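(* Let $\lambda>0$. The space $\mathrm{bmo}(\mathbb{R}_\lambda)$ is a proper subspace of $\mathrm{BMO}_{\Delta_\lambda}(\mathbb{R}_\lambda)$, i.e. $$\mathrm{bmo}(\mathbb{R}_\lambda)\subsetneq\mathrm{BMO}_{\Delta_\lambda}(\mathbb{R}_\lambda).$$
   Context: Fix $\lambda>0$. $\mathbb{R}_+=(0,\infty)$, $dm_\lambda(x)=x^{2\lambda}\,dx$, $d\mu_\lambda(x_1,x_2)=dm_\lambda(x_1)\,dm_\lambda(x_2)$, and $\mathbb{R}_\lambda=(\mathbb{R}_+\times\mathbb{R}_+,d\mu_\lambda)$. Little bmo: a function $b\in L^1_{loc}(\mathbb{R}_\lambda)$ is in $\mathrm{bmo}(\mathbb{R}_\lambda)$ if $$\|b\|_{\mathrm{bmo}(\mathbb{R}_\lambda)}:=\sup_{R}\frac1{\mu_\lambda(R)}\iint_R|b-m_R(b)|\,d\mu_\lambda<\infty,\qquad m_R(b)=\frac1{\mu_\lambda(R)}\iint_R b\,d\mu_\lambda,$$ the supremum being over all rectangles $R=I\times J\subset\mathbb{R}_+\times\mathbb{R}_+$ with $I,J$ bounded intervals. Product BMO. $\mathrm{BMO}_{\Delta_\lambda}(\mathbb{R}_\lambda)$ is the product BMO space $\mathrm{BMO}(X_1\times X_2)$ for $X_1=X_2=(\mathbb{R}_+,|\cdot|,dm_\lambda)$, which is defined as follows for spaces of homogeneous type $(X_i,d_i,\mu_i)$ ($d_i$ a quasi-metric with $d_i(x,y)\le A_{0,i}(d_i(x,z)+d_i(z,y))$,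 $\mu_i$ a nonzero measure with $\mu_i(B(x,2r))\le C_{\mu_i}\mu_i(B(x,r))<\infty$). For one such space $(X,d,\mu)$ fix a small $\delta>0$ (e.g. $\delta\le 10^{-3}A_0^{-10}$) and nested sets $\mathscr{X}^k\subseteq\mathscr{X}^{k+1}$ ($k\in\mathbb{Z}$) of points $x^k_\alpha$ with $d(x^k_\alpha,x^k_\beta)\ge\delta^k$ for $\alpha\neq\beta$ and $\min_\alpha d(x,x^k_\alpha)<2A_0\delta^k$ for all $x\in X$; let $Q^k_\alpha$ be the Hytönen–Kairema dyadic cubes with centers $x_\alpha^k$ (for each $k$ a partition of $X$, nested in $k$, each cube of generation $k$ comparable to a ball of radius $\delta^k$ about its center). Put $\mathscr{Y}^k=\mathscr{X}^{k+1}\setminus\mathscr{X}^k$, with points labelled $y^k_\alpha$; for $\alpha\in\mathscr{Y}^k$, $Q^k_\alpha$ denotes the dyadic cube centered at $y^k_\alpha$ (a cube of side comparable to $\delta^k$). Let $\{\psi^k_\alpha:k\in\mathbb{Z},\alpha\in\mathscr{Y}^k\}$ be the Auscher–Hytönen orthonormal wavelet basis of $L^2(X)$: for some $\eta\in(0,1]$ and $a,\nu,C>0$, $|\psi^k_\alpha(x)|\le C\mu(B(y^k_\alpha,\delta^k))^{-1/2}\exp(-\nu(d(y^k_\alpha,x)/\delta^k)^a)$; $|\psi^k_\alpha(x)-\psi^k_\alpha(y)|\le C\mu(B(y^k_\alpha,\delta^k))^{-1/2}(d(x,y)/\delta^k)^\eta\exp(-\nu(d(y^k_\alpha,x)/\delta^k)^a)$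 if $d(x,y)\le\delta^k$; and $\int\psi^k_\alpha\,d\mu=0$. Test functions: fix $x_0\in X$, $r>0$, $\beta,\gamma\in(0,\eta)$; $G(\beta,\gamma)$ consists of $f$ with $|f(x)|\le C\,\omega(x)$ and $|f(x)-f(y)|\le C\big(\tfrac{d(x,y)}{r+d(x,x_0)}\big)^{\beta}\omega(x)$ when $d(x,y)\le (r+d(x,x_0))/(2A_0)$, where $\omega(x)=\frac{1}{\mu(B(x_0,r))+\mu(B(x,d(x,x_0)))}\big(\tfrac{r}{r+d(x,x_0)}\big)^{\gamma}$; the least $C$ is the norm; $\mathring G(\beta,\gamma)$ is the closure in $G(\beta,\gamma)$ of the mean-zero functions of $G(\eta,\eta)$. The product test space on $X_1\times X_2$ consists of $f(x_1,x_2)$ that are, in each variable separately, such test functions with values in the test function space of the other variable; distributions are elements of its dual. Then $\mathrm{BMO}(X_1\times X_2)$ is the set of distributions $f$ with $\|f\|_{\mathrm{BMO}(X_1\times X_2)}:=\mathcal{C}(f)<\infty$, where $$\mathcal{C}(f)=\sup_\Omega\Big\{\frac1{\mu(\Omega)}\sum_{\substack{R=Q^{k_1}_{\alpha_1}\times Q^{k_2}_{\alpha_2}\subset\Omega\\ k_i\in\mathbb{Z},\ \alpha_i\in\mathscr{Y}^{k_i}}}|\langle\psi^{k_1}_{\alpha_1}\psi^{k_2}_{\alpha_2},f\rangle|^2\Big\}^{1/2},$$ with $\mu=\mu_1\times\mu_2$ and $\Omega$ ranging over all open subsets of $X_1\times X_2$ of finite measure. *)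

(* Defs.v *)
From HB Require Import structures.
From mathcomp Require Import all_boot all_order all_algebra.
From mathcomp Require Import all_classical all_reals all_analysis.
From mathcomp Require Import measurable_realfun.

Set Implicit Arguments.
Unset Strict Implicit.
Unset Printing Implicit Defensive.

Import Order.TTheory GRing.Theory Num.Theory.
Import numFieldNormedType.Exports.

Local Open Scope classical_set_scope.
Local Open Scope ring_scope.

(* The space (R_+, |x - y|, m_lambda) lives on the carrier set [Rplus] inside
   the type R.  Functions on R_+ are functions on R whose values off R_+ are
   never used, and the quasi-metric constant A_0 is 1.  Functions are
   real-valued, and measurable means Borel measurable. *)

Definition Rplus (R : realType) : set R := [set x | 0 < x].
Arguments Rplus : clear implicits.

Definition quadrant (R : realType) : set (R * R) := Rplus R `*` Rplus R.
Arguments quadrant : clear implicits.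

Section bessel_measure.
Context {R : realType}.
Local Open Scope ereal_scope.

(* dm_lambda = x^(2 lambda) dx on R_+, extended by zero to R; hence
   m_lambda(B(x, r)) is the mass of the ball of R_+. *)
Definition bessel_measure (lambda : R) (A : set R) : \bar R :=
  \int[lebesgue_measure]_(x in A `&` Rplus R) (x `^ (2 * lambda))%:E.

Variable lambda : R.
Local Notation m := (bessel_measure lambda).

Let measurable_Rplus : measurable (Rplus R).
Proof.
rewrite (_ : Rplus R = `]0%R, +oo[%classic) //.
by apply/seteqP; split => x; rewrite /Rplus /= in_itv /= andbT.
Qed.

Let measurable_weight (A : set R) :
  measurable_fun A (fun x : R => (x `^ (2 * lambda))%:E).
Proof.
apply/measurable_EFinP; apply: measurable_funTS; exact: measurable_powR.
Qed.

Let bessel_measure0 : m set0 = 0.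
Proof. by rewrite /bessel_measure set0I integral_set0. Qed.

Let bessel_measure_ge0 A : 0 <= m A.
Proof. by apply: integral_ge0 => x _; rewrite lee_fin powR_ge0. Qed.

Let bessel_measure_sigma_additive : semi_sigma_additive m.
Proof.
move=> F mF tF mUF; rewrite /bessel_measure setI_bigcupl.
rewrite ge0_integral_bigcup //=.
- apply: is_cvg_ereal_nneg_natsum_cond => n _ _.
  by apply: integral_ge0 => x _; rewrite lee_fin powR_ge0.
- by move=> k; apply: measurableI; [exact: mF | exact: measurable_Rplus].
- exact: measurable_weight.
- by move=> x _; rewrite lee_fin powR_ge0.
- exact: trivIset_setIr.
Qed.

HB.instance Definition _ := isMeasure.Build _ _ _
  m bessel_measure0 bessel_measure_ge0 bessel_measure_sigma_additive.

Let bessel_measure_sigma_finite : sigma_finite setT m.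
Proof.
pose F (n : nat) : set R :=
  `]-oo, n%:R]%classic `&` [set x | x `^ (2 * lambda) <= n%:R]%R.
have mF n : measurable (F n).
  apply: measurableI => //.
  rewrite (_ : [set _ | _] =
      setT `&` (@powR R ^~ (2 * lambda)%R) @^-1` `]-oo, n%:R]%classic).
    exact: measurable_powR.
  by rewrite setTI; apply/seteqP; split => x /=; rewrite in_itv.
exists F.
  apply/esym/seteqP; split=> // x _.
  exists (maxn (Num.truncn `|x|).+1 (Num.truncn (x `^ (2 * lambda))).+1) => //.
  split; rewrite /= ?in_itv /=.
    rewrite (le_trans (ler_norm _))//.
    rewrite (le_trans (ltW (truncnS_gt _)))// ler_nat leq_max leqnn //.
  rewrite (le_trans (ltW (truncnS_gt _)))// ler_nat leq_max leqnn orbT //.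
move=> n; split => //.
have mFR : measurable (F n `&` Rplus R).
  by apply: measurableI; [exact: mF | exact: measurable_Rplus].
apply: (@le_lt_trans _ _
  (\int[lebesgue_measure]_(x in F n `&` Rplus R) (n%:R : R)%:E)).
  apply: ge0_le_integral => //=.
  - by move=> x _; rewrite lee_fin powR_ge0.
  - exact: measurable_weight.
  - by move=> x [[_ xn] _]; rewrite lee_fin.
rewrite integral_cst // lte_mul_pinfty //.
apply: (@le_lt_trans _ _ (lebesgue_measure `[0%R, n%:R : R]%classic)).
  apply: le_measure; rewrite ?inE//.
  move=> x [[+ _] +]; rewrite /= !in_itv /= => -> /ltW.
  by rewrite /= => ->.
by rewrite lebesgue_measure_itv /=; case: ifPn => // _; rewrite -EFinD ltry.
Qed.

HB.instance Definition _ :=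
  Measure_isSigmaFinite.Build _ _ _ m bessel_measure_sigma_finite.

Definition bessel_measure2 : set (R * R) -> \bar R := m \x m.

HB.instance Definition _ := Measure.on bessel_measure2.

End bessel_measure.

Section little_bmo.
Context {R : realType}.
Variable lambda : R.
Local Notation mu := (bessel_measure2 lambda).

Definition locally_integrable2 (b : R * R -> R) : Prop :=
  measurable_fun (quadrant R) b /\
  forall K : set (R * R), compact K -> K `<=` quadrant R ->
    mu.-integrable K (EFin \o b).

Definition rectangles : set (set (R * R)) :=
  [set Q | exists I J : set R,
    [/\ is_interval I /\ is_interval J,
        bounded_set I /\ bounded_set J,
        I `<=` Rplus R /\ J `<=` Rplus R,
        Q = I `*` J & (0 < mu Q)%E]].

Definition mean (b : R * R -> R) (Q : set (R * R)) : R :=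
  (fine (mu Q))^-1 * \int[mu]_(z in Q) b z.

Definition bmo_norm (b : R * R -> R) : \bar R :=
  ereal_sup [set ((fine (mu Q))^-1%:E *
    \int[mu]_(z in Q) `|b z - mean b Q|%:E)%E | Q in rectangles].

Definition bmo : set (R * R -> R) :=
  [set b | locally_integrable2 b /\ (bmo_norm b < +oo)%E].

End little_bmo.

(* The points x^k_alpha serve as their own labels: [center k] is the set X^k,
   and [cube k x] is the cube of generation k centered at x in X^k. *)
Record dyadic_system (R : realType) := DyadicSystem {
  delta : R;
  delta_gt0 : 0 < delta;
  delta_small : delta <= 10%:R ^- 3;
  center : int -> set R;
  center_sub : forall k, center k `<=` Rplus R;
  center_nested : forall k, center k `<=` center (k + 1);
  center_separated : forall k x y, center k x -> center k y -> x <> y ->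
    delta ^ k <= `|x - y|;
  center_dense : forall k x, Rplus R x ->
    exists2 z, center k z & `|x - z| < 2 * delta ^ k;
  cube : int -> R -> set R;
  cube_measurable : forall k x, center k x -> measurable (cube k x);
  cube_cover : forall k, \bigcup_(x in center k) cube k x = Rplus R;
  cube_disjoint : forall k, trivIset (center k) (cube k);
  cube_nested : forall (k l : int) x z, k <= l -> center k x -> center l z ->
    cube l z `<=` cube k x \/ cube l z `&` cube k x = set0;
  cube_ball : exists c C : R, [/\ 0 < c, 0 < C & forall k x, center k x ->
    ball x (c * delta ^ k) `&` Rplus R `<=` cube k x /\
    cube k x `<=` ball x (C * delta ^ k)]
}.

Section wavelets.
Context {R : realType} (D : dyadic_system R).

(* The pairs (k, y) with y in Y^k = X^(k+1) \ X^k. *)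
Definition wavelet_index : set (int * R) :=
  [set i | (center D (i.1 + 1) `\` center D i.1) i.2].

(* A point of Y^k is a center of generation k + 1, not k, so the cube centered
   at it is the one of generation k + 1, of side comparable to delta^k. *)
Definition wavelet_cube (i : int * R) : set R := cube D (i.1 + 1) i.2.

End wavelets.

Record wavelet_basis (R : realType) (lambda : R) (D : dyadic_system R) :=
    WaveletBasis {
  eta : R;
  eta_gt0 : 0 < eta;
  eta_le1 : eta <= 1;
  psi : int * R -> R -> R;
  psi_regular : exists a nu C : R, [/\ 0 < a, 0 < nu, 0 < C &
    forall k y, wavelet_index D (k, y) ->
    let bound x := C
      * (Num.sqrt (fine (bessel_measure lambda (ball y (delta D ^ k)))))^-1
      * expR (- (nu * (`|y - x| / delta D ^ k) `^ a)) in
    (forall x, Rplus R x -> `|psi (k, y) x| <= bound x) /\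
    (forall x x', Rplus R x -> Rplus R x' -> `|x - x'| <= delta D ^ k ->
      `|psi (k, y) x - psi (k, y) x'| <=
      (`|x - x'| / delta D ^ k) `^ eta * bound x)];
  psi_mean0 : forall i, wavelet_index D i ->
    \int[bessel_measure lambda]_(x in Rplus R) psi i x = 0;
  psi_orthonormal : forall i j, wavelet_index D i -> wavelet_index D j ->
    \int[bessel_measure lambda]_(x in Rplus R) (psi i x * psi j x)
      = (i == j)%:R;
  psi_dense : forall f : R -> R, measurable_fun (Rplus R) f ->
    (\int[bessel_measure lambda]_(x in Rplus R) (f x ^+ 2)%:E < +oo)%E ->
    forall e : R, 0 < e ->
    exists (s : seq (int * R)) (c : int * R -> R),
      (forall i, i \in s -> wavelet_index D i) /\
      (\int[bessel_measure lambda]_(x in Rplus R)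
        ((f x - \sum_(i <- s) c i * psi i x) ^+ 2)%:E < e%:E)%E
}.

(* The parameters x_0, r, beta, gamma of a space of test functions. *)
Record test_type (R : realType) := TestType {
  basepoint : R;
  radius : R;
  regularity : R;
  decay : R
}.

Definition admissible (R : realType) (e : R) (p : test_type R) : Prop :=
  [/\ 0 < basepoint p, 0 < radius p,
      0 < regularity p < e & 0 < decay p < e].

(* The parameters of G(e, e), with the same x_0 and r. *)
Definition with_exponents (R : realType) (e : R) (p : test_type R) :=
  TestType (basepoint p) (radius p) e e.

Section test_functions.
Context {R : realType}.
Variable lambda : R.
Local Notation m := (bessel_measure lambda).

Definition test_weight (p : test_type R) (x : R) : R :=
  let: TestType x0 r _ gamma := p in
  (fine (m (ball x0 r)) + fine (m (ball x `|x - x0|)))^-1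
  * (r / (r + `|x - x0|)) `^ gamma.

(* [test_le p le_norm f C]: the V-valued function f lies in G(beta, gamma)
   with norm at most C, where [le_norm v c] means that v has norm at most c. *)
Definition test_le (p : test_type R) (V : zmodType) (le_norm : V -> R -> Prop)
    (f : R -> V) (C : R) : Prop :=
  let: TestType x0 r beta _ := p in
  (forall x, Rplus R x -> le_norm (f x) (C * test_weight p x)) /\
  (forall x y, Rplus R x -> Rplus R y ->
    `|x - y| <= (r + `|x - x0|) / 2 ->
    le_norm (f x - f y)
      (C * (`|x - y| / (r + `|x - x0|)) `^ beta * test_weight p x)).

Definition abs_le (v c : R) : Prop := `|v| <= c.

(* x_1 |-> f(x_1, .) is a test function with values in the test functions of
   x_2.  Unfolded, the four resulting bounds (size, increment in x_1, increment
   in x_2, mixed increment) are symmetric in the two variables. *)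
Definition product_test_le (p1 p2 : test_type R) (f : R -> R -> R) (C : R) :=
  test_le p1 (test_le p2 abs_le) f C.

Definition product_G (p1 p2 : test_type R) : set (R -> R -> R) :=
  [set f | exists C, product_test_le p1 p2 f C].

Definition product_test_norm (p1 p2 : test_type R) (f : R -> R -> R) : R :=
  inf [set C | product_test_le p1 p2 f C].

Definition mean_zero (f : R -> R -> R) : Prop :=
  (forall x1, Rplus R x1 -> \int[m]_(x2 in Rplus R) f x1 x2 = 0) /\
  (forall x2, Rplus R x2 -> \int[m]_(x1 in Rplus R) f x1 x2 = 0).

(* The closure in product_G p1 p2 of the functions of G(e1, e1; e2, e2) with
   mean zero in each variable. *)
Definition product_test (e1 e2 : R) (p1 p2 : test_type R) :
    set (R -> R -> R) :=
  [set f | product_G p1 p2 f /\ forall e : R, 0 < e ->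
    exists g, [/\ product_G (with_exponents e1 p1) (with_exponents e2 p2) g,
      mean_zero g, product_G p1 p2 (f - g) &
      product_test_norm p1 p2 (f - g) < e]].

(* A distribution is represented by a functional on all functions, of which
   only the values on the test functions matter. *)
Definition distribution (e1 e2 : R) (p1 p2 : test_type R) :
    set ((R -> R -> R) -> R) :=
  [set F |
    (forall (a : R) f g, product_test e1 e2 p1 p2 f ->
      product_test e1 e2 p1 p2 g ->
      F (fun x1 x2 => a * f x1 x2 + g x1 x2) = a * F f + F g) /\
    exists K : R, forall f, product_test e1 e2 p1 p2 f ->
      `|F f| <= K * product_test_norm p1 p2 f].

End test_functions.

Section product_bmo.
Context {R : realType}.
Variable lambda : R.
Context {D1 D2 : dyadic_system R}.
Variables (W1 : wavelet_basis lambda D1) (W2 : wavelet_basis lambda D2).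
Local Notation mu := (bessel_measure2 lambda).

Definition wavelet_coef (F : (R -> R -> R) -> R) (i : (int * R) * (int * R)) :
    R :=
  F (fun x1 x2 => psi W1 i.1 x1 * psi W2 i.2 x2).

Definition product_bmo_norm (F : (R -> R -> R) -> R) : \bar R :=
  ereal_sup [set sqrte ((fine (mu Omega))^-1%:E *
      \esum_(i in [set i | [/\ wavelet_index D1 i.1, wavelet_index D2 i.2 &
          wavelet_cube D1 i.1 `*` wavelet_cube D2 i.2 `<=` Omega]])
        (`|wavelet_coef F i| ^+ 2)%:E)%E
    | Omega in [set Omega : set (R * R) |
        [/\ open Omega, Omega `<=` quadrant R & (mu Omega < +oo)%E]]].

Definition product_BMO (p1 p2 : test_type R) : set ((R -> R -> R) -> R) :=
  [set F | distribution lambda (eta W1) (eta W2) p1 p2 F /\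
           (product_bmo_norm F < +oo)%E].

(* The distributions f |-> \iint b f dmu_lambda, for b in bmo. *)
Definition bmo_distributions (p1 p2 : test_type R) :
    set ((R -> R -> R) -> R) :=
  [set F | exists2 b, bmo lambda b &
    forall f, product_test lambda (eta W1) (eta W2) p1 p2 f ->
      F f = \int[mu]_(z in quadrant R) (b z * f z.1 z.2)].

End product_bmo.

(* Main.v *)
(** Inclusion.  For b in bmo the form B(f, h) = \iint b(x1, x2) f(x1) h(x2)
    differs on functions supported in intervals I and J by at most
    N |f|_oo |h|_oo mu(I x J) from the mean of b over I x J times the integrals
    of f and h.  In one variable, a functional with this property satisfies a
    Carleson estimate against the wavelets: split the wavelets into compactly
    supported mean-zero atoms, replace the functional on an interval by
    integration against a bisection step function, whose square oscillation is
    controlled by John-Nirenberg, and use that atoms are almost orthogonal.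
    In two variables, freeze the second wavelet: B(., psi_J) acts on the atoms
    in x1 through step functions whose values t_A = B(1_A, psi_J) / m(A) are, as
    functions of J, coefficients of functionals in x2 with the same bound N.
    Almost orthogonality in x1 and the Carleson estimate in x2 at each fixed x1
    then give the product Carleson condition on every open set.  The pairing
    with test functions converges because the means of b over dyadic rectangles
    at the origin grow linearly in the number of doublings.

    Strictness.  The distribution log x1 (x) log x2 satisfies the product
    Carleson condition, since log is in one-parameter BMO.  It is not given by
    a bmo function: on tent_n (x) h, with tent_n an L^1-normalized bump at
    scale 2^-n and h of mean zero, a bmo form stays bounded, while the
    logarithm grows like n. *)
Require Import Defs.
From mathcomp Require Import all_boot all_order all_algebra.
From mathcomp Require Import all_classical all_reals all_analysis.
From mathcomp Require Import measurable_realfun.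
From mathcomp Require Import ring lra zify.

Set Implicit Arguments.
Unset Strict Implicit.
Unset Printing Implicit Defensive.

Import Order.TTheory GRing.Theory Num.Theory.
Import numFieldNormedType.Exports.

Local Open Scope classical_set_scope.
Local Open Scope ring_scope.

(** * Balls and intervals for the measure m_lambda *)

(** Two obstacles shape the proof. The oscillation property only speaks of functions supported in an
    interval, whereas wavelets have unbounded support. So a wavelet is cut at distances 2^l scales,
    every estimate for atoms supported within L scales is kept polynomial in L, and the decay of the
    wavelet, faster than any power of 2^-l, pays for L = 2^(l+1). Secondly, a frozen form B(.,
    psi_J) is only a functional, never identified with a function. Its means over intervals give
    step functions of every finite depth; all bounds are uniform in the depth, and the limit is
    taken at the end, where the continuity of the atoms is used. For strictness a function of one
    variable is no candidate, because functions that have mean zero in each variable annihilate it;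
    in particular log x1 + log x2 is invisible. The product of the logarithms is not annihilated.
    The testing functions must have mean zero as well, so the bump at scale 2^-n is compensated by a
    fixed bump at scale 1. *)

Ltac pos := first [ lazymatch goal with
  | H : is_true (0 < ?x) |- is_true (0 < ?x) => exact: H
  | H : is_true (0 <= ?x) |- is_true (0 <= ?x) => exact: H
  | H : is_true (0 < ?x) |- is_true (0 <= ?x) => exact: (ltW H)
  | |- is_true (0 < _ ^+ _) => apply: exprn_gt0; pos
  | |- is_true (0 <= _ ^+ 2) => apply: sqr_ge0
  | |- is_true (0 <= _ ^+ _) => apply: exprn_ge0; pos
  | |- is_true (0 < _ * _) => apply: mulr_gt0; pos
  | |- is_true (0 <= _ * _) => apply: mulr_ge0; pos
  | |- is_true (0 < _ `^ _) => apply: powR_gt0; pos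
  | |- is_true (0 <= _ `^ _) => apply: powR_ge0
  | |- is_true (0 < _^-1) => rewrite invr_gt0; pos
  | |- is_true (0 <= _^-1) => rewrite invr_ge0; pos
  | |- is_true (0 < exprz _ _) => apply: exprz_gt0; pos
  | |- is_true (0 <= exprz _ _) => apply: exprz_ge0; pos
  | |- is_true (0 <= Num.sqrt _) => apply: sqrtr_ge0
  | |- is_true (0 <= `|_|) => apply: normr_ge0
  | |- is_true (0 < _%:R) => by []
  | |- is_true (0 <= _%:R) => by []
  | |- is_true (0 < _ - _) => lra
  | |- is_true (0 <= _ - _) => lra
  | |- is_true (0 < _ + _) => apply: addr_gt0; pos
  | |- is_true (0 <= _ + _) => apply: addr_ge0; pos
  end | done | by apply: ltW | lra ].

Section geometry.
Context {R : realType}.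
Variables (lambda : R) (lambda_gt0 : 0 < lambda).
Local Notation m := (bessel_measure lambda).

Lemma measurable_Rplus : measurable (Rplus R).
Proof.
rewrite (_ : Rplus R = `]0%R, +oo[%classic) //.
by apply/seteqP; split => x; rewrite /Rplus /= in_itv /= andbT.
Qed.

Lemma bessel_measure_setIRplus (A : set R) : m (A `&` Rplus R) = m A.
Proof. by rewrite /bessel_measure -setIA setIid. Qed.

Let mw (A : set R) : measurable_fun A (fun x : R => (x `^ (2 * lambda))%:E).
Proof.
apply/measurable_EFinP; apply: measurable_funTS; exact: measurable_powR.
Qed.

Lemma bessel_measure_le (A : set R) (d l : R) : measurable A -> 0 <= d ->
  (forall x, A x -> Rplus R x -> x `^ (2 * lambda) <= d) ->
  (lebesgue_measure A <= l%:E)%E -> (m A <= (d * l)%:E)%E.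
Proof.
move=> mA d0 Ad Al; rewrite /bessel_measure.
have mI : measurable (A `&` Rplus R) by apply: measurableI => //; exact: measurable_Rplus.
apply: (@le_trans _ _ (\int[lebesgue_measure]_(x in A `&` Rplus R) d%:E)%E).
  apply: ge0_le_integral => //=.
  - by move=> x _; rewrite lee_fin powR_ge0.
  - exact: mw.
  - by move=> x [Ax x0]; rewrite lee_fin Ad.
rewrite integral_cst// EFinM; apply: lee_wpmul2l; rewrite ?lee_fin//.
by apply: le_trans Al; apply: le_measure; rewrite ?inE.
Qed.

Lemma bessel_measure_ge (A B : set R) (d : R) : measurable A -> measurable B ->
  0 <= d -> B `<=` A `&` Rplus R ->
  (forall x, B x -> d <= x `^ (2 * lambda)) ->
  (d%:E * lebesgue_measure B <= m A)%E.
Proof.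
move=> mA mB d0 BA Bd; rewrite /bessel_measure -integral_cst//.
have mI : measurable (A `&` Rplus R) by apply: measurableI => //; exact: measurable_Rplus.
apply: (@le_trans _ _ (\int[lebesgue_measure]_(x in B) (x `^ (2 * lambda))%:E)%E).
  by apply: ge0_le_integral => //=; exact: mw.
apply: ge0_subset_integral => //=; first exact: mw.
by move=> x _; rewrite lee_fin powR_ge0.
Qed.

Lemma lebesgue_itvoo_le (a b : R) : a <= b ->
  lebesgue_measure (`]a, b[%classic : set R) = (b - a)%:E.
Proof.
rewrite le_eqVlt => /predU1P[->|ab]; rewrite lebesgue_measure_itv /= lte_fin.
  by rewrite ltxx subrr.
by rewrite ab.
Qed.

Lemma lebesgue_itvoc_le (a b : R) : a <= b ->
  lebesgue_measure (`]a, b]%classic : set R) = (b - a)%:E.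
Proof.
rewrite le_eqVlt => /predU1P[->|ab]; rewrite lebesgue_measure_itv /= lte_fin.
  by rewrite ltxx subrr.
by rewrite ab.
Qed.

Lemma bessel_measure_lty (A : set R) (b : R) : measurable A ->
  (forall x, A x -> x <= b) -> (m A < +oo)%E.
Proof.
move=> mA Ab; wlog b0 : b Ab / 0 <= b.
  move=> /(_ (Num.max b 0)); apply; last by rewrite le_max lexx orbT.
  by move=> x /Ab; rewrite le_max => ->.
rewrite -bessel_measure_setIRplus.
apply: (@le_lt_trans _ _ (m `]0, b])).
  apply: le_measure; rewrite ?inE//.
    by apply: measurableI => //; exact: measurable_Rplus.
  by move=> x [/Ab xb x0]; rewrite /= in_itv/= xb andbT.
apply: le_lt_trans (ltry (b `^ (2 * lambda) * b)).
apply: bessel_measure_le => //.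
- exact: powR_ge0.
- move=> x; rewrite /= in_itv/= => /andP[_ xb] x0.
  by apply: ge0_ler_powR => //; rewrite ?nnegrE ?mulr_ge0 ?ltW.
- by rewrite lebesgue_itvoc_le// subr0.
Qed.

(** [fine] sends an infinite measure to 0, so [vol] is meaningful only on sets bounded above, on
    which m_lambda is finite. This is why later lemmas carry an upper bound [b] or [X] for the
    points of a set. *)
Definition vol (A : set R) : R := fine (m A).

Lemma vol_ge0 A : 0 <= vol A.
Proof. by rewrite fine_ge0. Qed.

Lemma vol_setIRplus A : vol (A `&` Rplus R) = vol A.
Proof. by rewrite /vol bessel_measure_setIRplus. Qed.

Lemma volE (A : set R) (b : R) : measurable A ->
  (forall x, A x -> x <= b) -> (vol A)%:E = m A.
Proof.
move=> mA Ab; rewrite /vol fineK// ge0_fin_numE//.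
exact: bessel_measure_lty Ab.
Qed.

Lemma le_vol (A B : set R) (b : R) : measurable A -> measurable B ->
  A `&` Rplus R `<=` B -> (forall x, B x -> x <= b) -> vol A <= vol B.
Proof.
move=> mA mB AB Bb; rewrite -lee_fin (volE mB Bb).
have mI : measurable (A `&` Rplus R) by apply: measurableI => //; exact: measurable_Rplus.
rewrite /vol -bessel_measure_setIRplus -/(vol (A `&` Rplus R)) (@volE _ b)//.
  by apply: le_measure; rewrite ?inE.
by move=> x /AB/Bb.
Qed.

Lemma ball_le (x r z : R) : ball x r z -> z <= x + r.
Proof. by rewrite ball_itv /= in_itv /= => /andP[_ /ltW]. Qed.

Lemma mball (x r : R) : measurable (ball x r : set R).
Proof. by rewrite ball_itv. Qed.
Hint Resolve mball : core.

Lemma vol_ball_le (x r : R) : 0 < x -> 0 < r ->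
  vol (ball x r) <= 2 * r * (x + r) `^ (2 * lambda).
Proof.
move=> x0 r0; rewrite -lee_fin (volE (mball x r) (@ball_le x r)) mulrC.
apply: bessel_measure_le => //.
- exact: powR_ge0.
- move=> z /ball_le zb z0.
  by apply: ge0_ler_powR => //; rewrite ?nnegrE ?mulr_ge0 ?addr_ge0 ?ltW.
- rewrite ball_itv lebesgue_itvoo_le ?lee_fin; lra.
Qed.

(** The interval (x + r/2, x + r) lies in R_+ even when the ball crosses the origin, and on it the
    density is at least its value at (x + r)/2. *)
Lemma vol_ball_ge (x r : R) : 0 < x -> 0 < r ->
  r / 2 * ((x + r) / 2) `^ (2 * lambda) <= vol (ball x r).
Proof.
move=> x0 r0; rewrite -lee_fin (volE (mball x r) (@ball_le x r)) mulrC EFinM.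
have -> : (r / 2)%:E = lebesgue_measure (`](x + r / 2), (x + r)[%classic : set R).
  by rewrite lebesgue_itvoo_le; [congr EFin; lra|lra].
apply: bessel_measure_ge => //; first exact: powR_ge0.
- move=> z; rewrite ball_itv /= /Rplus /= !in_itv /= => /andP[h1 h2]; split; first by apply/andP; lra.
  lra.
- move=> z /=; rewrite in_itv /= => /andP[h1 h2].
  by apply: ge0_ler_powR => //; rewrite ?nnegrE ?mulr_ge0 ?addr_ge0 ?ltW//; lra.
Qed.

Lemma vol_ball_gt0 (x r : R) : 0 < x -> 0 < r -> 0 < vol (ball x r).
Proof.
move=> x0 r0; apply: lt_le_trans (vol_ball_ge x0 r0).
by rewrite mulr_gt0 ?powR_gt0 ?divr_gt0 ?addr_gt0.
Qed.

(** A natural number above the homogeneous dimension 2 lambda + 1, so that volume ratios are bounded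
    by integer powers. *)
Definition hdim : nat := (Num.truncn (2 * lambda)).+2.

Lemma powR_le_hdim (L : R) : 1 <= L -> L `^ (2 * lambda) * L <= L ^+ hdim.
Proof.
move=> L1; rewrite /hdim exprSr ler_pM2r; last by apply: lt_le_trans L1.
rewrite -powR_mulrn; last by apply: le_trans L1.
by apply: ler_powR => //; rewrite ltW// truncnS_gt.
Qed.

(** The volume of ball(x, r) is comparable to r (x + r)^(2 lambda), and x + L r <= L (x + r). *)
Lemma doubling : exists C : R, 1 <= C /\ forall x r L : R, 0 < x -> 0 < r -> 1 <= L ->
  vol (ball x (L * r)) <= C * L ^+ hdim * vol (ball x r).
Proof.
exists (4 * 2 `^ (2 * lambda)); split.
  have : 1 <= (2 : R) `^ (2 * lambda).
    by rewrite -[leLHS](@powRr0 _ 2); apply: ler_powR; [lra|rewrite mulr_ge0// ltW].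
  by move=> h; lra.
move=> x r L x0 r0 L1; have L0 : 0 < L by apply: lt_le_trans L1.
apply: (le_trans (vol_ball_le x0 (mulr_gt0 L0 r0))).
apply: (@le_trans _ _ (2 * (L * r) * (L * (x + r)) `^ (2 * lambda))).
  apply: ler_wpM2l; first by rewrite !mulr_ge0// ltW.
  have l0 : 0 <= 2 * lambda by rewrite mulr_ge0 // ltW.
  by apply: ge0_ler_powR => //; rewrite ?nnegrE; nra.
apply: (@le_trans _ _ (4 * 2 `^ (2 * lambda) * L ^+ hdim *
    (r / 2 * ((x + r) / 2) `^ (2 * lambda)))); last first.
  apply: ler_wpM2l; last exact: vol_ball_ge.
  by pos.
rewrite powRM; [|pos|pos].
have -> : (x + r) `^ (2 * lambda) = 2 `^ (2 * lambda) * ((x + r) / 2) `^ (2 * lambda).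
  rewrite -powRM; [congr (_ `^ _); lra|pos|pos].
have := powR_le_hdim L1.
set A := 2 `^ _; set B := ((x + r) / 2) `^ _; set P := L `^ _; set Q := L ^+ _ => PQ.
have A0 : 0 <= A := powR_ge0 _ _.
have B0 : 0 <= B := powR_ge0 _ _.
have -> : 2 * (L * r) * (P * (A * B)) = (2 * r * A * B) * (P * L) by ring.
have -> : 4 * A * Q * (r / 2 * B) = (2 * r * A * B) * Q by field.
by apply: ler_wpM2l => //; pos.
Qed.

Lemma vol_itv_ge (a b : R) : 0 <= a -> a < b ->
  vol (ball ((a + b) / 2) ((b - a) / 2)) <= vol `]a, b].
Proof.
move=> a0 ab; apply: (@le_vol _ _ b) => //.
- by move=> z [+ _]; rewrite ball_itv /= !in_itv /= => /andP[h1 h2]; apply/andP; lra.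
- by move=> z /=; rewrite in_itv/= => /andP[].
Qed.

Lemma vol_itv_gt0 (a b : R) : 0 <= a -> a < b -> 0 < vol `]a, b].
Proof. by move=> a0 ab; apply: lt_le_trans (vol_itv_ge a0 ab); apply: vol_ball_gt0; lra. Qed.

Lemma vol_itv_split (a c b : R) : a <= c -> c <= b ->
  vol `]a, b] = vol `]a, c] + vol `]c, b].
Proof.
move=> ac cb; have cE (u v : R) : (vol `]u, v])%:E = m `]u, v].
  by apply: (@volE _ v) => // z /=; rewrite in_itv/= => /andP[].
apply/EFin_inj; rewrite EFinD !cE -measureU//; last first.
  by apply/seteqP; split => // z [/=]; rewrite !in_itv /= => /andP[_ h1] /andP[h2 _]; lra.
congr (m _); apply/seteqP; split => z /=; rewrite !in_itv/=.
  by move=> /andP[h1 h2]; case: (lerP z c) => h; [left|right]; apply/andP; lra.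
by move=> [|] /andP[h1 h2]; apply/andP; lra.
Qed.

Lemma vol_bisect : exists kappa : R, 1 <= kappa /\ forall a b, 0 <= a -> a < b ->
  vol `]a, b] <= kappa * vol `]a, (a + b) / 2] /\
  vol `]a, b] <= kappa * vol `](a + b) / 2, b].
Proof.
have [C [C1 dbl]] := doubling.
(* A half of (a, b] is, up to end points, a ball of radius (b - a)/4; dilated 8 times it contains
   (a, b]. *)
exists (C * 8 ^+ hdim); split.
  by rewrite mulr_ege1// exprn_ege1//; lra.
have main (a b u v : R) : 0 <= a -> a <= u -> u < v -> v <= b -> v - u = (b - a) / 2 ->
    vol `]a, b] <= C * 8 ^+ hdim * vol `]u, v].
  move=> a0 au uv vb uvE.
  apply: (@le_trans _ _ (vol (ball ((u + v) / 2) (8 * ((v - u) / 2))))).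
    apply: (le_vol _ _ _ (@ball_le _ _)) => //.
    by move=> z [+ _]; rewrite ball_itv /= !in_itv /= => /andP[h1 h2]; apply/andP; lra.
  apply: (le_trans (dbl _ _ _ _ _ _)); try lra.
  apply: ler_wpM2l; last by apply: vol_itv_ge; lra.
  by rewrite mulr_ge0 ?exprn_ge0//; lra.
by move=> a b a0 ab; split; apply: main; lra.
Qed.

Lemma vol_ball_shift (x y r s : R) : 0 < x -> 0 < y -> `|x - y| + r <= s ->
  vol (ball x r) <= vol (ball y s).
Proof.
move=> x0 y0 h; apply: (le_vol _ _ _ (@ball_le _ _)) => //.
move=> z [+ _]; rewrite !ball_itv /= !in_itv /= => /andP[h1 h2].
have := ler_norm (x - y); have := ler_norm (y - x); rewrite distrC => h3 h4.
by apply/andP; lra.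
Qed.

End geometry.
Arguments mball {R} x r.
#[export] Hint Resolve mball : core.

(** * Weights, dominated functions and functionals *)

Section weight.
Context {R : realType}.
Variables (lambda : R) (lambda_gt0 : 0 < lambda).
Local Notation m := (bessel_measure lambda).
Local Notation vol := (vol lambda).

(* Up to constants depending on the basepoint and the radius, every test
   weight with decay [g] is this function. *)
Definition wt (g x : R) : R := (1 + x) `^ (- (2 * lambda + 1 + g)).

Lemma wt_gt0 (g x : R) : 0 < x -> 0 < wt g x.
Proof. by move=> x0; apply: powR_gt0; lra. Qed.

Lemma powR_inv_base (x a : R) : 0 <= x -> (x^-1) `^ a = x `^ (- a).
Proof. by move=> x0; rewrite powRN -powR_inv1// -powRrM mulN1r powRN. Qed.

Lemma powRDp (x a b : R) : 0 < x -> x `^ (a + b) = x `^ a * x `^ b.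
Proof. by move=> x0; rewrite powRD// (gt_eqF x0) implybT. Qed.

(** With u = r + |x - x0|, the two ball volumes together are comparable to u^(2 lambda + 1), and u
    is comparable to 1 + x. The lower bound comes from the second ball when |x - x0| >= r and from
    the first one otherwise. *)
Lemma test_weight_bounds (p : test_type R) : 0 < basepoint p -> 0 < Defs.radius p ->
  0 < decay p -> exists c C : R, [/\ 0 < c, 0 < C & forall x, 0 < x ->
    c * wt (decay p) x <= test_weight lambda p x <= C * wt (decay p) x].
Proof.
case: p => x0 r b g /= x00 r0 g0.
pose D := 2 * lambda + 1.
have l0 : 0 <= 2 * lambda by pos.
have D0 : 0 < D by rewrite /D; lra.
pose k := 2 + x0 / r.
pose a := r / (1 + x0 + r).
pose A := r + x0 + 1.
have k0 : 0 < k by rewrite /k; pos.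
have a0 : 0 < a by rewrite /a; pos.
have A0 : 0 < A by rewrite /A; pos.
have main x : 0 < x -> let u := r + `|x - x0| in
    [/\ (u / 4) `^ D <= vol (ball x0 r) + vol (ball x `|x - x0|),
     vol (ball x0 r) + vol (ball x `|x - x0|) <= 4 * k `^ (2 * lambda) * u `^ D,
     a * (1 + x) <= u & u <= A * (1 + x)].
  move=> xp u; set d := `|x - x0|.
  have d0 : 0 <= d := normr_ge0 _.
  have d1 : x - x0 <= d := ler_norm _.
  have d2 : x0 - x <= d by rewrite /d distrC ler_norm.
  have d3 : d <= x + x0 by rewrite /d ler_norml; lra.
  have u0 : 0 < u by rewrite /u -/d; lra.
  have uE : u = r + d by [].
  have kr : x0 / r * r = x0 by field; rewrite gt_eqF.
  have uD (v : R) : 0 < v -> v `^ D = v `^ (2 * lambda) * v.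
    by move=> v0; rewrite /D powRDp// powRr1// ltW.
  split.
  - case: (lerP r d) => rd.
      rewrite -[leLHS]add0r; apply: lerD; first exact: vol_ge0.
      apply: le_trans (vol_ball_ge lambda_gt0 xp _); last by lra.
      rewrite uD; last by pos.
      rewrite mulrC; apply: ler_pM; [pos|pos|lra|].
      by apply: ge0_ler_powR; rewrite ?nnegrE; [pos|pos|pos|lra].
    rewrite -[leLHS]addr0; apply: lerD; last exact: vol_ge0.
    apply: le_trans (vol_ball_ge lambda_gt0 x00 r0).
    rewrite uD; last by pos.
    rewrite mulrC; apply: ler_pM; [pos|pos|lra|].
    by apply: ge0_ler_powR; rewrite ?nnegrE; [pos|pos|pos|lra].
  - rewrite uD//.
    have -> : 4 * k `^ (2 * lambda) * (u `^ (2 * lambda) * u) =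
       2 * u * (k * u) `^ (2 * lambda) + 2 * u * (k * u) `^ (2 * lambda).
      by rewrite powRM; [ring|pos|pos].
    have k1 : x0 <= (k - 2) * u.
      rewrite -{1}kr /k addrC addrA addNr add0r.
      apply: ler_wpM2l; [pos|lra].
    apply: lerD.
      apply: (le_trans (vol_ball_le lambda_gt0 x00 r0)).
      apply: ler_pM; [pos|pos|lra|].
      by apply: ge0_ler_powR; rewrite ?nnegrE; [pos|pos|pos|lra].
    have [dp|dn] := ltP 0 d.
      apply: (le_trans (vol_ball_le lambda_gt0 xp dp)).
      apply: ler_pM; [pos|pos|lra|].
      by apply: ge0_ler_powR; rewrite ?nnegrE; [pos|pos|pos|lra].
    rewrite (_ : ball x d = set0).
      by rewrite /vol measure0 /=; pos.
    by apply/seteqP; split => // z; rewrite ball_itv /= in_itv/=; lra.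
  - rewrite /a mulrAC ler_pdivrMr; last by lra.
    rewrite uE; nra.
  - rewrite /A uE; nra.
pose c1 := 4 * k `^ (2 * lambda).
have c10 : 0 < c1 by rewrite /c1; pos.
exists (c1^-1 * r `^ g * A `^ (- (D + g))), (4 `^ D * r `^ g * a `^ (- (D + g))); split; [pos|pos|].
move=> x xp; have [h1 h2 h3 h4] := main _ xp.
rewrite /test_weight -/(vol _) -/(vol _).
move: h1 h2 h3 h4; set u := r + `|x - x0|; set V := vol _ + vol _ => h1 h2 h3 h4.
have u0 : 0 < u by apply: lt_le_trans h3; pos.
have V0 : 0 < V by apply: lt_le_trans h1; pos.
have s0 : 0 < 1 + x by lra.
have -> : (r / u) `^ g = r `^ g * u `^ (- g).
  by rewrite powRM ?powR_inv_base//; pos.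
have Dg : u `^ (- (D + g)) = u `^ (- D) * u `^ (- g).
  by rewrite opprD powRDp.
have mon (v w : R) : 0 < v -> v <= w -> w `^ (- (D + g)) <= v `^ (- (D + g)).
  move=> v0 vw; have w0 : 0 < w := lt_le_trans v0 vw.
  rewrite !powRN lef_pV2 ?posrE; [|pos|pos].
  by apply: ge0_ler_powR; rewrite ?nnegrE; [pos|pos|pos|].
rewrite /wt -/D; apply/andP; split.
  have -> : c1^-1 * r `^ g * A `^ (- (D + g)) * (1 + x) `^ (- (D + g)) =
     c1^-1 * r `^ g * (A * (1 + x)) `^ (- (D + g)) by rewrite powRM ?mulrA//; pos.
  apply: (@le_trans _ _ (c1^-1 * r `^ g * u `^ (- (D + g)))).
    by apply: ler_wpM2l; [pos|exact: mon].
  rewrite Dg.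
  have -> : c1^-1 * r `^ g * (u `^ (- D) * u `^ (- g)) =
    (c1^-1 * u `^ (- D)) * (r `^ g * u `^ (- g)) by ring.
  apply: ler_wpM2r; first by pos.
  by rewrite powRN -invfM lef_pV2 ?posrE//; pos.
have -> : 4 `^ D * r `^ g * a `^ (- (D + g)) * (1 + x) `^ (- (D + g)) =
   4 `^ D * r `^ g * (a * (1 + x)) `^ (- (D + g)) by rewrite powRM ?mulrA//; pos.
apply: (@le_trans _ _ (4 `^ D * r `^ g * u `^ (- (D + g)))); last first.
  by apply: ler_wpM2l; [pos|apply: mon => //; pos].
rewrite Dg.
have -> : 4 `^ D * r `^ g * (u `^ (- D) * u `^ (- g)) =
    (4 `^ D * u `^ (- D)) * (r `^ g * u `^ (- g)) by ring.
apply: ler_wpM2r; first by pos.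
have <- : ((u / 4) `^ D)^-1 = 4 `^ D * u `^ (- D).
  rewrite powRM ?powR_inv_base; [|pos|pos|pos].
  by rewrite invfM (powRN 4) invrK -powRN mulrC.
by rewrite lef_pV2 ?posrE//; pos.
Qed.

End weight.

(** The tool for dyadic decompositions: at each point a single term [h i] has to dominate [f], and
    the layers need not be disjoint. *)
Lemma integral_le_nneseries d (T : measurableType d) (R : realType)
    (mu : {measure set T -> \bar R}) (D : set T) (f : T -> \bar R)
    (h : nat -> T -> \bar R) (c : nat -> R) (C : R) :
  measurable D -> measurable_fun D f -> (forall x, D x -> 0 <= f x)%E ->
  (forall i, measurable_fun D (h i)) -> (forall i x, D x -> 0 <= h i x)%E ->
  (forall x, D x -> exists i, f x <= h i x)%E ->
  (forall i, \int[mu]_(x in D) h i x <= (c i)%:E)%E ->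
  (forall n, \sum_(0 <= i < n) c i <= C) ->
  (\int[mu]_(x in D) f x <= C%:E)%E.
Proof.
move=> mD mf f0 mh h0 fh hc cC.
apply: (@le_trans _ _ (\int[mu]_(x in D) (\sum_(i <oo) h i x))%E).
  apply: ge0_le_integral => //.
  - by apply: ge0_emeasurable_sum => // *; exact: h0.
  - move=> x Dx; have [i fi] := fh x Dx; apply: (le_trans fi).
    apply: le_trans (nneseries_lim_ge i.+1 _); last by move=> *; exact: h0.
    rewrite big_nat_recr//= leeDr//.
    by rewrite sume_ge0// => k _; exact: h0.
rewrite integral_nneseries//; apply: lime_le.
  by apply: is_cvg_nneseries => n _ _; apply: integral_ge0 => x; exact: h0.
near=> n; apply: (@le_trans _ _ (\sum_(0 <= i < n) (c i)%:E)%E).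
  by apply: lee_sum => i _; exact: hc.
by rewrite sumEFin lee_fin.
Unshelve. all: by end_near. Qed.

Section functionals.
Context {R : realType}.
Variables (lambda : R) (lambda_gt0 : 0 < lambda).
Local Notation m := (bessel_measure lambda).
Local Notation vol := (vol lambda).
Local Notation wt := (wt lambda).

Lemma geometric_sum_le (q : R) n : 0 <= q < 1 ->
  \sum_(0 <= i < n) q ^+ i <= (1 - q)^-1.
Proof.
move=> /andP[q0 q1]; rewrite big_mkord.
have h : (1 - q) * (\sum_(i < n) q ^+ i) = 1 - q ^+ n.
  by rewrite -(opprB q) mulNr -subrX1 opprB.
rewrite -[leRHS]mulr1 -(@ler_pM2l _ (1 - q)) ?subr_gt0// mulrA divff ?mul1r; last first.
  by rewrite subr_eq0 gt_eqF.
rewrite h; have := exprn_ge0 n q0; lra.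
Qed.

(** [j] is the least exponent with x <= 2^j, so that 1 + x exceeds 2^j / 2, also for j = 0. The
    halving costs the factor [k]. *)
Lemma wt_dyadic (g : R) : 0 < g -> exists k, 0 < k /\ forall x, 0 < x ->
  exists j : nat, x <= 2 ^+ j /\ wt g x <= k * (2 `^ (- (2 * lambda + 1 + g))) ^+ j.
Proof.
move=> g0; set E := 2 * lambda + 1 + g.
have E0 : 0 < E by have := lambda_gt0; rewrite /E; lra.
exists (2 `^ E); split; first by pos.
move=> x x0.
have ex : exists j : nat, x <= 2 ^+ j.
  exists (Num.truncn x).+1; apply: (le_trans (ltW (truncnS_gt x))).
  rewrite -natrX ler_nat; exact/ltnW/ltn_expl.
case: (ex_minnP ex) => j xj jmin; exists j; split => //.
have -> : 2 `^ E * 2 `^ (- E) ^+ j = (2 ^+ j / 2) `^ (- E).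
  rewrite powRM; [|by pos..].
  rewrite powR_inv_base// opprK mulrC; congr (_ * _).
  have h2 : 0 <= (2 : R) by [].
  by rewrite -(powR_mulrn j (powR_ge0 2 (- E))) -(powR_mulrn j h2) -!powRrM mulrC.
rewrite /wt -/E !powRN lef_pV2 ?posrE; [|by pos..].
apply: ge0_ler_powR; rewrite ?nnegrE; [lra|by pos|lra|].
case: j xj jmin => [|j] xj jmin; first by rewrite expr0; lra.
rewrite exprS mulrAC divff// mul1r.
case: (lerP x (2 ^+ j)) => h; last by lra.
by have := jmin _ h; rewrite ltnn.
Qed.

Lemma measurable_wt (g : R) (A : set R) : measurable_fun A (wt g).
Proof.
apply: measurable_funTS; rewrite /wt.
apply: (measurableT_comp (measurable_powR _)) => //.
exact: measurable_funD.
Qed.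

Lemma bessel_measure_itv0_le (b : R) : 0 < b ->
  (m `]0%R, b]%classic <= (b `^ (2 * lambda + 1))%:E)%E.
Proof.
move=> b0; rewrite powRDp// powRr1; last exact: ltW.
apply: bessel_measure_le => //; first exact: powR_ge0.
- move=> x; rewrite /= in_itv/= => /andP[xp xb] _; have l0 := lambda_gt0.
  by apply: ge0_ler_powR => //; rewrite ?nnegrE; lra.
- by rewrite lebesgue_itvoc_le ?subr0// ltW.
Qed.

(** The interval (0, 2^j] has measure at most 2^(j (2 lambda + 1)), and the weight on layer j is of
    order 2^(-j (2 lambda + 1 + g)). This leaves a geometric series of ratio 2^(-g). *)
Lemma wt_integral_lty (g : R) : 0 < g ->
  (\int[m]_(x in Rplus R) (wt g x)%:E < +oo)%E.
Proof.
move=> g0; have [k [k0 wk]] := wt_dyadic g0.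
set rho := 2 `^ _ in wk.
pose q : R := 2 `^ (- g).
have q01 : 0 <= q < 1.
  rewrite powR_ge0 /= /q powRN invf_lt1 ?powR_gt0//.
  have p1 : (1 : R) `^ g = 1 by rewrite powR1.
  rewrite -[X in X < _]p1; apply: gt0_ltr_powR; rewrite ?nnegrE; lra.
apply: (@le_lt_trans _ _ (k / (1 - q))%:E); last exact: ltry.
apply: (@integral_le_nneseries _ _ _ m (Rplus R) _
  (fun j x => (k * rho ^+ j)%:E * (\1_(`]0, 2 ^+ j]%classic) x)%:E)%E (fun j => k * q ^+ j)).
- exact: measurable_Rplus.
- by apply/measurable_EFinP; exact: measurable_wt.
- by move=> x x0; rewrite lee_fin; exact/ltW/wt_gt0.
- move=> i; apply: measurable_funeM; apply/measurable_EFinP.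
  exact: measurable_indic.
- by move=> i x _; rewrite mule_ge0// lee_fin// /rho; pos.
- move=> x x0; have [j [xj wj]] := wk _ x0; exists j.
  rewrite indicE mem_set ?mule1 ?lee_fin//=.
  by rewrite in_itv/= xj andbT.
- move=> i; rewrite ge0_integralZl_EFin//; last 3 first.
  + exact: measurable_Rplus.
  + by apply/measurable_EFinP; exact: measurable_indic.
  + by rewrite /rho; pos.
  rewrite integral_indic//; last exact: measurable_Rplus.
  apply: (@le_trans _ _ ((k * rho ^+ i)%:E * ((2 ^+ i) `^ (2 * lambda + 1))%:E)%E).
    apply: lee_wpmul2l; first by rewrite lee_fin /rho; pos.
    have := @bessel_measure_itv0_le (2 ^+ i); rewrite -bessel_measure_setIRplus.
    by apply; pos.
  rewrite -EFinM lee_fin -mulrA; apply: ler_wpM2l; first by pos.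
  have h2 : 0 <= (2 : R) by [].
  rewrite /rho /q -(powR_mulrn i (powR_ge0 2 _)) -(powR_mulrn i (powR_ge0 2 (- g))).
  rewrite -(powR_mulrn i h2) -!powRrM -powRDp//.
  by apply: ler_powR; lra.
- move=> n; rewrite -mulr_sumr; apply: ler_wpM2l; first by pos.
  exact: geometric_sum_le.
Qed.

Definition dominated (g : R) (f : R -> R) : Prop :=
  measurable_fun (Rplus R) f /\ exists C, forall x, 0 < x -> `|f x| <= C * wt g x.

(** Boundedness in a weighted sup norm. The dominated functions include wavelets, indicators of
    bounded intervals and test functions, so all of these can be fed to one functional. [C] is an
    arbitrary majorant, so that no norm of [f] has to be defined. *)
Definition dominated_functional (g : R) (L : (R -> R) -> R) (K : R) : Prop :=
  (forall a f h, dominated g f -> dominated g h ->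
    L (fun x => a * f x + h x) = a * L f + L h) /\
  (forall C f, dominated g f -> (forall x, 0 < x -> `|f x| <= C * wt g x) ->
    `|L f| <= C * K).

Definition Int (f : R -> R) : R := \int[m]_(x in Rplus R) f x.

Section dominated.
Variables (g : R) (g_gt0 : 0 < g).

Lemma dominated_lin (a : R) f h : dominated g f -> dominated g h ->
  dominated g (fun x => a * f x + h x).
Proof.
move=> [mf [C Cf]] [mh [C' Ch]]; split.
  by apply: measurable_funD => //; exact: measurable_funM.
exists (`|a| * C + C') => x x0.
apply: (le_trans (ler_normD _ _)); rewrite mulrDl -mulrA normrM.
by apply: lerD; [apply: ler_wpM2l => //; exact: Cf|exact: Ch].
Qed.

Lemma dominated0 : dominated g (fun=> 0).
Proof. by split; [exact: measurable_cst|exists 0 => x x0; rewrite normr0 mul0r]. Qed.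

Lemma dominatedZ (a : R) f : dominated g f -> dominated g (fun x => a * f x).
Proof.
move=> df; have := dominated_lin a df dominated0.
by congr dominated; apply/funext => x; rewrite addr0.
Qed.

Lemma dominatedD f h : dominated g f -> dominated g h -> dominated g (fun x => f x + h x).
Proof.
move=> df dh; have := dominated_lin 1 df dh.
by congr dominated; apply/funext => x; rewrite mul1r.
Qed.

Lemma dominatedN f : dominated g f -> dominated g (fun x => - f x).
Proof.
by move=> df; have := dominatedZ (-1) df; congr dominated; apply/funext => x; rewrite mulN1r.
Qed.

Lemma dominatedB f h : dominated g f -> dominated g h -> dominated g (fun x => f x - h x).
Proof. by move=> df dh; apply: dominatedD => //; exact: dominatedN. Qed.

Lemma dominatedM (M : R) (f h : R -> R) : dominated g f -> measurable_fun (Rplus R) h ->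
  (forall x, 0 < x -> `|h x| <= M) -> dominated g (fun x => f x * h x).
Proof.
move=> [mf [C Cf]] mh hM; split; first exact: measurable_funM.
exists (C * M) => x x0; rewrite normrM mulrAC.
by apply: ler_pM => //; [exact: Cf|exact: hM].
Qed.

Lemma dominated_sum (I : Type) (s : seq I) (P : pred I) (f : I -> R -> R) :
  (forall i, P i -> dominated g (f i)) -> dominated g (fun x => \sum_(i <- s | P i) f i x).
Proof.
move=> df; elim: s => [|i s IH].
  by have := dominated0; congr dominated; apply/funext => x; rewrite big_nil.
case Pi : (P i); last first.
  by move: IH; congr dominated; apply/funext => x; rewrite big_cons Pi.
have := dominatedD (df _ Pi) IH; congr dominated; apply/funext => x.
by rewrite big_cons Pi.
Qed.

Lemma wt_ge (X x : R) : 0 < x -> x <= X -> wt g X <= wt g x.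
Proof.
have l0 := lambda_gt0; have g0 := g_gt0; move=> x0 xX; rewrite /wt !powRN lef_pV2 ?posrE; [|by apply: powR_gt0; lra..].
by apply: ge0_ler_powR; rewrite ?nnegrE; lra.
Qed.

Lemma wt_bounded (X M : R) (f : R -> R) : 0 < X ->
  (forall x, 0 < x -> `|f x| <= M) -> (forall x, X < x -> f x = 0) ->
  forall x, 0 < x -> `|f x| <= M / wt g X * wt g x.
Proof.
move=> X0 fM fX x x0; have w0 : 0 < wt g x by apply: wt_gt0.
have wX : 0 < wt g X by apply: wt_gt0.
have M0 : 0 <= M by apply: le_trans (fM _ x0).
case: (lerP x X) => xX; last by rewrite fX// normr0; pos.
apply: (le_trans (fM _ x0)); rewrite mulrAC ler_pdivlMr//.
by apply: ler_wpM2l => //; exact: wt_ge.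
Qed.

Lemma dominated_bounded (X M : R) (f : R -> R) : 0 < X -> measurable_fun (Rplus R) f ->
  (forall x, 0 < x -> `|f x| <= M) -> (forall x, X < x -> f x = 0) -> dominated g f.
Proof. by move=> X0 mf fM fX; split => //; exists (M / wt g X); exact: wt_bounded. Qed.

Lemma dominated_indic (A : set R) (X : R) : measurable A ->
  (forall x, A x -> x <= X) -> dominated g (\1_A).
Proof.
move=> mA AX; apply: (@dominated_bounded (Num.max 1 X) 1).
- by rewrite lt_max ltr01.
- exact: measurable_indic.
- by move=> x x0; rewrite indicE; case: (_ \in _); rewrite ?normr1 ?normr0.
- move=> x; rewrite gt_max => /andP[_ Xx]; rewrite indicE memNset// => /AX.
  by rewrite leNgt Xx.
Qed.

Lemma integrable_wt : m.-integrable (Rplus R) (EFin \o wt g).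
Proof.
apply/integrableP; split.
  by apply/measurable_EFinP; exact: measurable_wt.
under eq_integral.
  move=> x; rewrite inE => x0 /=; rewrite ger0_norm; last exact/ltW/wt_gt0.
  over.
exact: wt_integral_lty.
Qed.

Lemma dominated_integrable f : dominated g f -> m.-integrable (Rplus R) (EFin \o f).
Proof.
move=> [mf [C Cf]].
apply: (@le_integrable _ _ _ m _ (@measurable_Rplus R) _ (fun x => C%:E * (EFin \o wt g) x)%E).
- exact/measurable_EFinP.
- move=> x x0 /=; rewrite lee_fin; apply: (le_trans (Cf _ x0)); exact: ler_norm.
- by apply: integrableZl; [exact: measurable_Rplus|exact: integrable_wt].
Qed.

Lemma Int_functional : dominated_functional g Int (Int (wt g)).
Proof.
have mR := @measurable_Rplus R.
split.
  move=> a f h df dh; rewrite /Int RintegralD//; last exact: dominated_integrable.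
    by rewrite RintegralZl//; exact: dominated_integrable.
  exact: dominated_integrable (dominatedZ a df).
move=> C f df fC; rewrite /Int -RintegralZl//; last exact: integrable_wt.
apply: (le_trans (le_normr_Rintegral _ _)) => //; first exact: dominated_integrable.
apply: le_Rintegral => //.
- by apply: integrable_norm => //; exact: dominated_integrable.
- by apply: (@integrableZl _ _ _ _ _ mR C (EFin \o wt g)) => //; exact: integrable_wt.
Qed.

Lemma le_Int f h : dominated g f -> dominated g h ->
  (forall x, 0 < x -> f x <= h x) -> Int f <= Int h.
Proof.
move=> df dh fh; apply: le_Rintegral => //; first exact: measurable_Rplus.
  exact: dominated_integrable.
exact: dominated_integrable.
Qed.

Lemma Int_EFin f : dominated g f ->
  ((Int f)%:E = \int[m]_(x in Rplus R) (f x)%:E)%E.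
Proof.
move=> df; rewrite /Int /Rintegral fineK//.
by apply: integrable_fin_num; [exact: measurable_Rplus|exact: dominated_integrable].
Qed.

Lemma Int_indic (A : set R) (X : R) : measurable A -> (forall x, A x -> x <= X) ->
  Int (\1_A) = vol A.
Proof.
move=> mA AX; rewrite /Int /Rintegral integral_indic//; last exact: measurable_Rplus.
by congr fine; exact: bessel_measure_setIRplus.
Qed.

Section functional.
Variables (L : (R -> R) -> R) (K : R) (LK : dominated_functional g L K).

Lemma functional_lin (a : R) f h : dominated g f -> dominated g h ->
  L (fun x => a * f x + h x) = a * L f + L h.
Proof. by case: LK => h1 _; exact: h1. Qed.

Lemma functional_le (C : R) (f : R -> R) : dominated g f ->
  (forall x, 0 < x -> `|f x| <= C * wt g x) -> `|L f| <= C * K.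
Proof. by case: LK => _; apply. Qed.

Lemma functional_ge0 : 0 <= K.
Proof.
have : `|L (fun=> 0)| <= 1 * K.
  apply: functional_le; first exact: dominated0.
  by move=> x x0; rewrite normr0 mul1r ltW// wt_gt0.
by rewrite mul1r; apply: le_trans.
Qed.

Lemma functional0 : L (fun=> 0) = 0.
Proof.
have := functional_lin 1 dominated0 dominated0.
rewrite (_ : (fun _ => 1 * 0 + 0) = (fun=> 0)); last by apply/funext => x; rewrite mulr0 addr0.
lra.
Qed.

Lemma functionalZ (a : R) f : dominated g f -> L (fun x => a * f x) = a * L f.
Proof.
move=> df; have := functional_lin a df dominated0; rewrite functional0 addr0 => <-.
by congr L; apply/funext => x; rewrite addr0.
Qed.

Lemma functionalD f h : dominated g f -> dominated g h ->
  L (fun x => f x + h x) = L f + L h.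
Proof.
move=> df dh; have := functional_lin 1 df dh; rewrite mul1r => <-.
by congr L; apply/funext => x; rewrite mul1r.
Qed.

Lemma functionalB f h : dominated g f -> dominated g h ->
  L (fun x => f x - h x) = L f - L h.
Proof.
move=> df dh; have := functional_lin (-1) dh df; rewrite mulN1r addrC => <-.
by congr L; apply/funext => x; rewrite mulN1r addrC.
Qed.

Lemma functional_sum (I : Type) (s : seq I) (P : pred I) (f : I -> R -> R) :
  (forall i, P i -> dominated g (f i)) ->
  L (fun x => \sum_(i <- s | P i) f i x) = \sum_(i <- s | P i) L (f i).
Proof.
move=> df; elim: s => [|i s IH].
  by rewrite big_nil -[RHS]functional0; congr L; apply/funext => x; rewrite big_nil.
rewrite big_cons; case Pi : (P i); last first.
  by rewrite -IH; congr L; apply/funext => x; rewrite big_cons Pi.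
rewrite -IH -functionalD; [|exact: df|exact: dominated_sum].
by congr L; apply/funext => x; rewrite big_cons Pi.
Qed.

(** The bound only looks at x > 0, so a difference that vanishes there is dominated with constant
    0. *)
Lemma functional_ext f h : dominated g f -> dominated g h ->
  (forall x, 0 < x -> f x = h x) -> L f = L h.
Proof.
move=> df dh fh; apply/eqP; rewrite -subr_eq0 -functionalB// -normr_le0.
rewrite -[leRHS](mul0r K); apply: functional_le; first exact: dominatedB.
by move=> x x0; rewrite fh// subrr normr0 mul0r.
Qed.

End functional.
End dominated.
End functionals.

(** * John-Nirenberg estimates on bisection trees *)

Section bisection_tree.
Context {R : realType}.
Implicit Types (a b c : R) (F G : R -> R -> R).

Fixpoint leaf_sum (n : nat) a b F : R :=
  if n is n'.+1 then leaf_sum n' a ((a + b) / 2) F + leaf_sum n' ((a + b) / 2) b F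
  else F a b.

Lemma leaf_sum_lin n a b (k : R) F G :
  leaf_sum n a b (fun u v => k * F u v + G u v) = k * leaf_sum n a b F + leaf_sum n a b G.
Proof. by elim: n a b => [//|n IH] a b /=; rewrite !IH; ring. Qed.

Lemma le_leaf_sum n a b F G : 0 <= a -> a < b ->
  (forall u v, 0 <= u -> u < v -> F u v <= G u v) ->
  leaf_sum n a b F <= leaf_sum n a b G.
Proof.
by move=> + + FG; elim: n a b => [|n IH] a b a0 ab /=; [exact: FG|apply: lerD; apply: IH; lra].
Qed.

Lemma eq_leaf_sum n a b F G : 0 <= a -> a < b ->
  (forall u v, 0 <= u -> u < v -> F u v = G u v) ->
  leaf_sum n a b F = leaf_sum n a b G.
Proof. by move=> a0 ab FG; apply/le_anti/andP; split; apply: le_leaf_sum => // u v ? ?; rewrite FG. Qed.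

(* John-Nirenberg on the bisection tree, by a stopping time at height 2N: the
   bound for depth n feeds the bound for depth n.+1 with a factor 1/2. *)
Lemma tree_john_nirenberg (w t : R -> R -> R) (k N : R) : 0 < N -> 1 <= k ->
  (forall a b, 0 <= a -> a < b -> 0 < w a b) ->
  (forall a b, 0 <= a -> a < b -> w a b = w a ((a + b) / 2) + w ((a + b) / 2) b) ->
  (forall a b, 0 <= a -> a < b -> w a b * t a b =
    w a ((a + b) / 2) * t a ((a + b) / 2) + w ((a + b) / 2) b * t ((a + b) / 2) b) ->
  (forall a b, 0 <= a -> a < b ->
    w a b <= k * w a ((a + b) / 2) /\ w a b <= k * w ((a + b) / 2) b) ->
  (forall n a b, 0 <= a -> a < b ->
    leaf_sum n a b (fun u v => w u v * `|t u v - t a b|) <= N * w a b) ->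
  forall n a b, 0 <= a -> a < b ->
    leaf_sum n a b (fun u v => w u v * (t u v - t a b) ^+ 2) <=
    (8 + (2 + k) ^+ 2) * N ^+ 2 * w a b.
Proof.
move=> N0 k1 w0 wD wtD wk L.
have mid a b : a < b -> a < (a + b) / 2 /\ (a + b) / 2 < b by lra.
have sw n a b : 0 <= a -> a < b -> leaf_sum n a b w = w a b.
  elim: n a b => //= n IH a b a0 ab; have [h1 h2] := mid _ _ ab.
  by rewrite (wD a b)// !IH//; lra.
have swt n a b : 0 <= a -> a < b -> leaf_sum n a b (fun u v => w u v * t u v) = w a b * t a b.
  elim: n a b => //= n IH a b a0 ab; have [h1 h2] := mid _ _ ab.
  by rewrite (wtD a b)// !IH//; lra.
pose Q n a b c := leaf_sum n a b (fun u v => w u v * (t u v - c) ^+ 2).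
pose A1 n a b c := leaf_sum n a b (fun u v => w u v * `|t u v - c|).
(* Variance plus squared bias: the cross term vanishes because the leaf sum of w t is w a b * t a
   b. *)
have QE n a b c : 0 <= a -> a < b -> Q n a b c = Q n a b (t a b) + w a b * (t a b - c) ^+ 2.
  move=> a0 ab; rewrite /Q.
  rewrite (@eq_leaf_sum _ _ _ _ (fun u v => 2 * (t a b - c) * (w u v * t u v) +
     ((c ^+ 2 - t a b ^+ 2) * w u v + w u v * (t u v - t a b) ^+ 2)))//; last first.
    by move=> u v _ _; ring.
  by rewrite leaf_sum_lin leaf_sum_lin sw// swt//; ring.
have A1ge n a b c : 0 <= a -> a < b -> w a b * `|t a b - c| <= A1 n a b c.
  rewrite /A1; elim: n a b => //= n IH a b a0 ab; have [h1 h2] := mid _ _ ab.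
  have h3 : 0 <= (a + b) / 2 by lra.
  have e x y : 0 <= x -> x < y -> w x y * `|t x y - c| = `|w x y * t x y - c * w x y|.
    by move=> x0 xy; rewrite [c * _]mulrC -mulrBr normrM gtr0_norm// w0.
  apply: (le_trans _ (lerD (IH _ _ a0 h1) (IH _ _ h3 h2))).
  rewrite (e a b)// (e a _ a0 h1) (e _ b h3 h2).
  have -> : w a b * t a b - c * w a b =
      (w a ((a + b) / 2) * t a ((a + b) / 2) - c * w a ((a + b) / 2)) +
      (w ((a + b) / 2) b * t ((a + b) / 2) b - c * w ((a + b) / 2) b).
    by rewrite (wtD a b)// (wD a b)//; ring.
  exact: ler_normD.
have A1_0 n a b c : 0 <= a -> a < b -> 0 <= A1 n a b c.
  by move=> a0 ab; apply: le_trans (A1ge n a b c a0 ab); rewrite mulr_ge0// ltW// w0.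
(* This is the L^1 oscillation at depth 1, combined with w a b <= k times the weight of either
   half. *)
have jump a b : 0 <= a -> a < b -> `|t a ((a + b) / 2) - t a b| <= k * N /\
    `|t ((a + b) / 2) b - t a b| <= k * N.
  move=> a0 ab; have [h1 h2] := mid _ _ ab.
  have h3 : 0 <= (a + b) / 2 by lra.
  have := L 1%N _ _ a0 ab; rewrite /=.
  have [] := wk _ _ a0 ab.
  have := w0 _ _ a0 h1; have := w0 _ _ h3 h2.
  set x := `|_ - _|; set y := `|_ - _|.
  have x0 : 0 <= x := normr_ge0 _; have y0 : 0 <= y := normr_ge0 _.
  move: (w a ((a + b) / 2)) (w ((a + b) / 2) b) (w a b) => w1 w2 W w20 w10 h4 h5 h6.
  split.
    rewrite -(@ler_pM2l _ w1)//; apply: (@le_trans _ _ (N * W)); first by nra.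
    by nra.
  rewrite -(@ler_pM2l _ w2)//; apply: (@le_trans _ _ (N * W)); first by nra.
  by nra.
(* The first mean outside the band |t - c| <= 2N has jumped by at most kN, so it deviates from c by
   at most [B]. [A] is the solution of A = 4N^2 + (A + B^2)/2. *)
pose B := (2 + k) * N; pose A := 8 * N ^+ 2 + B ^+ 2.
have B0 : 0 < B by rewrite /B; pos.
have A0 : 0 < A by rewrite /A; pos.
have main n : (forall a b c, 0 <= a -> a < b -> `|t a b - c| <= 2 * N ->
      Q n a b c <= 4 * N ^+ 2 * w a b + (A + B ^+ 2) / (2 * N) * A1 n a b c) ->
    forall a b, 0 <= a -> a < b -> Q n a b (t a b) <= A * w a b.
  move=> I a b a0 ab; apply: (le_trans (I a b (t a b) a0 ab _)).
    by rewrite subrr normr0; pos.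
  apply: (@le_trans _ _ (4 * N ^+ 2 * w a b + (A + B ^+ 2) / (2 * N) * (N * w a b))).
    by rewrite lerD2l; apply: ler_wpM2l; [pos|exact: L].
  rewrite le_eqVlt; apply/orP; left; apply/eqP.
  by rewrite /A; field; rewrite gt_eqF.
suff key n a b c : 0 <= a -> a < b -> `|t a b - c| <= 2 * N ->
      Q n a b c <= 4 * N ^+ 2 * w a b + (A + B ^+ 2) / (2 * N) * A1 n a b c.
  move=> n a b a0 ab; have -> : (8 + (2 + k) ^+ 2) * N ^+ 2 = A by rewrite /A /B; ring.
  exact: main n (key n) a b a0 ab.
have C0 : 0 < (A + B ^+ 2) / (2 * N) by pos.
elim: n a b c => [|n IH] a b c a0 ab tc.
  apply: (@le_trans _ _ (4 * N ^+ 2 * w a b)); last first.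
    by rewrite lerDl; apply: mulr_ge0; [pos|exact: A1_0].
  rewrite /Q /= mulrC; apply: ler_wpM2r; first by rewrite ltW// w0.
  rewrite -real_normK ?num_real//.
  have -> : 4 * N ^+ 2 = (2 * N) ^+ 2 by ring.
  by rewrite lerXn2r// ?nnegrE; pos.
have [h1 h2] := mid _ _ ab.
have h3 : 0 <= (a + b) / 2 by lra.
(* On a child whose mean leaves the band, the bound around its own mean gives (A + B^2) w; since |t
   - c| / (2N) > 1 there, this can be charged to the L^1 sum [A1]. *)
have child u v : 0 <= u -> u < v -> `|t u v - t a b| <= k * N ->
    Q n u v c <= 4 * N ^+ 2 * w u v + (A + B ^+ 2) / (2 * N) * A1 n u v c.
  move=> u0 uv tuv; case: (lerP `|t u v - c| (2 * N)) => tc2; first exact: IH.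
  have tB : `|t u v - c| <= B.
    rewrite (_ : t u v - c = (t u v - t a b) + (t a b - c)); last by ring.
    by apply: (le_trans (ler_normD _ _)); rewrite /B; lra.
  rewrite QE//.
  apply: (@le_trans _ _ ((A + B ^+ 2) * w u v)).
    rewrite mulrDl; apply: lerD; first exact: (main n IH).
    rewrite [leRHS]mulrC; apply: ler_wpM2l; first by rewrite ltW// w0.
    by rewrite -real_normK ?num_real// lerXn2r// ?nnegrE; pos.
  apply: (@le_trans _ _ ((A + B ^+ 2) / (2 * N) * (w u v * `|t u v - c|))).
    rewrite (_ : _ / _ * _ = ((A + B ^+ 2) * w u v) * (`|t u v - c| / (2 * N))); last first.
      by field; rewrite gt_eqF.
    rewrite ler_peMr//.
      by apply: mulr_ge0; [pos|rewrite ltW// w0].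
    by rewrite ler_pdivlMr; [lra|pos].
  apply: (@le_trans _ _ ((A + B ^+ 2) / (2 * N) * A1 n u v c)).
    by apply: ler_wpM2l; [pos|exact: A1ge].
  by rewrite lerDr; apply: mulr_ge0; [pos|rewrite ltW// w0].
have [j1 j2] := jump _ _ a0 ab.
have c1 := child _ _ a0 h1 j1; have c2 := child _ _ h3 h2 j2.
rewrite /Q /A1 /= -/(Q n _ _ c) -/(Q n _ _ c) -/(A1 n _ _ c) -/(A1 n _ _ c).
apply: (le_trans (lerD c1 c2)); rewrite (wD _ _ a0 ab).
by rewrite le_eqVlt; apply/orP; left; apply/eqP; ring.
Qed.

End bisection_tree.

(** * Step functions on the leaves of a bisection tree *)

Section step_functions.
Context {R : realType}.
Variables (lambda : R) (lambda_gt0 : 0 < lambda).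
Local Notation m := (bessel_measure lambda).
Local Notation vol := (vol lambda).
Local Notation Int := (Int lambda).
Local Notation dominated := (dominated lambda).
Local Notation dominated_functional := (dominated_functional lambda).
Variables (g : R) (g_gt0 : 0 < g).

Fixpoint step (n : nat) (a b : R) (v : R -> R -> R) (x : R) : R :=
  if n is n'.+1 then step n' a ((a + b) / 2) v x + step n' ((a + b) / 2) b v x
  else v a b * \1_(`]a, b]%classic) x.

Lemma step_out n (a b : R) v (x : R) : a <= b -> x <= a \/ b < x -> step n a b v x = 0.
Proof.
elim: n a b => [|n IH] a b ab xab /=.
  rewrite indicE memNset ?mulr0//= in_itv/= => /andP[h1 h2].
  by case: xab; lra.
by rewrite !IH ?addr0//; [lra|case: xab; [left|right]; lra|lra|case: xab; [left|right]; lra].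
Qed.

(** The leaf that contains x does not depend on [F], so several step functions can be read off on
    the same leaf. *)
Lemma step_leaf n (a b x : R) : 0 <= a -> a < x -> x <= b ->
  exists u v, [/\ 0 <= u, a <= u, u < x, x <= v & v <= b] /\ v - u = (b - a) / 2 ^+ n /\
    forall F, step n a b F x = F u v.
Proof.
elim: n a b => [|n IH] a b a0 ax xb.
  exists a, b; split; first by split.
  split; first by rewrite expr0 divr1.
  by move=> F /=; rewrite indicE mem_set ?mulr1//= in_itv/= ax xb.
have e (y : R) : y / 2 / 2 ^+ n = y / 2 ^+ n.+1 by rewrite exprS invfM mulrA.
case: (lerP x ((a + b) / 2)) => xc.
  have [u [v [[h1 h2 h3 h4 h5] [h6 h7]]]] := IH a ((a + b) / 2) a0 ax xc.
  exists u, v; split; first by split => //; lra.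
  split; first by rewrite h6 -e; congr (_ / _); lra.
  move=> F /=; rewrite h7 step_out ?addr0//; [lra|by left].
have c0 : 0 <= (a + b) / 2 by lra.
have [u [v [[h1 h2 h3 h4 h5] [h6 h7]]]] := IH ((a + b) / 2) b c0 xc xb.
exists u, v; split; first by split => //; lra.
split; first by rewrite h6 -e; congr (_ / _); lra.
move=> F /=; rewrite h7 step_out ?add0r//; [lra|by right].
Qed.

Lemma dominated_itv (a b : R) : dominated g (\1_(`]a, b]%classic)).
Proof.
by apply: (dominated_indic lambda_gt0 g_gt0 (X := b)) => // x; rewrite /= in_itv/= => /andP[].
Qed.

Lemma dominated_step n a b v : dominated g (step n a b v).
Proof.
elim: n a b => [|n IH] a b /=.
  by apply: dominatedZ => //; exact: dominated_itv.
exact: dominatedD.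
Qed.

Lemma measurable_step n a b v : measurable_fun (Rplus R) (step n a b v).
Proof. by case: (dominated_step n a b v). Qed.

Lemma functional_step L (K : R) n (a b : R) v : dominated_functional g L K ->
  L (step n a b v) = leaf_sum n a b (fun u w => v u w * L (\1_(`]u, w]%classic))).
Proof.
move=> LK; elim: n a b => [|n IH] a b /=.
  rewrite (functionalZ LK)//; exact: dominated_itv.
rewrite (functionalD LK) ?IH//; exact: dominated_step.
Qed.

Lemma Int_abs_le f h : dominated g f -> dominated g h ->
  (forall x, 0 < x -> `|f x| <= h x) -> `|Int f| <= Int h.
Proof.
move=> df dh fh; rewrite ler_norml; apply/andP; split.
  rewrite -mulN1r -(functionalZ (Int_functional lambda_gt0 g_gt0))//.
  apply: (le_Int lambda_gt0 g_gt0) => //; first exact: dominatedZ.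
  by move=> x x0; rewrite mulN1r; have := fh _ x0; rewrite ler_norml => /andP[].
apply: (le_Int lambda_gt0 g_gt0) => //.
by move=> x x0; apply: le_trans (fh _ x0); exact: ler_norm.
Qed.

Lemma Int_mul_functional (M : R) (h : R -> R) : measurable_fun (Rplus R) h ->
  (forall x, 0 < x -> `|h x| <= M) ->
  dominated_functional g (fun f => Int (fun x => f x * h x)) (M * Int (wt lambda g)).
Proof.
move=> mh hM; have IF := Int_functional lambda_gt0 g_gt0; split.
  move=> a f k df dk.
  have dm (z : R -> R) : dominated g z -> dominated g (fun x => z x * h x).
    by move=> dz; exact: (dominatedM dz mh hM).
  rewrite -(functional_lin IF); [|exact: dm|exact: dm].
  by congr Int; apply/funext => x; ring.
move=> C f df fC.
have C0 : 0 <= C.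
  have := fC _ ltr01; have : 0 < wt lambda g 1 by apply: wt_gt0.
  by move=> w0 h1; rewrite -(pmulr_lge0 _ w0); apply: le_trans h1.
rewrite mulrA; apply: (functional_le IF); first exact: (dominatedM df mh hM).
move=> x x0; rewrite normrM mulrAC; apply: ler_pM => //; [exact: fC|exact: hM].
Qed.

(** When [L] is integration against a function, this is the mean of that function over (a, b]; for a
    general functional it takes over this role. *)
Definition itv_mean (L : (R -> R) -> R) (a b : R) : R :=
  L (\1_(`]a, b]%classic)) / vol `]a, b]%classic.

Lemma itv_meanE L (a b : R) : itv_mean L a b = L (\1_(`]a, b]%classic)) / vol `]a, b]%classic.
Proof. by []. Qed.

Definition fun_mean (h : R -> R) (a b : R) : R :=
  itv_mean (fun f => Int (fun x => f x * h x)) a b.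

(* Averaging is self-adjoint. *)
Lemma step_adjoint L (K M : R) (h : R -> R) n (a b : R) : dominated_functional g L K ->
  measurable_fun (Rplus R) h -> (forall x, 0 < x -> `|h x| <= M) ->
  L (step n a b (fun_mean h)) = Int (fun x => step n a b (itv_mean L) x * h x).
Proof.
move=> LK mh hM; rewrite (functional_step _ _ _ _ LK).
have := functional_step n a b (itv_mean L) (Int_mul_functional mh hM); rewrite /= => ->.
elim: n a b => [|n IH] a b /=; last by rewrite !IH.
by rewrite /fun_mean /itv_mean; ring.
Qed.

Lemma Int_itv (a b : R) : Int (\1_(`]a, b]%classic)) = vol `]a, b]%classic.
Proof. by apply: (@Int_indic _ _ _ b) => // x; rewrite /= in_itv/= => /andP[]. Qed.

Lemma fun_mean_osc (M e : R) (h : R -> R) (a b x : R) : measurable_fun (Rplus R) h ->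
  (forall x, 0 < x -> `|h x| <= M) -> 0 <= a -> a < b ->
  (forall y, a < y -> y <= b -> `|h x - h y| <= e) ->
  `|h x - fun_mean h a b| <= e.
Proof.
move=> mh hM a0 ab he; have IF := Int_functional lambda_gt0 g_gt0.
have v0 := vol_itv_gt0 lambda_gt0 a0 ab.
have di := dominated_itv a b.
have dih : dominated g (fun y => \1_(`]a, b]%classic) y * h y) by exact: (dominatedM di mh hM).
have -> : h x - fun_mean h a b =
    Int (fun y => h x * \1_(`]a, b]%classic) y - \1_(`]a, b]%classic) y * h y) / vol `]a, b]%classic.
  rewrite (functionalB IF)//; last exact: dominatedZ.
  rewrite (functionalZ IF)// Int_itv mulrBl mulfK ?gt_eqF//.
rewrite normrM normfV (gtr0_norm v0) ler_pdivrMr// -Int_itv.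
rewrite -(functionalZ IF)//.
apply: Int_abs_le; [by apply: dominatedB => //; exact: dominatedZ|exact: dominatedZ|].
move=> y y0; rewrite [_ * h y]mulrC -mulrBl normrM.
rewrite [`|\1_ _ _|]ger0_norm; last by rewrite indicE.
rewrite indicE; case: (boolP (y \in _)); rewrite ?mulr1 ?mulr0//.
by rewrite inE /= in_itv/= => /andP[h1 h2]; exact: he.
Qed.

(** Self-adjointness moves the averaging onto [h]. The averages of a uniformly continuous function
    converge uniformly, and on a bounded interval this is convergence in the norm for which [L] is
    bounded. *)
Lemma step_cvg L (K M : R) (h : R -> R) (a b : R) : dominated_functional g L K ->
  measurable_fun (Rplus R) h -> (forall x, 0 < x -> `|h x| <= M) ->
  0 <= a -> a < b ->
  (forall x, 0 < x -> x <= a \/ b < x -> h x = 0) ->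
  (forall e, 0 < e -> exists2 d, 0 < d & forall y z, 0 < y -> 0 < z ->
    `|y - z| <= d -> `|h y - h z| <= e) ->
  (fun n => Int (fun x => step n a b (itv_mean L) x * h x)) @ \oo --> L h.
Proof.
move=> LK mh hM a0 ab h0 hu; have b0 : 0 < b by lra.
have dh : dominated g h.
  apply: (dominated_bounded lambda_gt0 g_gt0 b0 mh hM) => x bx; apply: h0; [lra|by right].
have K0 := functional_ge0 LK.
have w0 : 0 < wt lambda g b by exact: wt_gt0.
apply/cvgrPdist_le => e e0.
pose e' := e * wt lambda g b / (K + 1).
have e'0 : 0 < e' by rewrite /e'; pos.
have [d d0 hd] := hu _ e'0.
near=> n.
rewrite -(step_adjoint n a b LK mh hM) -(functionalB LK)//; last exact: dominated_step.
apply: (@le_trans _ _ (e' / wt lambda g b * K)); last first.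
  have -> : e' / wt lambda g b * K = e * (K / (K + 1)).
    by rewrite /e'; field; rewrite !gt_eqF//; lra.
  by rewrite ler_piMr ?ler_pdivrMr//; lra.
apply: (functional_le LK); first by apply: dominatedB => //; exact: dominated_step.
apply: (wt_bounded lambda_gt0 g_gt0 b0).
  move=> x x0; case: (lerP x a) => xa.
    by rewrite h0 ?step_out ?subrr ?normr0//; [pos|lra|by left|by left].
  case: (lerP x b) => xb; last first.
    by rewrite h0 ?step_out ?subrr ?normr0//; [pos|lra|by right|by right].
  have [u [v [[u0 au ux xv vb] [uvE ->]]]] := step_leaf n a0 xa xb.
  apply: (fun_mean_osc mh hM u0); first by lra.
  move=> y uy yv; apply: hd => //; first by lra.
  apply: (@le_trans _ _ (v - u)); first by rewrite ler_norml; lra.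
  rewrite uvE ler_pdivrMr ?exprn_gt0// mulrC -ler_pdivrMr//.
  near: n.
  exists (Num.truncn ((b - a) / d)).+1 => // n /= nd.
  apply: (le_trans (ltW (truncnS_gt _))).
  rewrite -natrX ler_nat; apply: (leq_trans nd); exact/ltnW/ltn_expl.
move=> x bx; rewrite h0 ?step_out ?subrr//; [lra|by right|lra|by right].
Unshelve. all: by end_near. Qed.

Lemma step_sqr n (a b : R) v (x : R) : 0 <= a -> a < b -> step n a b v x ^+ 2 = step n a b (fun u w => v u w ^+ 2) x.
Proof.
move=> a0 ab; case: (lerP x a) => xa.
  by rewrite !step_out ?expr0n//; [lra|by left|lra|by left].
case: (lerP x b) => xb; last by rewrite !step_out ?expr0n//; [lra|by right|lra|by right].
by have [u [w [_ [_ h]]]] := step_leaf n a0 xa xb; rewrite !h.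
Qed.

Lemma Int_step_sqr n (a b : R) v : 0 <= a -> a < b -> Int (fun x => step n a b v x ^+ 2) =
  leaf_sum n a b (fun u w => vol `]u, w]%classic * v u w ^+ 2).
Proof.
move=> a0 ab; under [X in Int X]eq_fun do rewrite step_sqr//.
rewrite (functional_step _ _ _ _ (Int_functional lambda_gt0 g_gt0)).
by elim: n a b a0 ab => [|n IH] a b a0 ab /=; [rewrite Int_itv mulrC|rewrite !IH; lra].
Qed.

End step_functions.

(** * Almost orthogonality of atoms *)

Lemma uniq_geometric_sum_le (R : realType) (q : R) (s : seq nat) :
  0 <= q < 1 -> uniq s -> \sum_(n <- s) q ^+ n <= (1 - q)^-1.
Proof.
move=> q01 us; pose N := (\max_(n <- s) n).+1.
have Ps : perm_eq s [seq n <- iota 0 N | n \in s].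
  apply: uniq_perm => //; first by rewrite filter_uniq// iota_uniq.
  move=> n; rewrite mem_filter mem_iota /= add0n; case: (boolP (n \in s)) => //= ns.
  by rewrite ltnS (leq_bigmax_seq _ ns).
rewrite (perm_big _ Ps) big_filter; apply: le_trans (geometric_sum_le N q01).
rewrite /index_iota subn0 big_mkcond; apply: ler_sum => n _.
by case: ifP => // _; apply: exprn_ge0; case/andP: q01.
Qed.

Lemma uniq_geometric_sum_int_le (R : realType) (q : R) (k : int) (s : seq int) :
  0 <= q < 1 -> uniq s -> \sum_(l <- s) q ^+ `|l - k|%N <= 2 / (1 - q).
Proof.
move=> q01 us; rewrite (bigID (fun l => k <= l)) /= mulrDl !mul1r.
have main (P : pred int) : {in P &, injective (fun l : int => `|l - k|%N)} ->
    \sum_(l <- s | P l) q ^+ `|l - k|%N <= (1 - q)^-1.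
  move=> inj; rewrite -big_filter -(big_map (fun l : int => `|l - k|%N) xpredT (fun n => q ^+ n)).
  apply: uniq_geometric_sum_le => //; rewrite map_inj_in_uniq ?filter_uniq//.
  by move=> x y; rewrite !mem_filter => /andP[Px _] /andP[Py _]; exact: inj.
apply: lerD; apply: main => x y; rewrite !unfold_in /= => hx hy /(congr1 Posz).
  by rewrite !gez0_abs ?subr_ge0// => /addIr.
by move: hx hy; rewrite -!ltNge => hx hy; rewrite !ltz0_abs ?subr_lt0// => /oppr_inj/addIr.
Qed.

Lemma sum_fibers (R : realType) (I J : eqType) (f : I -> J) (s : seq I) (F : I -> R) :
  \sum_(i <- s) F i = \sum_(j <- undup (map f s)) \sum_(i <- s | f i == j) F i.
Proof.
rewrite (exchange_big_dep xpredT)//= big_seq [RHS]big_seq; apply: eq_bigr => i si.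
rewrite big_mkcond (bigD1_seq (f i)) ?undup_uniq//=; last by rewrite mem_undup map_f.
by rewrite eqxx big1 ?addr0// => j; rewrite eq_sym => /negbTE ->.
Qed.

Lemma seq_max (R : realType) (I : eqType) (r : I -> R) (s : seq I) : s != [::] ->
  exists2 j, j \in s & forall i, i \in s -> r i <= r j.
Proof.
elim: s => // a s IH _; have [->|s0] := eqVneq s [::].
  by exists a; rewrite ?mem_head// => i; rewrite inE => /eqP ->.
have [j js jm] := IH s0; case: (lerP (r a) (r j)) => h.
  exists j; first by rewrite inE js orbT.
  by move=> i; rewrite inE => /predU1P[->//|]; exact: jm.
exists a; first exact: mem_head.
by move=> i; rewrite inE => /predU1P[->//|/jm h2]; lra.
Qed.

(** Greedy selection: keep an index of largest radius, discard all indices that are not separated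
    from it, repeat. A discarded ball has no larger radius than the kept one, hence lies in the
    threefold kept ball. *)
Lemma vitali_select (R : realType) (I : eqType) (y r : I -> R) (s : seq I) :
  (forall i, i \in s -> 0 < r i) ->
  exists G : seq I, [/\ uniq G, {subset G <= s},
    forall i j, i \in G -> j \in G -> i != j -> r i + r j <= `|y i - y j| &
    forall i, i \in s -> exists2 j, j \in G & r i <= r j /\ `|y i - y j| < r i + r j].
Proof.
have [n] := ubnP (size s); elim: n s => // n IH s sn r0.
have [->|s0] := eqVneq s [::]; first by exists [::].
have [j js jm] := seq_max r s0.
pose s' := [seq i <- s | r i + r j <= `|y i - y j|].
have ss' : {subset s' <= s} by move=> i; rewrite mem_filter => /andP[].
have js' : j \notin s'.
  by rewrite mem_filter subrr normr0 negb_and -ltNge; have := r0 _ js => h; apply/orP; left; lra.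
have [|i /ss'|G [uG Gs' Gd Gc]] := IH s'.
- rewrite -ltnS; apply: leq_trans sn; rewrite ltnS size_filter.
  rewrite -(count_predC (fun i => r i + r j <= `|y i - y j|)) -[ltnLHS]addn0 ltn_add2l -has_count.
  by apply/hasP; exists j => //=; move: js'; rewrite mem_filter js andbT.
- exact: r0.
have far i : i \in G -> r i + r j <= `|y i - y j|.
  by move=> /Gs'; rewrite mem_filter => /andP[].
exists (j :: G); split.
- by rewrite /= uG andbT; apply: contra js' => /Gs'.
- by move=> i; rewrite inE => /predU1P[->//|/Gs'/ss'].
- move=> a b; rewrite !inE => /predU1P[->|aG] /predU1P[->|bG]; rewrite ?eqxx// => ab.
  + by rewrite addrC distrC; exact: far.
  + exact: far.
  + exact: Gd.
- move=> i si; case: (lerP (r i + r j) `|y i - y j|) => h.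
    have [|a aG ha] := Gc i; first by rewrite mem_filter h si.
    by exists a => //; rewrite inE aG orbT.
  by exists j; rewrite ?mem_head//; split => //; exact: jm.
Qed.

Section almost_orthogonality.
Context {R : realType}.
Variables (lambda : R) (lambda_gt0 : 0 < lambda).
Local Notation m := (bessel_measure lambda).
Local Notation vol := (vol lambda).
Local Notation Int := (Int lambda).
Local Notation dominated := (dominated lambda).
Let IntF (g : R) (g0 : 0 < g) := Int_functional lambda_gt0 g0.
Local Notation IF := (IntF ltr01).

Lemma sum_indic_le (I : eqType) (s : seq I) (A : I -> set R) (B : set R) (x : R) :
  uniq s -> {in s &, forall i j, i != j -> A i x -> A j x -> False} ->
  (forall i, i \in s -> A i x -> B x) -> \sum_(i <- s) \1_(A i) x <= \1_B x :> R.
Proof.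
elim: s => [|a s IH] /=; first by rewrite big_nil indicE.
move=> /andP[as_ us] dis AB; rewrite big_cons.
have := IH us; case: (asboolP (A a x)) => [Aa _|nAa].
  rewrite big_seq big1 ?addr0; last first.
    move=> i si; rewrite indicE memNset// => Ai.
    apply: (dis a i) => //; rewrite ?inE ?eqxx ?si ?orbT//.
    by apply: contra as_ => /eqP ->.
  by rewrite !indicE !mem_set//; apply: (AB a) => //; exact: mem_head.
move=> h; rewrite indicE (memNset nAa) add0r; apply: h.
  by move=> i j si sj; apply: dis; rewrite inE ?si ?sj orbT.
by move=> i si; apply: AB; rewrite inE si orbT.
Qed.

Lemma sum_vol_le (I : eqType) (s : seq I) (A : I -> set R) (B : set R) (X : R) :
  uniq s -> (forall i, i \in s -> measurable (A i)) -> measurable B ->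
  (forall x, B x -> x <= X) ->
  (forall i x, i \in s -> 0 < x -> A i x -> B x) ->
  (forall i j x, i \in s -> j \in s -> i != j -> 0 < x -> A i x -> A j x -> False) ->
  \sum_(i <- s) vol (A i) <= vol B.
Proof.
move=> us mA mB BX AB dis.
have vI i : i \in s -> vol (A i) = vol (A i `&` Rplus R).
  by move=> _; rewrite vol_setIRplus.
have mI i : i \in s -> measurable (A i `&` Rplus R).
  by move=> si; apply: measurableI; [exact: mA|exact: measurable_Rplus].
have IX i : i \in s -> forall x, (A i `&` Rplus R) x -> x <= X.
  by move=> si x [Ax x0]; apply: BX; exact: AB Ax.
pose A' i := if i \in s then A i `&` Rplus R else set0.
have mA' i : measurable (A' i) by rewrite /A'; case: ifP => // /mI.
have A'X i x : A' i x -> x <= X by rewrite /A'; case: ifP => // /IX; apply.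
rewrite big_seq (eq_bigr (fun i => Int (\1_(A' i)))); last first.
  move=> i si; rewrite vI// (Int_indic lambda (mA' i) (A'X i)) /A' si//.
rewrite -big_seq -(Int_indic lambda mB BX).
have d1 i : dominated 1 (\1_(A' i)).
  exact: (dominated_indic lambda_gt0 ltr01 (mA' i) (A'X i)).
have d2 : dominated 1 (\1_B) by exact: (dominated_indic lambda_gt0 ltr01 mB BX).
rewrite -(functional_sum IF)//.
apply: (le_Int lambda_gt0 ltr01) => //; first exact: dominated_sum.
move=> x x0; apply: sum_indic_le => //.
  move=> i j si sj ij; rewrite /A' si sj => -[h1 _] [h2 _]; exact: (dis i j x).
by move=> i si; rewrite /A' si => -[h _]; exact: AB h.
Qed.

Lemma vol_bigcup_le (I : eqType) (s : seq I) (A : I -> set R) (B : set R) (X : R) :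
  (forall i, i \in s -> measurable (A i)) -> measurable B ->
  (forall x, B x -> x <= X) -> (forall i x, i \in s -> A i x -> x <= X) ->
  (forall x, 0 < x -> B x -> exists2 i, i \in s & A i x) ->
  vol B <= \sum_(i <- s) vol (A i).
Proof.
move=> mA mB BX AX BA.
pose A' i := if i \in s then A i else set0.
have mA' i : measurable (A' i) by rewrite /A'; case: ifP => // /mA.
have A'X i x : A' i x -> x <= X by rewrite /A'; case: ifP => // si; exact: AX.
rewrite big_seq (eq_bigr (fun i => Int (\1_(A' i)))); last first.
  by move=> i si; rewrite (Int_indic lambda (mA' i) (A'X i)) /A' si.
rewrite -big_seq -(Int_indic lambda mB BX).
have d1 i : dominated 1 (\1_(A' i)).
  exact: (dominated_indic lambda_gt0 ltr01 (mA' i) (A'X i)).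
have d2 : dominated 1 (\1_B) by exact: (dominated_indic lambda_gt0 ltr01 mB BX).
rewrite -(functional_sum IF)//.
apply: (le_Int lambda_gt0 ltr01) => //; first exact: dominated_sum.
move=> x x0; case: (asboolP (B x)) => Bx; last first.
  by rewrite indicE memNset//; apply: sumr_ge0 => i _; rewrite indicE.
have [i si Ai] := BA _ x0 Bx; rewrite indicE mem_set//=.
rewrite (big_rem i)//= indicE mem_set; last by rewrite /A' si.
by rewrite lerDl sumr_ge0// => j _; rewrite indicE.
Qed.

Variable D : dyadic_system R.
Local Notation dl := (delta D).
Let dl0 : 0 < dl := delta_gt0 D.

Lemma delta_lt1 : dl < 1.
Proof.
apply: (le_lt_trans (delta_small D)).
by rewrite invf_lt1 ?exprn_gt0// exprn_egt1//; lra.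
Qed.

Lemma scale_gt0 (k : int) : 0 < dl ^ k.
Proof. exact: exprz_gt0. Qed.

Definition scale (i : int * R) : R := dl ^ i.1.
Definition wvol (i : int * R) : R := vol (ball i.2 (scale i)).

Lemma index_gt0 i : wavelet_index D i -> 0 < i.2.
Proof. by case=> + _; exact: center_sub. Qed.

Lemma wvol_gt0 i : wavelet_index D i -> 0 < wvol i.
Proof. by move=> wi; apply: vol_ball_gt0 => //; [exact: index_gt0|exact: scale_gt0]. Qed.

Lemma sqrt_wvol_gt0 i : wavelet_index D i -> 0 < Num.sqrt (wvol i).
Proof. by move=> wi; rewrite sqrtr_gt0 wvol_gt0. Qed.

Variables (e : R) (e_gt0 : 0 < e) (e_le1 : e <= 1).

(** Size, cancellation and smoothness are those of a wavelet of index [i]; the support is within [L]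
    scales of the centre. [L] is a parameter because the pieces of one wavelet have arbitrarily wide
    supports. *)
Definition atom (L : R) (i : int * R) (f : R -> R) : Prop :=
  [/\ measurable_fun (Rplus R) f, Int f = 0,
    forall x, 0 < x -> `|f x| <= (Num.sqrt (wvol i))^-1,
    forall x, 0 < x -> L * scale i <= `|x - i.2| -> f x = 0 &
    forall x y, 0 < x -> 0 < y -> `|x - y| <= scale i ->
      `|f x - f y| <= (Num.sqrt (wvol i))^-1 * (`|x - y| / scale i) `^ e].

Lemma atom_dominated L i f : wavelet_index D i -> 0 < L -> atom L i f -> dominated 1 f.
Proof.
move=> wi L0 [mf _ fb fs _].
have y0 := index_gt0 wi; have s0 := scale_gt0 i.1.
have X0 : 0 < i.2 + L * scale i by pos.
apply: (dominated_bounded lambda_gt0 ltr01 X0 mf fb) => x xX.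
have x0 : 0 < x by lra.
apply: fs => //; apply: le_trans (ler_norm _); lra.
Qed.

(** Points of Y^k belong to X^(k+1), so they are delta^(k+1) apart and the balls of radius
    delta^(k+1)/2 around them are disjoint. Doubling compares the volumes of these balls with
    [wvol i]. *)
Lemma packing : exists C : R, 0 < C /\ forall (k : int) (s : seq (int * R)) z rho, uniq s ->
  (forall i, i \in s -> [/\ wavelet_index D i, i.1 = k & `|i.2 - z| <= rho]) ->
  0 < z -> dl ^ k <= rho -> \sum_(i <- s) wvol i <= C * vol (ball z rho).
Proof.
have [Cd [Cd1 dbl]] := doubling lambda_gt0.
pose C1 := Cd * (2 / dl) ^+ hdim lambda; pose C2 := Cd * 2 ^+ hdim lambda.
have d1 := delta_lt1.
have C10 : 0 < C1 by rewrite /C1; pos.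
exists (C1 * C2); split; first by rewrite /C2; pos.
move=> k s z rho us ws z0 krho.
have sk0 := scale_gt0 k.
have rho0 : 0 < rho by lra.
have small i : i \in s -> wvol i <= C1 * vol (ball i.2 (dl ^ k * dl / 2)).
  move=> si; have [wi ik _] := ws _ si; rewrite /wvol /scale ik.
  have {1}-> : dl ^ k = 2 / dl * (dl ^ k * dl / 2) by field; rewrite gt_eqF.
  apply: dbl; [exact: index_gt0|pos|].
  by rewrite ler_pdivlMr// mul1r; lra.
rewrite big_seq; apply: (@le_trans _ _ (\sum_(i <- s) C1 * vol (ball i.2 (dl ^ k * dl / 2)))).
  by rewrite [leRHS]big_seq; exact: ler_sum.
rewrite -mulr_sumr -[leRHS]mulrA; apply: ler_wpM2l; first exact: ltW.
apply: (@le_trans _ _ (vol (ball z (2 * rho)))); last first.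
  by apply: dbl => //; lra.
apply: (@sum_vol_le _ _ _ _ (z + 2 * rho)) => //.
- exact: ball_le.
- move=> i x si x0; have [_ _ h1] := ws _ si.
  rewrite !ball_itv /= !in_itv /= => /andP[h2 h3].
  move: h1; rewrite ler_norml => /andP[h4 h5].
  have : dl ^ k * dl / 2 <= rho by nra.
  by move=> h6; apply/andP; lra.
- move=> i j x si sj ij x0; have [wi ik _] := ws _ si; have [wj jk _] := ws _ sj.
  rewrite !ball_itv /= !in_itv /= => /andP[h2 h3] /andP[h4 h5].
  have : dl ^ (k + 1) <= `|i.2 - j.2|.
    apply: (@center_separated _ D (k + 1)).
    + by move: wi => [+ _]; rewrite ik.
    + by move: wj => [+ _]; rewrite jk.
    + move=> ij2; case/eqP: ij; apply/eqP; rewrite -pair_eqE /= /pair_eq.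
      by rewrite ik jk ij2 !eqxx.
  rewrite expfzDr ?gt_eqF// expr1z; apply/negP; rewrite -ltNge ltr_norml.
  by apply/andP; lra.
Qed.

Let q : R := dl `^ e.

Lemma q01 : 0 <= q < 1.
Proof.
rewrite powR_ge0 /=; have p1 : (1 : R) `^ e = 1 by rewrite powR1.
rewrite -[X in _ < X]p1 /q.
by have e0 := e_gt0; have d0 := dl0; have d1 := delta_lt1; apply: gt0_ltr_powR; rewrite ?nnegrE//; lra.
Qed.

Lemma scale_ratio (k l : int) : k <= l -> (dl ^ l / dl ^ k) `^ e = q ^+ `|l - k|%N.
Proof.
move=> kl; have lE : l = k + `|l - k|%N%:Z by rewrite gez0_abs ?subr_ge0// [RHS]addrC subrK.
rewrite {1}lE expfzDr ?gt_eqF// mulrAC divff ?mul1r ?gt_eqF ?scale_gt0//.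
have d0 := ltW dl0.
by rewrite -exprnP /q -(powR_mulrn _ d0) -(powR_mulrn _ (powR_ge0 dl e)) -!powRrM mulrC.
Qed.

Let dom1 : (0 : R) < 1 := ltr01.

Lemma le_scale (i j : int * R) : j.1 <= i.1 -> scale i <= scale j.
Proof.
move=> ji; rewrite /scale.
have -> : i.1 = j.1 + `|i.1 - j.1|%N%:Z by rewrite gez0_abs ?subr_ge0// [RHS]addrC subrK.
rewrite expfzDr ?gt_eqF//; apply: ler_piMr; first exact/ltW/scale_gt0.
by rewrite -exprnP; apply: exprn_ile1; [exact: ltW|exact/ltW/delta_lt1].
Qed.

(** Since the finer atom [f] has mean zero, the value of [h] at the centre of [f] can be subtracted.
    The Hoelder bound of [h] over the support of [f] then gains delta^e per generation between the
    two. *)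
Lemma atom_inner : exists C : R, 0 < C /\ forall L i j f h, 1 <= L ->
  wavelet_index D i -> wavelet_index D j -> atom L i f -> atom L j h -> j.1 <= i.1 ->
  `|Int (fun x => f x * h x)| <=
  C * L ^+ (hdim lambda).+1 * q ^+ `|i.1 - j.1|%N * (Num.sqrt (wvol i) / Num.sqrt (wvol j)).
Proof.
have [Cd [Cd1 dbl]] := doubling lambda_gt0.
exists (2 * Cd); split; first by pos.
move=> L i j f h L1 wi wj af ah ji.
have L0 : 0 < L by lra.
have df := atom_dominated wi L0 af.
have y0 := index_gt0 wi.
have si0 : 0 < scale i := scale_gt0 i.1.
have sj0 : 0 < scale j := scale_gt0 j.1.
have [mf f0 fb fs _] := af.
have [mh _ hb _ hh] := ah.
pose c := h i.2.
pose M := 2 * (Num.sqrt (wvol j))^-1 * (L * scale i / scale j) `^ e.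
have vi0 := sqrt_wvol_gt0 wi; have vj0 := sqrt_wvol_gt0 wj.
have ivj : 0 < (Num.sqrt (wvol j))^-1 by pos.
have osc x : 0 < x -> `|x - i.2| < L * scale i -> `|h x - c| <= M.
  move=> x0 xi; case: (lerP `|x - i.2| (scale j)) => xj.
    apply: (le_trans (hh _ _ x0 y0 xj)); rewrite /M.
    apply: ler_pM; [pos|pos|lra|].
    apply: ge0_ler_powR; rewrite ?nnegrE; [by pos|by pos|by pos|].
    by apply: ler_wpM2r; [pos|exact: ltW].
  apply: (@le_trans _ _ (2 * (Num.sqrt (wvol j))^-1)).
    apply: (le_trans (ler_normB _ _)).
    have := hb _ x0; have := hb _ y0; rewrite -/c; lra.
  rewrite /M; apply: ler_peMr; first by pos.
  rewrite -(powRr0 (L * scale i / scale j)); apply: ler_powR; last exact: ltW.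
  by rewrite ler_pdivlMr// mul1r; lra.
have IE : Int (fun x => f x * h x) = Int (fun x => f x * (h x - c)).
  have dfh : dominated 1 (fun x => f x * h x) := dominatedM df mh hb.
  have -> : (fun x => f x * (h x - c)) = (fun x => - c * f x + f x * h x).
    by apply/funext => x; ring.
  by rewrite (functional_lin IF)// f0 mulr0 add0r.
rewrite IE.
have mb : measurable (ball i.2 (L * scale i) : set R) by [].
have dB : dominated 1 (\1_(ball i.2 (L * scale i))).
  exact: (dominated_indic lambda_gt0 dom1 mb (@ball_le _ _ _)).
apply: (@le_trans _ _ (Int (fun x => (Num.sqrt (wvol i))^-1 * M * \1_(ball i.2 (L * scale i)) x))).
  apply: (Int_abs_le lambda_gt0 dom1).
  - have -> : (fun x => f x * (h x - c)) = (fun x => - c * f x + f x * h x).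
      by apply/funext => x; ring.
    by apply: dominated_lin => //; exact: (dominatedM df mh hb).
  - exact: dominatedZ.
  - move=> x x0; rewrite indicE; case: (boolP (x \in _)) => xB.
      move: xB; rewrite inE /ball /= distrC => xB.
      rewrite mulr1 normrM; apply: ler_pM => //; [exact: fb|exact: osc].
    have -> : f x = 0; last by rewrite mul0r normr0 mulr0.
    apply: fs => //; rewrite leNgt; apply: contra xB => h1.
    by rewrite inE /ball /= distrC.
rewrite (functionalZ IF)// (Int_indic lambda mb (@ball_le _ _ _)).
have V : vol (ball i.2 (L * scale i)) <= Cd * L ^+ hdim lambda * (Num.sqrt (wvol i)) ^+ 2.
  rewrite sqr_sqrtr; last by rewrite ltW// wvol_gt0.
  exact: dbl.
have P : (L * scale i / scale j) `^ e <= L * q ^+ `|i.1 - j.1|%N.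
  rewrite -mulrA powRM; [|by pos|by pos].
  rewrite /scale scale_ratio//; apply: ler_wpM2r; first by apply: exprn_ge0; exact: powR_ge0.
  by rewrite -{2}(powRr1 (ltW L0)); apply: ler_powR.
have q0 : 0 <= q by exact: powR_ge0.
have -> : 2 * Cd * L ^+ (hdim lambda).+1 * q ^+ `|i.1 - j.1| *
    (Num.sqrt (wvol i) / Num.sqrt (wvol j)) =
    (Num.sqrt (wvol i))^-1 * (2 * (Num.sqrt (wvol j))^-1 * (L * q ^+ `|i.1 - j.1|)) *
     (Cd * L ^+ hdim lambda * (Num.sqrt (wvol i)) ^+ 2).
  by rewrite exprS; field; rewrite !gt_eqF.
apply: ler_pM; [rewrite /M; pos|exact: vol_ge0| |exact: V].
apply: ler_wpM2l; first by pos.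
by apply: ler_wpM2l; first by pos.
Qed.

(** Both orders of the scales are brought to one form: up to the gain q^gap, the entry times its
    Schur weight is the share of ball(j.2, rho) taken by the ball of [i]. Such shares are summed
    over a generation by a packing bound. Centres further apart than [rho] have disjoint
    supports. *)
Lemma atom_schur_term : exists C : R, 0 < C /\ forall L i j f h, 1 <= L ->
  wavelet_index D i -> wavelet_index D j -> atom L i f -> atom L j h ->
  forall rho, rho = 2 * L * Num.max (scale i) (scale j) ->
  `|Int (fun x => f x * h x)| * (Num.sqrt (wvol i) / Num.sqrt (wvol j)) <=
  (`|i.2 - j.2| <= rho)%R%:R *
  (C * L ^+ (2 * hdim lambda).+1 * q ^+ `|i.1 - j.1|%N * (wvol i / vol (ball j.2 rho))).
Proof.
have [Cd [Cd1 dbl]] := doubling lambda_gt0.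
have [C1 [C10 inner]] := atom_inner.
exists (C1 * Cd * 4 ^+ hdim lambda); split; first by pos.
move=> L i j f h L1 wi wj af ah rho rhoE.
have L0 : 0 < L by lra.
have si0 : 0 < scale i := scale_gt0 i.1.
have sj0 : 0 < scale j := scale_gt0 j.1.
have vi0 := sqrt_wvol_gt0 wi; have vj0 := sqrt_wvol_gt0 wj.
have yi0 := index_gt0 wi; have yj0 := index_gt0 wj.
have q0 : 0 <= q by exact: powR_ge0.
have m1 : scale i <= Num.max (scale i) (scale j) by rewrite le_max lexx.
have m2 : scale j <= Num.max (scale i) (scale j) by rewrite le_max lexx orbT.
have rho0 : 0 < rho by rewrite rhoE; apply: mulr_gt0; [pos|lra].
case: (lerP `|i.2 - j.2| rho) => /= ij; last first.
  have -> : Int (fun x => f x * h x) = 0; last by rewrite normr0 !mul0r.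
  have df := atom_dominated wi L0 af.
  rewrite -(functional0 IF); apply: (functional_ext IF).
  - by case: ah => mh _ hb _ _; exact: (dominatedM df mh hb).
  - exact: dominated0.
  move=> x x0; case: af => _ _ _ fs _; case: ah => _ _ _ hs _.
  case: (lerP (L * scale i) `|x - i.2|) => h1; first by rewrite fs// mul0r.
  rewrite hs ?mulr0// leNgt; apply/negP => h2.
  move: ij; rewrite ltNge => /negP; apply.
  rewrite (_ : i.2 - j.2 = (x - j.2) - (x - i.2)); last by ring.
  apply: (le_trans (ler_normB _ _)); rewrite rhoE; nra.
rewrite mul1r; set n := `|_|%N.
have vb0 : 0 < vol (ball j.2 rho) by exact: vol_ball_gt0.
have EL : L ^+ (2 * hdim lambda).+1 = L ^+ (hdim lambda).+1 * L ^+ hdim lambda.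
  by rewrite mul2n -addnn -addSn exprD.
rewrite EL.
case: (lerP j.1 i.1) => ji.
  have sij : Num.max (scale i) (scale j) = scale j.
    by apply/max_idPr; exact: le_scale.
  apply: (@le_trans _ _ ((C1 * L ^+ (hdim lambda).+1 * q ^+ n) * (wvol i / wvol j))).
    have := inner _ _ _ _ _ L1 wi wj af ah ji; rewrite -/n => h1.
    apply: (@le_trans _ _ (C1 * L ^+ (hdim lambda).+1 * q ^+ n * (Num.sqrt (wvol i) / Num.sqrt (wvol j)) * (Num.sqrt (wvol i) / Num.sqrt (wvol j)))).
      by apply: ler_wpM2r => //; pos.
    rewrite -[leLHS]mulrA; apply: ler_wpM2l; first by pos.
    rewrite -expr2 expr_div_n !sqr_sqrtr// ?ltW// wvol_gt0//.
  have V : vol (ball j.2 rho) <= Cd * 4 ^+ hdim lambda * L ^+ hdim lambda * wvol j.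
    apply: (@le_trans _ _ (vol (ball j.2 ((4 * L) * scale j)))).
      apply: vol_ball_shift => //.
      by rewrite subrr normr0 add0r rhoE sij; nra.
    have := dbl j.2 (scale j) (4 * L) yj0 sj0; rewrite exprMn mulrA; apply; lra.
  have wi0 := wvol_gt0 wi; have wj0 := wvol_gt0 wj.
  have -> : C1 * Cd * 4 ^+ hdim lambda * (L ^+ (hdim lambda).+1 * L ^+ hdim lambda) * q ^+ n * (wvol i / vol (ball j.2 rho)) =
    (C1 * L ^+ (hdim lambda).+1 * q ^+ n) * (wvol i / vol (ball j.2 rho) * (Cd * 4 ^+ hdim lambda * L ^+ hdim lambda)).
    by ring.
  apply: ler_wpM2l; first by pos.
  rewrite -[leRHS]mulrA; apply: ler_wpM2l; first exact: ltW.
  by rewrite mulrC ler_pdivlMr// mulrC ler_pdivrMr.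
have ij' : i.1 <= j.1 by exact: ltW.
have sij : Num.max (scale i) (scale j) = scale i.
  by apply/max_idPl; exact: le_scale.
have := inner _ _ _ _ _ L1 wj wi ah af ij'.
have -> : `|j.1 - i.1|%N = n by rewrite /n -distnC.
have -> : (fun x => h x * f x) = (fun x => f x * h x) by apply/funext => x; rewrite mulrC.
move=> h1.
apply: (@le_trans _ _ (C1 * L ^+ (hdim lambda).+1 * q ^+ n)).
  apply: (@le_trans _ _ (C1 * L ^+ (hdim lambda).+1 * q ^+ n * (Num.sqrt (wvol j) / Num.sqrt (wvol i)) * (Num.sqrt (wvol i) / Num.sqrt (wvol j)))).
    by apply: ler_wpM2r => //; pos.
  by rewrite le_eqVlt; apply/orP; left; apply/eqP; field; rewrite !gt_eqF.
have V : vol (ball j.2 rho) <= Cd * 4 ^+ hdim lambda * L ^+ hdim lambda * wvol i.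
  apply: (@le_trans _ _ (vol (ball i.2 ((4 * L) * scale i)))).
    apply: vol_ball_shift => //.
    by move: ij; rewrite distrC rhoE sij; nra.
  have := dbl i.2 (scale i) (4 * L) yi0 si0; rewrite exprMn mulrA; apply; lra.
have -> : C1 * Cd * 4 ^+ hdim lambda * (L ^+ (hdim lambda).+1 * L ^+ hdim lambda) * q ^+ n * (wvol i / vol (ball j.2 rho)) =
    (C1 * L ^+ (hdim lambda).+1 * q ^+ n) * (Cd * 4 ^+ hdim lambda * L ^+ hdim lambda * wvol i / vol (ball j.2 rho)).
  by ring.
by rewrite ler_peMr//; [pos|rewrite ler_pdivlMr// mul1r].
Qed.

(* Schur's test with the weights sqrt(wvol i). *)
Lemma atom_schur_row : exists C : R, 0 < C /\ forall L (s : seq (int * R)) f j h, 1 <= L ->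
  uniq s -> (forall i, i \in s -> wavelet_index D i /\ atom L i (f i)) ->
  wavelet_index D j -> atom L j h ->
  \sum_(i <- s) `|Int (fun x => f i x * h x)| * (Num.sqrt (wvol i) / Num.sqrt (wvol j)) <=
  C * L ^+ (2 * hdim lambda).+1.
Proof.
have [C1 [C10 term]] := atom_schur_term.
have [C2 [C20 pack]] := packing.
have /andP[q0 q1] := q01.
exists (C1 * C2 * (2 / (1 - q))); split; first by apply: mulr_gt0; [pos|apply: divr_gt0; lra].
move=> L s f j h L1 us ws wj ah.
have L0 : 0 < L by lra.
have yj0 := index_gt0 wj.
(* Generation by generation: packing in ball(j.2, rho) bounds the sum of the shares by a constant,
   which leaves the geometric factor in |k - j.1|. *)
rewrite (sum_fibers (fun i : int * R => i.1)).
apply: (@le_trans _ _ (\sum_(k <- undup [seq i.1 | i <- s])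
    C1 * C2 * L ^+ (2 * hdim lambda).+1 * q ^+ `|k - j.1|%N)); last first.
  rewrite -mulr_sumr.
  apply: (@le_trans _ _ (C1 * C2 * L ^+ (2 * hdim lambda).+1 * (2 / (1 - q)))).
    apply: ler_wpM2l; first by pos.
    by apply: uniq_geometric_sum_int_le; [rewrite q0|exact: undup_uniq].
  by rewrite le_eqVlt; apply/orP; left; apply/eqP; ring.
apply: ler_sum => k _.
pose rho := 2 * L * Num.max (dl ^ k) (scale j).
have sk0 := scale_gt0 k.
have krho : dl ^ k <= rho.
  have : dl ^ k <= Num.max (dl ^ k) (scale j) by rewrite le_max lexx.
  rewrite /rho; nra.
have rho0 : 0 < rho by lra.
have v0 : 0 < vol (ball j.2 rho) by exact: vol_ball_gt0.
pose s' := [seq i <- s | (i.1 == k) && (`|i.2 - j.2| <= rho)].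
apply: (@le_trans _ _ (\sum_(i <- s') C1 * L ^+ (2 * hdim lambda).+1 * q ^+ `|k - j.1|%N / vol (ball j.2 rho) * wvol i)).
  rewrite big_filter big_mkcond [leRHS]big_mkcond /= big_seq [leRHS]big_seq.
  apply: ler_sum => i si; have [wi ai] := ws _ si.
  case: eqP => //= ik; have := term _ _ _ _ _ L1 wi wj ai ah rho.
  rewrite /= /scale ik -/(scale j) => /(_ erefl); case: ifP => _ h1; apply: (le_trans h1).
    by rewrite mul1r le_eqVlt; apply/orP; left; apply/eqP; ring.
  by rewrite mul0r.
rewrite -mulr_sumr.
apply: (@le_trans _ _ (C1 * L ^+ (2 * hdim lambda).+1 * q ^+ `|k - j.1|%N / vol (ball j.2 rho) * (C2 * vol (ball j.2 rho)))).
  apply: ler_wpM2l; first by pos.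
  apply: (pack k) => //; first exact: filter_uniq.
  move=> i; rewrite mem_filter => /andP[/andP[/eqP ik ij] si].
  by have [wi _] := ws _ si.
by rewrite le_eqVlt; apply/orP; left; apply/eqP; field; rewrite gt_eqF.
Qed.

(** Duality. With c_i the pairings of [h], T = sum c_i f_i and Y = sum c_i^2 = Int (h T), Schur's
    test gives Int T^2 <= K Y, and this forces Y <= K Int h^2. *)
Theorem almost_orthogonality : exists C : R, 0 < C /\
  forall L (s : seq (int * R)) f (h : R -> R) (M X : R), 1 <= L -> 0 < X -> uniq s ->
  (forall i, i \in s -> wavelet_index D i /\ atom L i (f i)) ->
  measurable_fun (Rplus R) h -> (forall x, 0 < x -> `|h x| <= M) ->
  (forall x, X < x -> h x = 0) ->
  \sum_(i <- s) (Int (fun x => h x * f i x)) ^+ 2 <=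
  C * L ^+ (2 * hdim lambda).+1 * Int (fun x => h x ^+ 2).
Proof.
have [C [C0 row]] := atom_schur_row.
exists C; split => // L s f h M X L1 X0 us ws mh hM hX.
have L0 : 0 < L by lra.
set K := C * _; have K0 : 0 < K by rewrite /K; pos.
have dh : dominated 1 h by exact: (dominated_bounded lambda_gt0 dom1 X0 mh hM hX).
pose f' i := if i \in s then f i else fun=> 0.
have f'E i : i \in s -> f' i = f i by rewrite /f' => ->.
have df i : dominated 1 (f' i).
  rewrite /f'; case: ifP => si; last exact: dominated0.
  by have [wi ai] := ws _ si; exact: (atom_dominated wi L0 ai).
have fM i : exists Mi, forall x, 0 < x -> `|f' i x| <= Mi.
  rewrite /f'; case: ifP => si; last by exists 0 => x _; rewrite normr0.
  by have [_ [_ _ fb _ _]] := ws _ si; exists (Num.sqrt (wvol i))^-1.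
have mf i : measurable_fun (Rplus R) (f' i) by case: (df i).
have dM (u : R -> R) i : dominated 1 u -> dominated 1 (fun x => u x * f' i x).
  by move=> du; have [Mi hi] := fM i; exact: (dominatedM du (mf i) hi).
pose c i := Int (fun x => h x * f' i x).
rewrite big_seq (eq_bigr (fun i => c i ^+ 2)) -?big_seq; last first.
  by move=> i si; rewrite /c f'E.
set Y := \sum_(i <- s) _.
pose T x := \sum_(i <- s) c i * f' i x.
have dT : dominated 1 T by apply: dominated_sum => i _; exact: dominatedZ.
have dcf i : dominated 1 (fun x => h x * f' i x) by exact: dM.
have IhT : Int (fun x => h x * T x) = Y.
  have -> : (fun x => h x * T x) = (fun x => \sum_(i <- s) c i * (h x * f' i x)).
    by apply/funext => x; rewrite /T mulr_sumr; apply: eq_bigr => i _; ring.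
  rewrite (functional_sum IF); last by move=> i _; exact: dominatedZ.
  by apply: eq_bigr => i _; rewrite (functionalZ IF)// -/(c i) expr2.
have TE : (fun x => T x ^+ 2) = (fun x => \sum_(i <- s) \sum_(j <- s) (c i * c j) * (f' i x * f' j x)).
  apply/funext => x; rewrite expr2 /T mulr_suml; apply: eq_bigr => i _.
  by rewrite mulr_sumr; apply: eq_bigr => j _; ring.
have dT2 : dominated 1 (fun x => T x ^+ 2).
  rewrite TE; apply: dominated_sum => i _; apply: dominated_sum => j _.
  by apply: dominatedZ; exact: dM.
have IT2 : Int (fun x => T x ^+ 2) <= K * Y.
  have -> : Int (fun x => T x ^+ 2) = \sum_(i <- s) \sum_(j <- s) (c i * c j) * Int (fun x => f' i x * f' j x).
    rewrite TE (functional_sum IF); last first.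
      by move=> i _; apply: dominated_sum => j _; apply: dominatedZ; exact: dM.
    apply: eq_bigr => i _; rewrite (functional_sum IF); last first.
      by move=> j _; apply: dominatedZ; exact: dM.
    by apply: eq_bigr => j _; rewrite (functionalZ IF)//; exact: dM.
  pose A i j := `|Int (fun x => f' i x * f' j x)|.
  pose w i := Num.sqrt (wvol i).
  (* Arithmetic-geometric mean with the weights sqrt(wvol): |c_i c_j| is split into a part with
     c_i^2 and a part with c_j^2, each carrying a Schur weight, so that the two halves are row sums
     and column sums. *)
  apply: (@le_trans _ _ (\sum_(i <- s) \sum_(j <- s)
      (c i ^+ 2 * (A i j * (w j / w i)) / 2 + c j ^+ 2 * (A i j * (w i / w j)) / 2))).
    rewrite big_seq [leRHS]big_seq; apply: ler_sum => i si.
    rewrite big_seq [leRHS]big_seq; apply: ler_sum => j sj.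
    have wi : 0 < w i by apply: sqrt_wvol_gt0; case: (ws _ si).
    have wj : 0 < w j by apply: sqrt_wvol_gt0; case: (ws _ sj).
    apply: (le_trans (ler_norm _)); rewrite normrM -/(A i j) normrM.
    have A0 : 0 <= A i j := normr_ge0 _.
    rewrite -!(@real_normK _ (c _)) ?num_real//.
    have : 0 <= A i j * (`|c i| * w j - `|c j| * w i) ^+ 2 / (2 * w i * w j).
      by apply: divr_ge0; [apply: mulr_ge0 => //; exact: sqr_ge0|pos].
    rewrite -[X in X -> _]/(is_true _) => h1.
    rewrite -subr_ge0; apply: le_trans h1 _.
    by rewrite le_eqVlt; apply/orP; left; apply/eqP; field; rewrite !gt_eqF.
  have -> : K * Y = K * Y / 2 + K * Y / 2 by field.
  rewrite (eq_bigr (fun i => \sum_(j <- s) c i ^+ 2 * (A i j * (w j / w i)) / 2 +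
     \sum_(j <- s) c j ^+ 2 * (A i j * (w i / w j)) / 2)); last first.
    by move=> i _; rewrite big_split.
  have rowA j : j \in s -> \sum_(i <- s) A i j * (w i / w j) <= K.
    move=> sj; have [wj aj] := ws _ sj.
    apply: le_trans (row L s f j (f j) L1 us ws wj aj).
    rewrite big_seq [leRHS]big_seq le_eqVlt; apply/orP; left; apply/eqP.
    by apply: eq_bigr => i si; rewrite /A !f'E.
  have AC i j : A i j = A j i.
    by rewrite /A; congr (`| Int _ |); apply/funext => x; rewrite mulrC.
  have half : \sum_(j <- s) \sum_(i <- s) c j ^+ 2 * (A i j * (w i / w j)) / 2 <= K * Y / 2.
    rewrite /Y mulr_sumr mulr_suml big_seq [leRHS]big_seq; apply: ler_sum => j sj.
    rewrite -mulr_suml -mulr_sumr; apply: ler_wpM2r; first by lra.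
    by rewrite [leRHS]mulrC; apply: ler_wpM2l; [exact: sqr_ge0|exact: rowA].
  rewrite big_split /=; apply: lerD; last by rewrite exchange_big.
  under eq_bigr do under eq_bigr do rewrite AC.
  exact: half.
have dh2 : dominated 1 (fun x => h x ^+ 2).
  have -> : (fun x => h x ^+ 2) = (fun x => h x * h x) by apply/funext => x; rewrite expr2.
  exact: (dominatedM dh mh hM).
have dhT : dominated 1 (fun x => h x * T x).
  have -> : (fun x => h x * T x) = (fun x => T x * h x) by apply/funext => x; rewrite mulrC.
  exact: (dominatedM dT mh hM).
(* Integrating (K h - T)^2 / K >= 0 takes the place of Cauchy-Schwarz: together with Int T^2 <= K Y
   it gives 2Y <= K Int h^2 + Y. *)
have : Int (fun x => 2 * (h x * T x)) <= Int (fun x => K * h x ^+ 2 + K^-1 * T x ^+ 2).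
  apply: (le_Int lambda_gt0 dom1); first exact: dominatedZ.
    by apply: dominatedD; exact: dominatedZ.
  move=> x x0; rewrite -subr_ge0.
  have -> : K * h x ^+ 2 + K^-1 * T x ^+ 2 - 2 * (h x * T x) = K^-1 * (K * h x - T x) ^+ 2.
    by field; rewrite gt_eqF.
  by apply: mulr_ge0; [pos|exact: sqr_ge0].
rewrite (functionalZ IF)// IhT (functional_lin IF)//; last exact: dominatedZ.
rewrite (functionalZ IF)// => h1.
have : K^-1 * Int (fun x => T x ^+ 2) <= Y.
  by rewrite mulrC ler_pdivrMr// mulrC.
lra.
Qed.

End almost_orthogonality.

(** * Carleson estimates for atoms *)

Section carleson.
Context {R : realType}.
Variables (lambda : R) (lambda_gt0 : 0 < lambda).
Local Notation vol := (vol lambda).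
Local Notation Int := (Int lambda).
Local Notation dominated := (dominated lambda).
Local Notation dominated_functional := (dominated_functional lambda).
Local Notation itv_mean := (itv_mean lambda).

(* A functional with the oscillation property of integration against a
   function of mean oscillation at most N over every interval. *)
Definition bmo_functional (L : (R -> R) -> R) (N : R) : Prop :=
  forall a b (f : R -> R) (M : R), 0 <= a -> a < b -> measurable_fun (Rplus R) f ->
    (forall x, 0 < x -> `|f x| <= M) ->
    (forall x, 0 < x -> x <= a \/ b < x -> f x = 0) ->
    `|L f - itv_mean L a b * Int f| <= N * M * vol `]a, b]%classic.

Lemma cvg_sum_sqr (I : Type) (s : seq I) (u : I -> nat -> R) (l : I -> R) (B : R) :
  (forall i, u i @ \oo --> l i) -> (forall n, \sum_(i <- s) (u i n) ^+ 2 <= B) ->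
  \sum_(i <- s) (l i) ^+ 2 <= B.
Proof.
move=> ul uB.
have : (fun n => \sum_(i <- s) (u i n) ^+ 2) @ \oo --> \sum_(i <- s) (l i) ^+ 2.
  elim: s {uB} => [|a s IH].
    by rewrite big_nil; under eq_fun do rewrite big_nil; exact: cvg_cst.
  rewrite big_cons; under eq_fun do rewrite big_cons; apply: cvgD => //.
  by under eq_fun do rewrite expr2; rewrite expr2; apply: cvgM.
move=> h; apply: (cvgr_to_le h); near=> n; exact: uB.
Unshelve. all: by end_near. Qed.

Section mean_oscillation.
Variables (g : R) (g_gt0 : 0 < g).
Variables (L : (R -> R) -> R) (K N : R).
Hypotheses (LK : dominated_functional g L K) (LN : bmo_functional L N) (N_gt0 : 0 < N).
Let IF := Int_functional lambda_gt0 g_gt0.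

Lemma vol_itv_mean (a b : R) : 0 <= a -> a < b ->
  vol `]a, b]%classic * itv_mean L a b = L (\1_(`]a, b]%classic)).
Proof.
by move=> a0 ab; rewrite itv_meanE mulrC divfK// gt_eqF// vol_itv_gt0.
Qed.

Lemma indic_itv_split (a c b x : R) : a <= c -> c <= b ->
  \1_(`]a, b]%classic) x = \1_(`]a, c]%classic) x + \1_(`]c, b]%classic) x :> R.
Proof.
move=> ac cb; rewrite !indicE !mem_setE !in_itv /=.
case: (lerP x a) => h1; case: (lerP x c) => h2; case: (lerP x b) => h3 /=;
  rewrite ?(ltNge c x) ?h2 /= ?(addr0, add0r)//; try lra.
all: by case: (ltrP c x) => h4 /=; rewrite ?(addr0, add0r)//; lra.
Qed.

Lemma step_le1 n (a b : R) (v : R -> R -> R) (x : R) : 0 <= a -> a < b -> (forall u w, `|v u w| <= 1) ->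
  `|step n a b v x| <= 1.
Proof.
move=> a0 ab v1; case: (lerP x a) => xa; first by rewrite step_out ?normr0//; [lra|by left].
case: (lerP x b) => xb; last by rewrite step_out ?normr0//; [lra|by right].
by have [u [w [_ [_ ->]]]] := step_leaf n a0 xa xb.
Qed.

(** Duality for the L^1 norm: the step function of the signs is bounded by 1 and supported in (a,
    b], so the oscillation property of [L] applies to it. This is the input of the John-Nirenberg
    estimate. *)
Lemma leaf_oscillation n (a b : R) : 0 <= a -> a < b ->
  leaf_sum n a b (fun u v => vol `]u, v]%classic * `|itv_mean L u v - itv_mean L a b|) <=
  N * vol `]a, b]%classic.
Proof.
move=> a0 ab; pose sg u v := Num.sg (itv_mean L u v - itv_mean L a b).
have := LN (f := step n a b sg) (M := 1) a0 ab (measurable_step lambda_gt0 g_gt0 _ _ _ _).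
rewrite mulr1 => h; apply: le_trans (h _ _); last 2 first.
- move=> x _; apply: step_le1 => // u w.
  by rewrite /sg normr_sg; case: (_ != 0).
- by move=> x _ h1; apply: step_out => //; exact: ltW.
apply: le_trans (ler_norm _).
rewrite (functional_step lambda_gt0 g_gt0 _ _ _ _ LK) (functional_step lambda_gt0 g_gt0 _ _ _ _ IF).
have -> : leaf_sum n a b (fun u w => sg u w * L (\1_(`]u, w]%classic))) -
    itv_mean L a b * leaf_sum n a b (fun u w => sg u w * Int (\1_(`]u, w]%classic))) =
    leaf_sum n a b (fun u w => - itv_mean L a b * (sg u w * Int (\1_(`]u, w]%classic))) +
      sg u w * L (\1_(`]u, w]%classic))).
  by rewrite leaf_sum_lin; ring.
apply: le_leaf_sum => // u v u0 uv.
by rewrite normrEsg -vol_itv_mean// Int_itv /sg; lra.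
Qed.

End mean_oscillation.

Variable D : dyadic_system R.
Variables (e : R) (e_gt0 : 0 < e) (e_le1 : e <= 1).
Local Notation atom := (atom lambda D e).
Local Notation scale := (scale D).
Local Notation dl := (delta D).

Lemma atom_uniformly_continuous (L : R) i f : wavelet_index D i -> atom L i f ->
  forall eps, 0 < eps -> exists2 d, 0 < d & forall y z, 0 < y -> 0 < z ->
    `|y - z| <= d -> `|f y - f z| <= eps.
Proof.
move=> wi [_ _ _ _ hf] eps eps0.
have s0 : 0 < scale i := scale_gt0 D i.1.
have v0 := sqrt_wvol_gt0 lambda_gt0 wi.
pose t := eps * Num.sqrt (wvol lambda D i).
have t0 : 0 < t by rewrite /t; pos.
exists (Num.min (scale i) (scale i * t `^ e^-1)).
  by rewrite lt_min s0 /=; pos.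
move=> y z y0 z0; rewrite le_min => /andP[h1 h2].
apply: (le_trans (hf _ _ y0 z0 h1)).
rewrite mulrC ler_pdivrMr// -/t.
apply: (@le_trans _ _ ((t `^ e^-1) `^ e)).
  apply: ge0_ler_powR; rewrite ?nnegrE; [exact: ltW|pos|pos|].
  by rewrite ler_pdivrMr// mulrC.
by rewrite -powRrM mulVf ?gt_eqF// powRr1//; exact: ltW.
Qed.

Lemma wavelet_cube_ball : exists C : R, 1 <= C /\ forall i, wavelet_index D i ->
  wavelet_cube D i `<=` ball i.2 (C * scale i).
Proof.
have [c [C [c0 C0 h]]] := cube_ball D.
exists (Num.max 1 C); split; first by rewrite le_max lexx.
move=> i [wi _] x /(proj2 (h _ _ wi)); rewrite /ball /= => h1; apply: (lt_le_trans h1).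
have d1 := delta_lt1 D; have s0 : 0 < scale i := scale_gt0 D i.1.
rewrite expfzDr ?gt_eqF ?delta_gt0// expr1z -/(scale i).
have : C <= Num.max 1 C by rewrite le_max lexx orbT.
have d0 := delta_gt0 D => h2; apply: ler_pM; [pos|pos|exact: h2|].
by apply: ler_piMr; exact: ltW.
Qed.

Lemma vol_wavelet_cube : exists C : R, 0 < C /\ forall i L, wavelet_index D i -> 1 <= L ->
  vol (ball i.2 (L * scale i)) <= C * L ^+ hdim lambda * vol (wavelet_cube D i).
Proof.
have [Cd [Cd1 dbl]] := doubling lambda_gt0.
have [c [C [c0 C0 h]]] := cube_ball D.
have d1 := delta_lt1 D; have d0 := delta_gt0 D.
(* The minimum with 1 keeps the dilation factor passed to [doubling] at least 1. *)
pose c' := Num.min 1 c.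
have c'0 : 0 < c' by rewrite lt_min ltr01.
have c'1 : c' <= 1 by rewrite ge_min lexx.
have c'c : c' <= c by rewrite ge_min lexx orbT.
exists (Cd * (dl^-1 / c') ^+ hdim lambda); split; first by pos.
move=> i L [wi wi'] L1; have s0 : 0 < scale i := scale_gt0 D i.1.
have y0 : 0 < i.2 by exact: center_sub wi.
apply: (@le_trans _ _ (Cd * (dl^-1 / c' * L) ^+ hdim lambda * vol (ball i.2 (c' * (scale i * dl))))).
  have -> : L * scale i = (dl^-1 / c' * L) * (c' * (scale i * dl)).
    by field; rewrite !gt_eqF.
  apply: dbl => //; first by pos.
  rewrite -invfM -ler_pdivrMl; last by pos.
  by rewrite invrK mulr1; nra.
rewrite [(_ * L) ^+ _]exprMn mulrA; apply: ler_wpM2l; first by pos.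
apply: (@le_vol _ _ lambda_gt0 _ _ (i.2 + C * dl ^ (i.1 + 1))) => //.
- exact: (cube_measurable wi).
- move=> x [xB x0]; apply: (proj1 (h _ _ wi)); split => //.
  move: xB; rewrite /ball /= => h1; apply: (lt_le_trans h1).
  rewrite expfzDr ?gt_eqF// expr1z -/(scale i); apply: ler_wpM2r => //; pos.
- by move=> x /(proj2 (h _ _ wi)); exact: ball_le.
Qed.

Lemma wt_le1 (g x : R) : 0 < g -> 0 < x -> wt lambda g x <= 1.
Proof.
move=> g0 x0; have p0 : (1 + x) `^ 0 = 1 by rewrite powRr0.
have l0 := lambda_gt0; rewrite -[leRHS]p0; apply: ler_powR; lra.
Qed.

(* The step functions with values itv_mean Lf represent Lf in the limit on
   atoms, and their square oscillation is at most N^2 vol by John-Nirenberg. *)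
Lemma carleson_atoms_interval : exists C : R, 0 < C /\
  forall g Lf K N L (s : seq (int * R)) f a b, 0 < g ->
  dominated_functional g Lf K -> bmo_functional Lf N -> 0 < N -> 1 <= L -> uniq s ->
  (forall i, i \in s -> wavelet_index D i /\ atom L i (f i)) ->
  0 <= a -> a < b ->
  (forall i x, i \in s -> 0 < x -> x <= a \/ b < x -> f i x = 0) ->
  \sum_(i <- s) (Lf (f i)) ^+ 2 <=
  C * L ^+ (2 * hdim lambda).+1 * N ^+ 2 * vol `]a, b]%classic.
Proof.
have [C1 [C10 ao]] := almost_orthogonality lambda_gt0 D e_gt0 e_le1.
have [k [k1 wk]] := vol_bisect lambda_gt0.
exists (C1 * (8 + (2 + k) ^+ 2)); split; first by pos.
move=> g Lf K N L s f a b g0 LK LN N0 L1 us ws a0 ab fab.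
have L0 : 0 < L by lra.
have b0 : 0 < b by lra.
have jn n : leaf_sum n a b (fun u v => vol `]u, v]%classic * (itv_mean Lf u v - itv_mean Lf a b) ^+ 2) <=
  (8 + (2 + k) ^+ 2) * N ^+ 2 * vol `]a, b]%classic.
  apply: (tree_john_nirenberg N0 k1) => //.
  - by move=> *; exact: vol_itv_gt0.
  - by move=> *; apply: vol_itv_split => //; lra.
  - move=> u v u0 uv; rewrite !vol_itv_mean//; try lra.
    rewrite -(functionalD LK); [|exact: dominated_itv..].
    by congr Lf; apply/funext => x; apply: indic_itv_split; lra.
  - move=> *; exact: (leaf_oscillation g0 LK LN).
pose v u w := itv_mean Lf u w - itv_mean Lf a b.
pose h n := step n a b v.
pose f' i := if i \in s then f i else fun=> 0.
have f'E i : i \in s -> f' i = f i by rewrite /f' => ->.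
rewrite big_seq (eq_bigr (fun i => (Lf (f' i)) ^+ 2)) -?big_seq; last by move=> i si; rewrite f'E.
apply: (@cvg_sum_sqr _ s (fun i n => Int (fun x => h n x * f' i x))).
  move=> i; rewrite /f'; case: ifP => si; last first.
    rewrite (functional0 LK) (_ : (fun n => _) = (fun=> 0)); first exact: cvg_cst.
    apply/funext => n; rewrite -[RHS](functional0 (Int_functional lambda_gt0 g0)); congr Int.
    by apply/funext => x; rewrite mulr0.
  have [wi ai] := ws _ si; have [mf f0 fb fs fh] := ai.
  have df : dominated g (f i).
    by apply: (dominated_bounded lambda_gt0 g0 b0 mf fb) => x bx; apply: (fab i) => //; [lra|by right].
  (* Atoms have mean zero, so subtracting the mean over (a, b] from the step function does not
     change the pairing. It is the difference whose square norm John-Nirenberg controls. *)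
  have -> : (fun n => Int (fun x => h n x * f i x)) =
     (fun n => Int (fun x => step n a b (itv_mean Lf) x * f i x)).
    apply/funext => n; pose IF := Int_functional lambda_gt0 g0.
    have ds w : dominated g (fun x => step n a b w x * f i x).
      by apply: (dominatedM _ mf fb); exact: dominated_step.
    rewrite -[RHS]addr0 -[X in _ + X](mulr0 (- itv_mean Lf a b)) -f0 addrC.
    rewrite -(functional_lin IF)//.
    apply: (functional_ext IF); [exact: ds|by apply: dominated_lin|].
    move=> x x0; case: (lerP x a) => xa; first by rewrite (fab i x)//; [ring|by left].
    case: (lerP x b) => xb; last by rewrite (fab i x)//; [ring|by right].
    have [u [w [_ [_ hw]]]] := step_leaf n a0 xa xb.
    by rewrite /h !hw /v; ring.
  apply: (step_cvg lambda_gt0 g0 LK mf fb a0 ab); first by move=> x; exact: fab.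
  exact: atom_uniformly_continuous ai.
move=> n; have [M hM] : exists M, forall x, 0 < x -> `|h n x| <= M.
  have [_ [M hM]] := dominated_step lambda_gt0 g0 n a b v.
  have M0 : 0 <= M.
    have := hM _ ltr01; have w0 : 0 < wt lambda g 1 by exact: wt_gt0.
    by move=> h1; rewrite -(pmulr_lge0 _ w0); apply: le_trans h1.
  exists M => x x0; apply: (le_trans (hM _ x0)).
  by apply: ler_piMr => //; exact: wt_le1.
apply: (@le_trans _ _ (C1 * L ^+ (2 * hdim lambda).+1 * Int (fun x => h n x ^+ 2))).
  apply: (ao L s f' (h n) M b) => //.
  - by move=> i si; rewrite f'E//; exact: ws.
  - exact: (measurable_step lambda_gt0 g0).
  - by move=> x bx; apply: step_out; [lra|right].
rewrite (Int_step_sqr lambda_gt0 g0)//.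
apply: (@le_trans _ _ (C1 * L ^+ (2 * hdim lambda).+1 * ((8 + (2 + k) ^+ 2) * N ^+ 2 * vol `]a, b]%classic))).
  by apply: ler_wpM2l; [pos|exact: jn].
by rewrite le_eqVlt; apply/orP; left; apply/eqP; ring.
Qed.

(** A Vitali selection reduces this to single intervals. The radius [r i] covers both the support
    and the cube of [i], so the atoms assigned to a selected ball are supported in its triple, and
    the cubes of the selected indices are disjoint subsets of [U]. Returning from the triple balls
    to these cubes costs the third power L^hdim. *)
Lemma carleson_atoms : exists C : R, 0 < C /\
  forall g Lf K N L (s : seq (int * R)) f (U : set R) X, 0 < g ->
  dominated_functional g Lf K -> bmo_functional Lf N -> 0 < N -> 1 <= L -> uniq s ->
  (forall i, i \in s -> wavelet_index D i /\ atom L i (f i)) ->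
  measurable U -> (forall x, U x -> x <= X) ->
  (forall i, i \in s -> wavelet_cube D i `<=` U) ->
  \sum_(i <- s) (Lf (f i)) ^+ 2 <= C * L ^+ (3 * hdim lambda).+1 * N ^+ 2 * vol U.
Proof.
have [C1 [C10 single]] := carleson_atoms_interval.
have [C2 [C21 cb]] := wavelet_cube_ball.
have [C3 [C30 vc]] := vol_wavelet_cube.
have l0 := lambda_gt0.
exists (C1 * C3 * (4 * C2) ^+ hdim lambda); split; first by pos.
move=> g Lf K N L s f U X g0 LK LN N0 L1 us ws mU UX sU.
have L0 : 0 < L by lra.
pose r i := L * C2 * scale i.
have sc0 i : 0 < scale i := scale_gt0 D i.1.
have r0 i : 0 < r i by rewrite /r; apply: mulr_gt0 => //; pos.
have [|G [uG Gs Gd Gc]] := @vitali_select R _ (fun i : int * R => i.2) r s; first by [].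
pose near i j := (r i <= r j) && (`|i.2 - j.2| < r i + r j).
apply: (@le_trans _ _ (\sum_(j <- G) \sum_(i <- s | near i j) (Lf (f i)) ^+ 2)).
  rewrite (exchange_big_dep xpredT)//= big_seq [leRHS]big_seq; apply: ler_sum => i si.
  have [j jG [h1 h2]] := Gc _ si.
  rewrite big_mkcond (bigD1_seq j)//= {1}/near h1 h2 /= lerDl.
  by apply: sumr_ge0 => k _; case: ifP => // _; exact: sqr_ge0.
apply: (@le_trans _ _ (\sum_(j <- G) C1 * L ^+ (2 * hdim lambda).+1 * N ^+ 2 *
   (C3 * (4 * C2 * L) ^+ hdim lambda * vol (wavelet_cube D j)))).
  rewrite big_seq [leRHS]big_seq; apply: ler_sum => j jG.
  have [wj aj] := ws _ (Gs _ jG).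
  have y0 := index_gt0 wj.
  pose a := Num.max 0 (j.2 - 3 * r j); pose b := j.2 + 3 * r j.
  have rj := r0 j.
  have a0 : 0 <= a by rewrite le_max lexx.
  have ab : a < b by rewrite /a /b gt_max; apply/andP; lra.
  rewrite -big_filter.
  apply: (le_trans (single g Lf K N L _ f a b g0 LK LN N0 L1 _ _ a0 ab _)).
  - exact: filter_uniq.
  - by move=> i; rewrite mem_filter => /andP[_]; exact: ws.
  - move=> i x; rewrite mem_filter => /andP[/andP[h1 h2] si] x0 xab.
    have [_ [_ _ _ fs _]] := ws _ si; apply: fs => //.
    rewrite leNgt; apply/negP => h3.
    have h4 : `|x - i.2| < r i.
      apply: (lt_le_trans h3); rewrite /r -mulrA.
      by apply: ler_wpM2l; [exact: ltW|apply: ler_peMl => //; exact: ltW].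
    have h5 : `|x - j.2| < 3 * r j.
      rewrite (_ : x - j.2 = (x - i.2) + (i.2 - j.2)); last by ring.
      apply: (le_lt_trans (ler_normD _ _)); lra.
    move: h5; rewrite ltr_norml => /andP[h5 h6].
    clear -x0 xab h5 h6.
    by case: xab => [|]; rewrite /a /b ?le_max; [case/orP|]; lra.
  - apply: ler_wpM2l; first by pos.
    apply: (@le_trans _ _ (vol (ball j.2 (4 * C2 * L * scale j)))).
      apply: (@le_vol _ _ lambda_gt0 _ _ (j.2 + 4 * C2 * L * scale j)) => //; last exact: ball_le.
      move=> x [+ x0]; rewrite ball_itv /= !in_itv /= /a /b gt_max => /andP[/andP[h1 h2] h3].
      have rE : 4 * C2 * L * scale j = 4 * r j by rewrite /r; ring.
      by rewrite rE; apply/andP; lra.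
    by apply: vc => //; nra.
rewrite -mulr_sumr -mulr_sumr exprMn.
have vU : \sum_(j <- G) vol (wavelet_cube D j) <= vol U.
  apply: (sum_vol_le lambda_gt0 uG _ mU UX).
  - by move=> j jG; have [[wj _] _] := ws _ (Gs _ jG); exact: (cube_measurable wj).
  - by move=> j x jG _; exact: (sU _ (Gs _ jG)).
  - move=> i j x iG jG ij x0.
    have [wi _] := ws _ (Gs _ iG); have [wj _] := ws _ (Gs _ jG).
    move=> /(cb _ wi); rewrite /ball /= => h1 /(cb _ wj); rewrite /ball /= => h2.
    have := Gd _ _ iG jG ij; apply/negP; rewrite -ltNge.
    rewrite (_ : i.2 - j.2 = (i.2 - x) - (j.2 - x)); last by ring.
    apply: (le_lt_trans (ler_normB _ _)).
    have h3 k : C2 * scale k <= r k.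
      by rewrite /r; apply: ler_wpM2r; [exact: ltW|apply: ler_peMl => //; lra].
    have := h3 i; have := h3 j.
    lra.
apply: (@le_trans _ _ (C1 * L ^+ (2 * hdim lambda).+1 * N ^+ 2 *
    (C3 * ((4 * C2) ^+ hdim lambda * L ^+ hdim lambda) * vol U))).
  apply: ler_wpM2l; first by pos.
  by apply: ler_wpM2l => //; pos.
have -> : L ^+ (3 * hdim lambda).+1 = L ^+ (2 * hdim lambda).+1 * L ^+ hdim lambda.
  by rewrite -exprD addSn -mulSnr.
by rewrite le_eqVlt; apply/orP; left; apply/eqP; ring.
Qed.

End carleson.

(** * Wavelets as sums of atoms *)

Section wavelet_atoms.
Context {R : realType}.
Variables (lambda : R) (lambda_gt0 : 0 < lambda).
Local Notation vol := (vol lambda).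
Local Notation Int := (Int lambda).
Local Notation dominated := (dominated lambda).
Local Notation dominated_functional := (dominated_functional lambda).

(** With a N >= M, the bound exp(v) >= v^N / N! at v = nu u^a beats the M-th power of u for u >
    1. *)
Lemma expR_power_decay (a nu : R) (M : nat) : 0 < a -> 0 < nu ->
  exists C : R, 0 < C /\ forall u, 0 <= u -> expR (- (nu * u `^ a)) <= C * (1 + u) ^- M.
Proof.
move=> a0 nu0; pose N := (Num.truncn (M%:R / a)).+1.
have MN : M%:R <= a * N%:R.
  by rewrite mulrC -ler_pdivrMr// ltW// truncnS_gt.
exists (2 ^+ M * (1 + nu ^- N * N`!%:R)); split; first by pos.
move=> u u0; have u1 : 0 < (1 + u) ^+ M by apply: exprn_gt0; lra.
rewrite -ler_pdivrMr ?invr_gt0// invrK.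
case: (lerP u 1) => hu.
  apply: (@le_trans _ _ (1 * 2 ^+ M)).
    apply: ler_pM; [exact: expR_ge0|exact: ltW| |by rewrite lerXn2r// ?nnegrE; lra].
    by rewrite -expR0 ler_expR oppr_le0; pos.
  rewrite mulrC; apply: ler_wpM2l; first by pos.
  by rewrite lerDl; pos.
set v := nu * u `^ a.
have v0 : 0 < v by rewrite /v; apply: mulr_gt0 => //; apply: powR_gt0; lra.
have ev : expR (- v) * v ^+ N <= N`!%:R.
  rewrite expRN mulrC ler_pdivrMr ?expR_gt0// mulrC -ler_pdivrMr ?ltr0n ?fact_gt0//.
  by have := expR_ge1Dxn (Num.truncn (M%:R / a)) (ltW v0); rewrite -/N; lra.
have uv : (1 + u) ^+ M <= 2 ^+ M * (nu ^- N * v ^+ N).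
  apply: (@le_trans _ _ ((2 * u) ^+ M)); first by rewrite lerXn2r// ?nnegrE; lra.
  rewrite exprMn; apply: ler_wpM2l; first by pos.
  rewrite /v exprMn mulrA mulVf ?mul1r ?gt_eqF ?exprn_gt0//.
  rewrite -(powR_mulrn _ u0) -(powR_mulrn _ (powR_ge0 u a)) -powRrM.
  by apply: ler_powR => //; exact: ltW.
apply: (@le_trans _ _ (expR (- v) * (2 ^+ M * (nu ^- N * v ^+ N)))).
  by apply: ler_wpM2l => //; exact: expR_ge0.
have -> : expR (- v) * (2 ^+ M * (nu ^- N * v ^+ N)) = 2 ^+ M * (nu ^- N * (expR (- v) * v ^+ N)) by ring.
apply: ler_wpM2l; first by pos.
apply: (@le_trans _ _ (nu ^- N * N`!%:R)); first by apply: ler_wpM2l => //; pos.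
by rewrite lerDr.
Qed.

(** [h] needs no regularity, since continuity at x uses the bound with [h] evaluated at x only. *)
Lemma hoelder_measurable (f : R -> R) (h : R -> R) (s e : R) : 0 < s -> 0 < e ->
  (forall x y, 0 < x -> 0 < y -> `|x - y| <= s -> `|f x - f y| <= (`|x - y| / s) `^ e * h x) ->
  measurable_fun (Rplus R) f.
Proof.
move=> s0 e0 fh; apply: open_continuous_measurable_fun.
  rewrite (_ : Rplus R = `]0%R, +oo[%classic); first exact: interval_open.
  by apply/seteqP; split => x; rewrite /Rplus /= in_itv /= andbT.
move=> x; rewrite inE => x0; apply/cvgrPdist_le => eps eps0.
pose H := `|h x| + 1.
have H0 : 0 < H by rewrite /H; apply: ltr_wpDl.
pose d := Num.min s (s * (eps / H) `^ e^-1).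
have d0 : 0 < d by rewrite lt_min s0 /=; pos.
near=> y.
have y0 : 0 < y by near: y; exact: lt_nbhsr.
have yd : `|x - y| <= d by near: y; exact: cvgr_dist_le.
move: yd; rewrite le_min => /andP[h1 h2].
apply: (le_trans (fh _ _ x0 y0 h1)).
apply: (@le_trans _ _ (eps / H * H)); last by rewrite divfK// gt_eqF.
apply: (@le_trans _ _ ((`|x - y| / s) `^ e * H)).
  apply: ler_wpM2l; first exact: powR_ge0.
  by apply: (le_trans (ler_norm _)); rewrite /H lerDl.
apply: ler_wpM2r; first exact: ltW.
apply: (@le_trans _ _ (((eps / H) `^ e^-1) `^ e)).
  apply: ge0_ler_powR; rewrite ?nnegrE; [exact: ltW|pos|pos|].
  by rewrite ler_pdivrMr// mulrC.
by rewrite -powRrM mulVf ?gt_eqF// powRr1//; pos.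
Unshelve. all: by end_near. Qed.

(** Cauchy-Schwarz with the weights 2^-l, by induction from (x + y)^2 <= 2 x^2 + 2 y^2. The price
    2^l is later paid by the decay of the wavelet pieces. *)
Lemma sqr_sum_dyadic (x : nat -> R) n :
  (\sum_(0 <= l < n) x l) ^+ 2 <= 2 * \sum_(0 <= l < n) 2 ^+ l * x l ^+ 2.
Proof.
elim: n x => [|n IH] x; first by rewrite !big_geq// expr0n mulr0.
rewrite !big_nat_recl//= expr0 mul1r.
have := IH (fun l => x l.+1); set Y := \sum_(0 <= i < n) _ => h.
have -> : \sum_(0 <= i < n) 2 ^+ i.+1 * x i.+1 ^+ 2 =
    2 * \sum_(0 <= i < n) 2 ^+ i * x i.+1 ^+ 2.
  by rewrite mulr_sumr; apply: eq_bigr => i _; rewrite exprS mulrA.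
have := sqr_ge0 (x 0 - Y); nra.
Qed.

Definition chi (t : R) : R := Num.max 0 (Num.min 1 (2 - t)).

Lemma chi_ge0 t : 0 <= chi t. Proof. by rewrite /chi le_max lexx. Qed.
Lemma chi_le1 t : chi t <= 1.
Proof. by rewrite /chi ge_max ler01 ge_min lexx. Qed.
Lemma chi1 t : t <= 1 -> chi t = 1.
Proof.
move=> h; rewrite /chi (min_idPl _); last by lra.
by apply/max_idPr; lra.
Qed.
Lemma chi0 t : 2 <= t -> chi t = 0.
Proof. by move=> h; rewrite /chi; apply/max_idPl; rewrite ge_min; apply/orP; right; lra. Qed.

Lemma chi_lip t u : `|chi t - chi u| <= `|t - u|.
Proof.
wlog tu : t u / t <= u.
  move=> h; have [tu|tu] := leP t u; first exact: h.
  by rewrite distrC [leRHS]distrC; apply: h; exact: ltW.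
have -> : `|t - u| = u - t by rewrite ler0_norm; lra.
rewrite /chi /Num.max /Num.min /Order.max /Order.min.
rewrite ler_norml.
case: ifP; case: ifP; case: ifP; case: ifP => h1 h2 h3 h4; apply/andP;
move: h1 h2 h3 h4; rewrite ?ltNge; 
do ?[move/negbT; rewrite ?negbK => ?| move=> ?]; lra.
Qed.

Section cutoff.
Variables (y s : R) (s_gt0 : 0 < s).
Let q (x : R) := `|x - y| / s.

Definition cutoff (l : nat) (x : R) : R := chi (`|x - y| / s / 2 ^+ l).

(* The part of the cutoff at distance about 2^l s from y. *)
Definition annulus (l : nat) (x : R) : R :=
  cutoff l x - (if l is l'.+1 then cutoff l' x else 0).

Lemma sum_annulus n x : \sum_(0 <= l < n.+1) annulus l x = cutoff n x.
Proof.
elim: n => [|n IH]; first by rewrite big_nat1 /annulus subr0.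
by rewrite big_nat_recr//= IH /annulus; lra.
Qed.

Lemma cutoff_lip l x x' : `|cutoff l x - cutoff l x'| <= `|x - x'| / s.
Proof.
apply: (le_trans (chi_lip _ _)).
rewrite -mulrBl -mulrBl normrM normrM.
have p : 0 < (2 : R) ^+ l by pos.
rewrite (gtr0_norm (_ : 0 < s^-1)) ?invr_gt0// (gtr0_norm (_ : 0 < (2 ^+ l)^-1)) ?invr_gt0//.
apply: (@le_trans _ _ (`| `|x - y| - `|x' - y| | / s)).
  by apply: ler_piMr; [pos|rewrite invf_le1// exprn_ege1//; lra].
apply: ler_wpM2r; first by pos.
have -> : x - x' = (x - y) - (x' - y) by ring.
exact: ler_dist_dist.
Qed.

Lemma annulus_lip l x x' : `|annulus l x - annulus l x'| <= 2 * (`|x - x'| / s).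
Proof.
rewrite /annulus opprD addrACA; apply: (le_trans (ler_normD _ _)).
have h1 := cutoff_lip l x x'.
case: l h1 => [|l] h1.
  rewrite opprK addNr normr0; have : 0 <= `|x - x'| / s by pos.
  lra.
have := cutoff_lip l x x'; rewrite -opprD normrN; lra.
Qed.

Lemma annulus_le1 l x : `|annulus l x| <= 1.
Proof.
rewrite /annulus; have := chi_ge0 (`|x - y| / s / 2 ^+ l); have := chi_le1 (`|x - y| / s / 2 ^+ l).
case: l => [|l]; rewrite ler_norml /cutoff; first by move=> *; apply/andP; lra.
have := chi_ge0 (`|x - y| / s / 2 ^+ l); have := chi_le1 (`|x - y| / s / 2 ^+ l).
by move=> *; apply/andP; lra.
Qed.

Lemma cutoff_out l x : 2 ^+ l.+1 * s <= `|x - y| -> cutoff l x = 0.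
Proof.
move=> h; apply: chi0; rewrite ler_pdivlMr; last by pos.
by rewrite ler_pdivlMr// -exprS.
Qed.

Lemma annulus_out l x : 2 ^+ l.+1 * s <= `|x - y| -> annulus l x = 0.
Proof.
move=> h; rewrite /annulus cutoff_out//; case: l h => [|l] h; first by rewrite subrr.
rewrite cutoff_out ?subrr//; apply: le_trans h; apply: ler_wpM2r; first exact: ltW.
by have p : 0 < (2 : R) ^+ l.+1; [pos|rewrite [leRHS]exprS; lra].
Qed.

Lemma cutoff_in l x : q x <= 2 ^+ l -> cutoff l x = 1.
Proof. by move=> h; apply: chi1; rewrite ler_pdivrMr ?mul1r//; pos. Qed.

Lemma annulus_in l x : annulus l x != 0 -> 2 ^+ l <= 2 * (1 + q x).
Proof.
have q0 : 0 <= q x by rewrite /q; pos.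
case: l => [_|l]; first by rewrite expr0; lra.
rewrite leNgt; apply: contraNN => h; rewrite exprS in h.
have p : 0 < (2 : R) ^+ l by pos.
have h1 : q x <= 2 ^+ l by lra.
have h2 : q x <= 2 ^+ l.+1 by rewrite exprS; lra.
by rewrite /annulus !cutoff_in ?subrr.
Qed.

Lemma measurable_cutoff l : measurable_fun (Rplus R) (cutoff l).
Proof.
apply: (@hoelder_measurable _ (fun=> 1) s 1) => // x x' x0 x0' _.
by rewrite mulr1 powRr1; [exact: cutoff_lip|pos].
Qed.

Lemma measurable_annulus l : measurable_fun (Rplus R) (annulus l).
Proof.
apply: measurable_funB; first exact: measurable_cutoff.
by case: l => [|l]; [exact: measurable_cst|exact: measurable_cutoff].
Qed.

End cutoff.
End wavelet_atoms.

Lemma le_powR_unit (R : realType) (r e : R) : 0 <= r -> r <= 1 -> 0 < e -> e <= 1 -> r <= r `^ e.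
Proof.
move=> r0 r1 e0 e1; have [->|rn] := eqVneq r 0; first exact: powR_ge0.
have rp : 0 < r by rewrite lt_neqAle eq_sym rn.
rewrite /powR (negbTE rn) -{1}(lnK (x := r)) ?posrE// ler_expR.
by have := ln_le0 r1; nra.
Qed.

(** * Decay of wavelets and their decomposition over annuli *)

Section wavelet_pieces.
Context {R : realType}.
Variables (lambda : R) (lambda_gt0 : 0 < lambda).
Local Notation vol := (vol lambda).
Local Notation Int := (Int lambda).
Local Notation dominated := (dominated lambda).
Local Notation dominated_functional := (dominated_functional lambda).
Variable D : dyadic_system R.
Variable W : wavelet_basis lambda D.
Local Notation e := (eta W).
Local Notation atom := (atom lambda D e).
Local Notation scale := (scale D).
Local Notation wvol := (wvol lambda D).
Let e0 : 0 < e := eta_gt0 W.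
Let e1 : e <= 1 := eta_le1 W.
Local Notation ps := (psi W).
Local Notation q i x := (`|x - i.2| / scale i).
Local Notation cut i := (cutoff i.2 (scale i)).
Local Notation ann i := (annulus i.2 (scale i)).

Let sc0 i : 0 < scale i := scale_gt0 D i.1.

(** From here on the exponential bounds are used only through polynomial decay, whose order [M] each
    application chooses. *)
Lemma psi_decay (M : nat) : exists C : R, 0 < C /\ forall i, wavelet_index D i ->
  (forall x, 0 < x -> `|ps i x| <= C * (Num.sqrt (wvol i))^-1 * (1 + q i x) ^- M) /\
  (forall x y, 0 < x -> 0 < y -> `|x - y| <= scale i ->
    `|ps i x - ps i y| <= (`|x - y| / scale i) `^ e *
      (C * (Num.sqrt (wvol i))^-1 * (1 + q i x) ^- M)).
Proof.
have [a [nu [C [a0 nu0 C0 h]]]] := psi_regular W.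
have [C' [C'0 dec]] := expR_power_decay M a0 nu0.
exists (C * C'); split; first by pos.
move=> [k y] wi; have [h1 h2] := h _ _ wi.
have v0 := sqrt_wvol_gt0 lambda_gt0 wi.
have b x : C * (Num.sqrt (wvol (k, y)))^-1 * expR (- (nu * (`|y - x| / delta D ^ k) `^ a)) <=
    C * C' * (Num.sqrt (wvol (k, y)))^-1 * (1 + q (k, y) x) ^- M.
  have -> : C * C' * (Num.sqrt (wvol (k, y)))^-1 * (1 + q (k, y) x) ^- M =
    C * (Num.sqrt (wvol (k, y)))^-1 * (C' * (1 + q (k, y) x) ^- M) by ring.
  apply: ler_wpM2l; first by pos.
  have s0 := sc0 (k, y); rewrite [`|y - x|]distrC; apply: dec; pos.
split=> [x x0|x x' x0 x'0 xx]; first exact: le_trans (h1 _ x0) (b x).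
apply: (le_trans (h2 _ _ x0 x'0 xx)); apply: ler_wpM2l; [exact: powR_ge0|exact: b].
Qed.

(** [E] depends neither on the centre nor on the scale: it only has to exceed the exponent 2 lambda
    + 1 + g of the weight, because 1 + x <= (1 + y + s) (1 + |x - y| / s). *)
Lemma wt_lower (g : R) : 0 < g -> exists E : nat, forall y s, 0 < y -> 0 < s ->
  exists C : R, 0 < C /\ forall x, 0 < x -> (1 + `|x - y| / s) ^- E <= C * wt lambda g x.
Proof.
move=> g0; pose D0 := 2 * lambda + 1 + g.
exists (Num.truncn D0).+1 => y s y0 s0; set E := _.+1.
have l0 := lambda_gt0.
have DE : D0 <= E%:R by rewrite ltW// truncnS_gt.
exists ((1 + y + s) ^+ E); split; first by pos.
move=> x x0; set u := `|x - y| / s.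
have u0 : 0 <= u by rewrite /u; pos.
have ux : 1 + x <= (1 + y + s) * (1 + u).
  have h1 : x - y <= u * s by rewrite /u divfK ?gt_eqF// ler_norm.
  nra.
rewrite /wt -/D0 powRN.
have p0 : 0 < (1 + x) `^ D0 by apply: powR_gt0; lra.
rewrite ler_pdivlMr// mulrC ler_pdivrMr; last by apply: exprn_gt0; lra.
rewrite -exprMn; apply: (@le_trans _ _ ((1 + x) ^+ E)).
  rewrite -powR_mulrn; last by lra.
  by apply: ler_powR => //; lra.
by rewrite lerXn2r// ?nnegrE; nra.
Qed.

Lemma measurable_psi i : wavelet_index D i -> measurable_fun (Rplus R) (ps i).
Proof.
have [C [C0 h]] := psi_decay 0 => wi; have [_ h2] := h _ wi.
apply: (@hoelder_measurable _ _ (fun x => C * (Num.sqrt (wvol i))^-1 * (1 + q i x) ^- 0) (scale i) e) => //.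
Qed.

Lemma psi_dominated_tail (g : R) i : 0 < g -> wavelet_index D i ->
  exists C : R, 0 < C /\ forall x, 0 < x -> `|ps i x| <= C * wt lambda g x /\
    forall n, `|(1 - cut i n x) * ps i x| <= C * 2 ^- n * wt lambda g x.
Proof.
move=> g0 wi; have [E hE] := wt_lower g0.
(* One power more than the weight takes up: where the cutoff [n] is not 1, the spare factor (1 + |x
   - y| / s)^-1 is below 2^-n. *)
have [C1 [C10 h]] := psi_decay E.+1.
have y0 := index_gt0 wi.
have [C2 [C20 hw]] := hE _ _ y0 (sc0 i).
have [h1 _] := h _ wi.
have v0 := sqrt_wvol_gt0 lambda_gt0 wi.
pose C3 := C1 * (Num.sqrt (wvol i))^-1.
have C30 : 0 < C3 by rewrite /C3; pos.
exists (C3 * C2); split; first by pos.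
move=> x x0; have u0 : 0 <= q i x by have := sc0 i => ?; pos.
have w0 : 0 < wt lambda g x by exact: wt_gt0.
have u1 : 0 < (1 + q i x) ^- E by rewrite invr_gt0; apply: exprn_gt0; lra.
have psb : `|ps i x| <= C3 * (C2 * wt lambda g x) * (1 + q i x)^-1.
  apply: (le_trans (h1 _ x0)); rewrite -/C3 exprSr invfM [leLHS]mulrA.
  apply: ler_wpM2r; first by rewrite invr_ge0; lra.
  by apply: ler_wpM2l; [exact: ltW|exact: hw].
split.
  apply: (le_trans psb); rewrite -(mulrA C3 C2); apply: ler_piMr; first by pos.
  by rewrite invf_le1; lra.
move=> n; have [qn|qn] := leP (q i x) (2 ^+ n).
  by rewrite (cutoff_in qn) subrr mul0r normr0; pos.
rewrite normrM.
have c1 : `|1 - cut i n x| <= 1.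
  have := chi_ge0 (`|x - i.2| / scale i / 2 ^+ n); have := chi_le1 (`|x - i.2| / scale i / 2 ^+ n).
  by rewrite ler_norml /cutoff => *; apply/andP; lra.
apply: (@le_trans _ _ (1 * (C3 * (C2 * wt lambda g x) * (1 + q i x)^-1))).
  by apply: ler_pM.
rewrite mul1r; have -> : C3 * C2 * 2 ^- n * wt lambda g x = C3 * (C2 * wt lambda g x) * 2 ^- n by ring.
apply: ler_wpM2l; first by pos.
by rewrite lef_pV2 ?posrE; [lra|lra|pos].
Qed.

Lemma dominated_psi (g : R) i : 0 < g -> wavelet_index D i -> dominated g (ps i).
Proof.
move=> g0 wi; split; first exact: measurable_psi.
by have [C [_ h]] := psi_dominated_tail g0 wi; exists C => x x0; have [] := h _ x0.
Qed.

Lemma cutoff_bounded i l x : `|cut i l x| <= 1.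
Proof. by rewrite ger0_norm; [exact: chi_le1|exact: chi_ge0]. Qed.

Lemma dominated_cutoff (g : R) i l : 0 < g -> wavelet_index D i -> dominated g (cut i l).
Proof.
move=> g0 wi; have y0 := index_gt0 wi; have s0 := sc0 i.
have X0 : 0 < i.2 + 2 ^+ l.+1 * scale i by pos.
apply: (dominated_bounded lambda_gt0 g0 X0 (M := 1)).
- exact: measurable_cutoff.
- by move=> x _; exact: cutoff_bounded.
- move=> x xX; apply: cutoff_out => //; apply: le_trans (ler_norm _); lra.
Qed.

(** The multiple of the innermost cutoff that restores mean zero. The integral of that cutoff is at
    least [wvol i], so the division is under control. *)
Definition coef (l : nat) (i : int * R) : R :=
  Int (fun x => ps i x * ann i l x) / Int (cut i 0).

(* psi_i = sum_l piece l i, with mean-zero pieces supported at distance at most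
   2^(l+1) times the scale of i. *)
Definition piece (l : nat) (i : int * R) (x : R) : R :=
  ps i x * ann i l x - coef l i * cut i 0 x.

Lemma dominated_psi_annulus (g : R) i l : 0 < g -> wavelet_index D i ->
  dominated g (fun x => ps i x * ann i l x).
Proof.
move=> g0 wi; apply: (dominatedM (dominated_psi g0 wi) (measurable_annulus i.2 (sc0 i) l) (M := 1)).
by move=> x _; exact: annulus_le1.
Qed.

Lemma dominated_psi_cutoff (g : R) i l : 0 < g -> wavelet_index D i ->
  dominated g (fun x => ps i x * cut i l x).
Proof.
move=> g0 wi; apply: (dominatedM (dominated_psi g0 wi) (measurable_cutoff i.2 (sc0 i) l) (M := 1)).
by move=> x _; exact: cutoff_bounded.
Qed.

Lemma dominated_piece (g : R) i l : 0 < g -> wavelet_index D i -> dominated g (piece l i).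
Proof.
move=> g0 wi; apply: dominatedB; first exact: dominated_psi_annulus.
by apply: dominatedZ; exact: dominated_cutoff.
Qed.

Let IF := Int_functional lambda_gt0 (@ltr01 R).

Lemma Int_cutoff_ge i : wavelet_index D i -> wvol i <= Int (cut i 0).
Proof.
move=> wi; rewrite /wvol -(Int_indic lambda (mball i.2 (scale i)) (@ball_le _ _ _)).
apply: (le_Int lambda_gt0 ltr01).
- exact: (dominated_indic lambda_gt0 ltr01 (mball i.2 (scale i)) (@ball_le _ _ _)).
- exact: dominated_cutoff.
- move=> x x0; rewrite indicE; case: (boolP (x \in _)) => /= h; last exact: chi_ge0.
  rewrite cutoff_in// expr0 ler_pdivrMr ?mul1r//.
  by move: h; rewrite inE /ball /= distrC => /ltW.
Qed.

(** On annulus [l] decay of order [M] gives 2^(-l M). The correction term loses the ratio of the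
    volumes of the balls of radius 2^(l+1) and 1 scales, which accounts for 2^(l hdim). *)
Lemma piece_atom (M : nat) : exists C : R, 0 < C /\ forall l i, wavelet_index D i ->
  atom (2 ^+ l.+1) i (fun x => (C * 2 ^+ (l * hdim lambda) * 2 ^- (l * M))^-1 * piece l i x).
Proof.
have [C1 [C10 h]] := psi_decay M.
have [Cd [Cd1 dbl]] := doubling lambda_gt0.
(* 4^M transfers the decay to a point within one scale of the annulus; 3 = 1 + 2 adds the two terms
   of the product rule for psi times annulus. *)
pose A := 3 * 4 ^+ M * C1.
have A0 : 0 < A by rewrite /A; pos.
(* The factor 2 is for the two terms of [piece], the rest for doubling up to radius 2^(l+1)
   scales. *)
exists (2 * A * Cd * 2 ^+ hdim lambda); split; first by pos.
move=> l i wi; have [ps1 ps2] := h _ wi.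
have y0 := index_gt0 wi; have s0 := sc0 i.
have v0 := sqrt_wvol_gt0 lambda_gt0 wi.
have V0 := wvol_gt0 lambda_gt0 wi.
set sV := Num.sqrt (wvol i) in v0 ps1 ps2.
have VE : wvol i = sV ^+ 2 by rewrite sqr_sqrtr// ltW.
pose t : R := 2 ^- (l * M).
have t0 : 0 < t by rewrite /t; pos.
pose H : R := 2 ^+ (l * hdim lambda).
have H1 : 1 <= H by rewrite exprn_ege1// ler1n.
have q0 x : 0 <= q i x by pos.
have dec (k : R) x : 1 <= k -> 2 ^+ l <= k * (1 + q i x) -> (1 + q i x) ^- M <= k ^+ M * t.
  move=> k1 h1; have -> : t = (2 ^- l) ^+ M by rewrite /t exprM exprVn.
  have q0x := q0 x; have p : 0 < (2 : R) ^+ l by pos.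
  rewrite -exprMn -(exprVn (1 + q i x)) lerXn2r// ?nnegrE; [by pos|by pos|].
  rewrite -[leLHS]mul1r ler_pdivrMr; last by lra.
  by rewrite mulrAC ler_pdivlMr ?mul1r.
have P1 x : 0 < x -> `|ps i x * ann i l x| <= A * t * sV^-1.
  move=> x0; have [->|a0] := eqVneq (ann i l x) 0; first by rewrite mulr0 normr0; pos.
  rewrite normrM; apply: (@le_trans _ _ (C1 * sV^-1 * (2 ^+ M * t) * 1)).
    apply: ler_pM => //; last exact: annulus_le1.
    apply: (le_trans (ps1 _ x0)); apply: ler_wpM2l; first by pos.
    by apply: dec; [rewrite ler1n|exact: annulus_in].
  have -> : C1 * sV^-1 * (2 ^+ M * t) * 1 = (C1 * t * sV^-1) * 2 ^+ M by ring.
  have -> : A * t * sV^-1 = (C1 * t * sV^-1) * (3 * 4 ^+ M) by rewrite /A; ring.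
  apply: ler_wpM2l; first by pos.
  have : (2 : R) ^+ M <= 4 ^+ M by rewrite lerXn2r// ?nnegrE// ler_nat.
  have : 0 < (4 : R) ^+ M by pos.
  lra.
have P2 x x' : 0 < x -> 0 < x' -> `|x - x'| <= scale i ->
    `|ps i x * ann i l x - ps i x' * ann i l x'| <= A * t * sV^-1 * (`|x - x'| / scale i) `^ e.
  move=> x0 x'0 xx.
  set r := `|x - x'| / scale i.
  have r0 : 0 <= r by rewrite /r; pos.
  have r1 : r <= 1 by rewrite /r ler_pdivrMr ?mul1r.
  have re : r <= r `^ e by exact: le_powR_unit.
  have qq : q i x <= q i x' + 1.
    rewrite ler_pdivrMr// mulrDl divfK ?gt_eqF// mul1r.
    have -> : x - i.2 = (x' - i.2) + (x - x') by ring.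
    by apply: (le_trans (ler_normD _ _)); lra.
  have -> : ps i x * ann i l x - ps i x' * ann i l x' =
     (ps i x - ps i x') * ann i l x + ps i x' * (ann i l x - ann i l x') by ring.
  apply: (le_trans (ler_normD _ _)); rewrite !normrM.
  have T1 : `|ps i x - ps i x'| * `|ann i l x| <= C1 * 4 ^+ M * t * sV^-1 * r `^ e.
    have [->|a0] := eqVneq (ann i l x) 0.
      by rewrite normr0 mulr0; pos.
    apply: (@le_trans _ _ (r `^ e * (C1 * sV^-1 * (4 ^+ M * t)) * 1)).
      apply: ler_pM => //; last exact: annulus_le1.
      apply: (le_trans (ps2 _ _ x0 x'0 xx)); apply: ler_wpM2l; first exact: powR_ge0.
      apply: ler_wpM2l; first by pos.
      apply: dec; first by rewrite ler1n.
      by have := annulus_in s0 a0; have := q0 x; lra.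
    by rewrite le_eqVlt; apply/orP; left; apply/eqP; ring.
  have T2 : `|ps i x'| * `|ann i l x - ann i l x'| <= 2 * (C1 * 4 ^+ M * t * sV^-1 * r `^ e).
    have [|] := boolP ((ann i l x == 0) && (ann i l x' == 0)).
      move=> /andP[/eqP -> /eqP ->]; rewrite subrr normr0 mulr0; pos.
    rewrite negb_and => a0.
    have q' : 2 ^+ l <= 4 * (1 + q i x').
      by case/orP: a0 => a0; have := annulus_in s0 a0; have := q0 x'; lra.
    apply: (@le_trans _ _ (C1 * sV^-1 * (4 ^+ M * t) * (2 * r `^ e))).
      apply: ler_pM => //.
        apply: (le_trans (ps1 _ x'0)); apply: ler_wpM2l; first by pos.
        by apply: dec; [rewrite ler1n|].
      apply: (le_trans (annulus_lip i.2 s0 l x x')); rewrite -/r; lra.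
    by rewrite le_eqVlt; apply/orP; left; apply/eqP; ring.
  apply: (le_trans (lerD T1 T2)).
  by rewrite le_eqVlt; apply/orP; left; apply/eqP; rewrite /A; ring.
have dpa := dominated_psi_annulus l ltr01 wi.
have dc0 := dominated_cutoff 0 ltr01 wi.
have Ic := Int_cutoff_ge wi.
have Ic0 : 0 < Int (cut i 0) by lra.
have cb : `|coef l i| <= A * Cd * 2 ^+ hdim lambda * H * t * sV^-1.
  rewrite /coef normrM normfV (gtr0_norm Ic0) ler_pdivrMr//.
  have mb := mball i.2 (2 ^+ l.+1 * scale i).
  have dB : dominated 1 (\1_(ball i.2 (2 ^+ l.+1 * scale i))).
    exact: (dominated_indic lambda_gt0 ltr01 mb (@ball_le _ _ _)).
  apply: (@le_trans _ _ (Int (fun x => A * t * sV^-1 * \1_(ball i.2 (2 ^+ l.+1 * scale i)) x))).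
    apply: (Int_abs_le lambda_gt0 ltr01) => //; first exact: dominatedZ.
    move=> x x0; rewrite indicE; case: (boolP (x \in _)) => /= hx.
      by rewrite mulr1; exact: P1.
    rewrite annulus_out ?mulr0 ?normr0//.
    by rewrite leNgt; apply: contra hx => hx; rewrite inE /ball /= distrC.
  rewrite (functionalZ IF)// (Int_indic lambda mb (@ball_le _ _ _)).
  have -> : A * Cd * 2 ^+ hdim lambda * H * t * sV^-1 * Int (cut i 0) =
     A * t * sV^-1 * (Cd * (2 ^+ hdim lambda * H) * Int (cut i 0)) by ring.
  apply: ler_wpM2l; first by pos.
  apply: (le_trans (dbl _ _ _ y0 s0 _)); first by rewrite exprn_ege1// ler1n.
  rewrite -exprM mulSn exprD; apply: ler_wpM2l; [pos|exact: Ic].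
set c := _ * _ * _.
have cE : c = 2 * (A * Cd * 2 ^+ hdim lambda * H * t) by rewrite /c /t /H; ring.
have big : A * t <= A * Cd * 2 ^+ hdim lambda * H * t.
  apply: ler_wpM2r; first exact: ltW.
  have -> : A * Cd * 2 ^+ hdim lambda * H = A * (Cd * (2 ^+ hdim lambda * H)) by ring.
  apply: ler_peMr; first exact: ltW.
  have h1 : 1 <= (2 : R) ^+ hdim lambda by rewrite exprn_ege1// ler1n.
  have : 1 <= 2 ^+ hdim lambda * H by nra.
  nra.
have At0 : 0 < A * t by pos.
have c0 : 0 < c by rewrite cE; lra.
have iv0 : 0 < sV^-1 by rewrite invr_gt0.
split.
- apply: measurable_funM => //; by case: (dominated_piece l ltr01 wi).
- rewrite (functionalZ IF); last exact: dominated_piece.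
  rewrite (functionalB IF)//; last exact: dominatedZ.
  rewrite (functionalZ IF)// /coef divfK ?gt_eqF// subrr mulr0//.
- move=> x x0; rewrite normrM gtr0_norm ?invr_gt0// mulrC ler_pdivrMr//.
  apply: (le_trans (ler_normB _ _)); rewrite (normrM (coef l i)).
  have h1 := P1 _ x0.
  have h2 : `|coef l i| * `|cut i 0 x| <= A * Cd * 2 ^+ hdim lambda * H * t * sV^-1 * 1.
    by apply: ler_pM => //; exact: cutoff_bounded.
  rewrite -/sV; apply: (le_trans (lerD h1 h2)).
  have -> : sV^-1 * c = A * Cd * 2 ^+ hdim lambda * H * t * sV^-1 + A * Cd * 2 ^+ hdim lambda * H * t * sV^-1 * 1.
    by rewrite cE; ring.
  by rewrite lerD2r; apply: ler_wpM2r => //; exact: ltW.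
- move=> x x0 hx; rewrite /piece annulus_out// mulr0 sub0r cutoff_out ?mulr0 ?oppr0 ?mulr0//.
  apply: le_trans hx; apply: ler_wpM2r; first exact: ltW.
  by rewrite [leRHS]exprS expr1; have : 1 <= (2 : R) ^+ l; [rewrite exprn_ege1// ler1n|lra].
- move=> x x' x0 x'0 xx; rewrite -mulrBr normrM gtr0_norm ?invr_gt0// mulrC ler_pdivrMr//.
  have -> : piece l i x - piece l i x' = (ps i x * ann i l x - ps i x' * ann i l x') -
     coef l i * (cut i 0 x - cut i 0 x') by rewrite /piece; ring.
  apply: (le_trans (ler_normB _ _)); rewrite (normrM (coef l i)).
  have h1 := P2 _ _ x0 x'0 xx.
  set r := `|x - x'| / scale i in h1 *.
  have r0 : 0 <= r by rewrite /r; pos.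
  have r1 : r <= 1 by rewrite /r ler_pdivrMr ?mul1r.
  have re : r <= r `^ e by exact: le_powR_unit.
  have h2 : `|coef l i| * `|cut i 0 x - cut i 0 x'| <= A * Cd * 2 ^+ hdim lambda * H * t * sV^-1 * r `^ e.
    by apply: ler_pM => //; apply: (le_trans (cutoff_lip _ s0 _ _ _)).
  rewrite -/sV; apply: (le_trans (lerD h1 h2)).
  have -> : sV^-1 * r `^ e * c = A * Cd * 2 ^+ hdim lambda * H * t * sV^-1 * r `^ e + A * Cd * 2 ^+ hdim lambda * H * t * sV^-1 * r `^ e.
    by rewrite cE; ring.
  rewrite lerD2r; apply: ler_wpM2r; first exact: powR_ge0.
  by apply: ler_wpM2r => //; exact: ltW.
Qed.

Lemma sum_piece n i x : wavelet_index D i -> \sum_(0 <= l < n.+1) piece l i x =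
  ps i x * cut i n x - Int (fun x => ps i x * cut i n x) / Int (cut i 0) * cut i 0 x.
Proof.
move=> wi; rewrite /piece sumrB -mulr_sumr sum_annulus -mulr_suml; congr (_ - _ * _).
rewrite -mulr_suml; congr (_ / _).
rewrite -(functional_sum IF); last by move=> l _; exact: dominated_psi_annulus.
by congr Int; apply/funext => z; rewrite -mulr_sumr sum_annulus.
Qed.

(** The error consists of the tail of psi beyond cutoff [n] and a correction proportional to the
    integral of the truncated wavelet. As psi has mean zero, that integral is minus the integral of
    the tail, so both parts are of order 2^-n. *)
Lemma functional_piece_cvg g L K i : 0 < g -> dominated_functional g L K ->
  wavelet_index D i -> (fun n => \sum_(0 <= l < n.+1) L (piece l i)) @ \oo --> L (ps i).
Proof.
move=> g0 LK wi; have [C [C0 h]] := psi_dominated_tail g0 wi.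
have IFg := Int_functional lambda_gt0 g0.
have K0 := functional_ge0 LK; have K10 := functional_ge0 IFg.
have V0 := wvol_gt0 lambda_gt0 wi.
have Ic0 : 0 < Int (cut i 0) by apply: lt_le_trans (Int_cutoff_ge wi).
have dps := dominated_psi g0 wi.
have dcut := dominated_cutoff 0 g0 wi.
have dpc n := dominated_psi_cutoff n g0 wi.
have tail Lf Kf n : dominated_functional g Lf Kf ->
    `|Lf (ps i) - Lf (fun x => ps i x * cut i n x)| <= C * 2 ^- n * Kf.
  move=> LKf; rewrite -(functionalB LKf)//; apply: (functional_le LKf).
    exact: dominatedB.
  move=> x x0; have [_ /(_ n)] := h _ x0; congr (`|_| <= _); ring.
pose B := C * K + C * Int (wt lambda g) / Int (cut i 0) * `|L (cut i 0)|.
have B0 : 0 <= B.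
  by rewrite /B; apply: addr_ge0; [pos|apply: mulr_ge0 => //; apply: divr_ge0; [apply: mulr_ge0 => //|]; exact: ltW].
have main n : `|L (ps i) - \sum_(0 <= l < n.+1) L (piece l i)| <= B * 2 ^- n.
  rewrite -(functional_sum LK); last by move=> l _; exact: dominated_piece.
  have -> : (fun x => \sum_(0 <= l < n.+1) piece l i x) = (fun x => ps i x * cut i n x -
      Int (fun x => ps i x * cut i n x) / Int (cut i 0) * cut i 0 x).
    by apply/funext => x; exact: sum_piece.
  rewrite (functionalB LK)//; last exact: dominatedZ.
  rewrite (functionalZ LK)// opprB addrCA addrC.
  apply: (le_trans (ler_normD _ _)); rewrite /B mulrDl; apply: lerD.
    by apply: (le_trans (tail _ _ _ LK)); rewrite mulrAC.
  rewrite !normrM normfV (gtr0_norm Ic0).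
  have := tail _ _ n IFg; rewrite (_ : Int (ps i) = 0); last exact: psi_mean0.
  rewrite sub0r normrN => h1.
  have -> : C * Int (wt lambda g) / Int (cut i 0) * `|L (cut i 0)| * 2 ^- n =
     C * 2 ^- n * Int (wt lambda g) / Int (cut i 0) * `|L (cut i 0)| by ring.
  apply: ler_wpM2r => //; apply: ler_wpM2r; [by rewrite invr_ge0 ltW|exact: h1].
apply/cvgrPdist_le => eps eps0; near=> n.
apply: (le_trans (main n)).
apply: (@le_trans _ _ (eps / (B + 1) * (B + 1))); last by rewrite divfK// gt_eqF//; lra.
rewrite mulrC; apply: ler_pM; [pos|exact: B0| |lra].
rewrite -[leRHS]invrK lef_pV2 ?posrE; [|pos|by rewrite invr_gt0; apply: divr_gt0 => //; lra].
near: n; exists (Num.truncn (eps / (B + 1))^-1).+1 => // n /= nd.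
apply: (le_trans (ltW (truncnS_gt _))).
by rewrite -natrX ler_nat; apply: (leq_trans nd); exact/ltnW/ltn_expl.
Unshelve. all: by end_near. Qed.

(** Passage from atoms to wavelets. The functional may depend on the summation index [a] and not
    only on the wavelet [idx a], because in two variables the second wavelet is frozen inside it. *)
Theorem wavelet_square_sum (E : nat) : exists C : R, 0 < C /\
  forall (A : eqType) (S : seq A) (idx : A -> int * R) (L : A -> (R -> R) -> R) (g B : R),
  0 < g -> 0 <= B ->
  (forall a, a \in S -> wavelet_index D (idx a) /\ exists K, dominated_functional g (L a) K) ->
  (forall (r : R) f, 1 <= r -> (forall i, wavelet_index D i -> atom r i (f i)) ->
    \sum_(a <- S) (L a (f (idx a))) ^+ 2 <= B * r ^+ E) ->
  \sum_(a <- S) (L a (ps (idx a))) ^+ 2 <= C * B.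
Proof.
(* [h] cancels the volume loss of the pieces, [E] pays for r^E at r = 2^(l+1), and the remaining 1,
   squared, leaves 2^-l after the weight 2^l of [sqr_sum_dyadic]. *)
pose h := hdim lambda; pose M := (1 + h + E)%N.
have [c [c0 at_]] := piece_atom M.
exists (4 * c ^+ 2 * 2 ^+ E); split; first by pos.
move=> A S idx L g B g0 B0 HS H.
pose k (l : nat) : R := c * 2 ^+ (l * h) * 2 ^- (l * M).
have k0 l : 0 < k l by rewrite /k; pos.
pose L' a := if a \in S then L a else fun=> 0.
rewrite big_seq (eq_bigr (fun a => (L' a (ps (idx a))) ^+ 2)) -?big_seq; last first.
  by move=> a aS; rewrite /L' aS.
apply: (@cvg_sum_sqr _ _ S (fun a n => \sum_(0 <= l < n.+1) L' a (piece l (idx a)))).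
  move=> a; rewrite /L'; case: ifP => aS; last first.
    by under eq_fun do rewrite big1//; exact: cvg_cst.
  have [wa [K LK]] := HS _ aS; exact: functional_piece_cvg LK wa.
move=> n; pose X a l := L' a (piece l (idx a)).
apply: (@le_trans _ _ (\sum_(a <- S) 2 * \sum_(0 <= l < n.+1) 2 ^+ l * X a l ^+ 2)).
  by apply: ler_sum => a _; exact: sqr_sum_dyadic.
rewrite -mulr_sumr exchange_big /=.
apply: (@le_trans _ _ (2 * \sum_(0 <= l < n.+1) c ^+ 2 * 2 ^+ E * B * (2^-1) ^+ l)); last first.
  rewrite -mulr_sumr.
  have g2 := @geometric_sum_le R 2^-1 n.+1.
  have -> : 4 * c ^+ 2 * 2 ^+ E * B = 2 * (c ^+ 2 * 2 ^+ E * B * (1 - 2^-1)^-1) by field.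
  by apply: ler_wpM2l => //; apply: ler_wpM2l; [pos|apply: g2; apply/andP; lra].
apply: ler_wpM2l => //; apply: ler_sum => l _; rewrite -mulr_sumr.
have at_l i : wavelet_index D i -> atom (2 ^+ l.+1) i (fun x => (k l)^-1 * piece l i x).
  by move=> wi; exact: at_.
have r1 : 1 <= (2 : R) ^+ l.+1 by rewrite exprn_ege1// ler1n.
have := H _ _ r1 at_l => h1.
have XE : \sum_(a <- S) X a l ^+ 2 = k l ^+ 2 * \sum_(a <- S) (L a (fun x => (k l)^-1 * piece l (idx a) x)) ^+ 2.
  rewrite mulr_sumr big_seq [RHS]big_seq; apply: eq_bigr => a aS.
  have [wa [K LK]] := HS _ aS.
  rewrite /X /L' aS (functionalZ LK); last exact: dominated_piece.
  by field; rewrite gt_eqF.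
rewrite XE.
apply: (@le_trans _ _ (2 ^+ l * (k l ^+ 2 * (B * (2 ^+ l.+1) ^+ E)))).
  by apply: ler_wpM2l; [pos|apply: ler_wpM2l => //; pos].
have -> : k l = c * 2 ^+ (l * h) * 2 ^- (l * M) by [].
have -> : (l * M = l + l * h + l * E)%N by rewrite /M !mulnDr muln1.
have -> : (2 : R) ^+ l.+1 ^+ E = 2 ^+ E * 2 ^+ (l * E) by rewrite -exprM mulSn exprD.
rewrite !exprD exprVn.
have p (n' : nat) : 0 < (2 : R) ^+ n' by pos.
apply: (@le_trans _ _ (c ^+ 2 * 2 ^+ E * B * 2 ^- l * (2 ^+ (l * E))^-1)).
  by rewrite le_eqVlt; apply/orP; left; apply/eqP; field; rewrite !gt_eqF.
apply: ler_piMr; first by pos.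
by rewrite invf_le1// exprn_ege1//; lra.
Qed.

End wavelet_pieces.

(** * Carleson estimates for wavelets and bilinear forms *)

Section product_carleson.
Context {R : realType}.
Variables (lambda : R) (lambda_gt0 : 0 < lambda).
Local Notation m := (bessel_measure lambda).
Local Notation mu := (bessel_measure2 lambda).
Local Notation vol := (vol lambda).
Local Notation Int := (Int lambda).
Local Notation dominated := (dominated lambda).
Local Notation dominated_functional := (dominated_functional lambda).
Local Notation bmo_functional := (bmo_functional lambda).
Local Notation itv_mean := (itv_mean lambda).

Theorem carleson_wavelets (D : dyadic_system R) (W : wavelet_basis lambda D) :
  exists C : R, 0 < C /\
  forall g L K N (s : seq (int * R)) (U : set R) X, 0 < g ->
  dominated_functional g L K -> bmo_functional L N -> 0 < N -> uniq s ->
  (forall i, i \in s -> wavelet_index D i) ->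
  measurable U -> (forall x, U x -> x <= X) ->
  (forall i, i \in s -> wavelet_cube D i `<=` U) ->
  \sum_(i <- s) (L (psi W i)) ^+ 2 <= C * (N ^+ 2 * vol U).
Proof.
have [C1 [C10 ca]] := carleson_atoms lambda_gt0 D (eta_gt0 W) (eta_le1 W).
have [C2 [C20 ws]] := wavelet_square_sum lambda_gt0 W (3 * hdim lambda).+1.
exists (C2 * C1); split; first by pos.
move=> g L K N s U X g0 LK LN N0 us wi mU UX sU.
rewrite -mulrA; apply: (ws _ s id (fun=> L) g _ g0).
- by have := vol_ge0 lambda U => v0; pos.
- by move=> i si; split; [exact: wi|exists K].
- move=> r f r1 af.
  apply: le_trans (ca g L K N r s f U X g0 LK LN N0 r1 us _ mU UX sU) _.
    by move=> i si; split; [exact: wi|apply: af; exact: wi].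
  by rewrite le_eqVlt; apply/orP; left; apply/eqP; ring.
Qed.

Lemma integral_Rplus (f : R -> \bar R) : measurable_fun setT f -> (forall x, 0 <= f x)%E ->
  (\int[m]_x f x = \int[m]_(x in Rplus R) f x)%E.
Proof.
move=> mf f0.
rewrite (@ge0_negligible_integral _ _ _ m setT (~` Rplus R))//.
- by rewrite setTD setCK.
- by apply: measurableC; exact: measurable_Rplus.
- rewrite -[LHS]bessel_measure_setIRplus setICl; exact: measure0.
Qed.

Lemma fine_integral_le (f h : R -> \bar R) (c : R) : 0 <= c ->
  measurable_fun setT f -> measurable_fun setT h ->
  (forall x, 0 <= f x)%E -> (forall x, 0 <= h x)%E -> (\int[m]_x h x < +oo)%E ->
  (forall x, f x <= c%:E * h x)%E ->
  fine (\int[m]_x f x)%E <= c * fine (\int[m]_x h x)%E.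
Proof.
move=> c0 mf mh f0 h0 hy fh.
have h1 : (\int[m]_x f x <= c%:E * \int[m]_x h x)%E.
  rewrite -ge0_integralZl_EFin//; apply: ge0_le_integral => //.
  exact: measurable_funeM.
have hf : (\int[m]_x h x)%E \is a fin_num by rewrite ge0_fin_numE// integral_ge0.
rewrite -[c]/(fine c%:E) -fineM//; apply: fine_le => //; last by rewrite fin_numM.
rewrite ge0_fin_numE ?integral_ge0//; apply: (le_lt_trans h1).
by rewrite lte_mul_pinfty// lee_fin.
Qed.

Lemma step_bounded n (a b : R) (v : R -> R -> R) :
  exists M, forall x, 0 < x -> `|step n a b v x| <= M.
Proof.
have [_ [M hM]] := dominated_step lambda_gt0 (@ltr01 R) n a b v.
have M0 : 0 <= M.
  have := hM _ ltr01; have w0 : 0 < wt lambda 1 1 by exact: wt_gt0.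
  by move=> h1; rewrite -(pmulr_lge0 _ w0); apply: le_trans h1.
exists M => x x0; apply: (le_trans (hM _ x0)).
by apply: ler_piMr => //; exact: wt_le1.
Qed.

(** A finite union of rectangles. For wavelet cubes it replaces the open set of the Carleson
    condition by the part that a finite partial sum sees. *)
Definition incidence (I J : eqType) (E : I -> set R) (G : J -> set R) (S : seq (I * J)) :
    set (R * R) :=
  [set z | exists2 p, p \in S & E p.1 z.1 /\ G p.2 z.2].

Section incidence.
Variables (I J : eqType) (E : I -> set R) (G : J -> set R) (S : seq (I * J)) (X : R).
Hypothesis mE : forall p, p \in S -> measurable (E p.1).
Hypothesis mG : forall p, p \in S -> measurable (G p.2).
Hypothesis EX : forall p x, p \in S -> E p.1 x -> x <= X.
Hypothesis GX : forall p x, p \in S -> G p.2 x -> x <= X.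
Local Notation Q := (incidence E G S).

Lemma measurable_incidence : measurable Q.
Proof.
elim: S mE mG => [|p s IH] mE' mG'.
  by rewrite (_ : incidence E G [::] = set0)//; apply/seteqP; split => // z [].
rewrite (_ : incidence E G (p :: s) = (E p.1 `*` G p.2) `|` incidence E G s).
  apply: measurableU; first by apply: measurableX; [exact: mE' (mem_head _ _)|exact: mG' (mem_head _ _)].
  by apply: IH => r rs; [apply: mE'|apply: mG']; rewrite inE rs orbT.
apply/seteqP; split => z.
  by case=> r; rewrite inE => /predU1P[->|rs] h; [left|right; exists r].
by case=> [h|[r rs h]]; [exists p|exists r] => //; rewrite inE ?eqxx ?rs ?orbT.
Qed.

Lemma xsection_incidence x :
  xsection Q x = [set y | exists2 p, p \in S & E p.1 x /\ G p.2 y].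
Proof. by apply/seteqP; split => y; rewrite /xsection /= inE. Qed.

Lemma ysection_incidence y :
  ysection Q y = [set x | exists2 p, p \in S & E p.1 x /\ G p.2 y].
Proof. by apply/seteqP; split => x; rewrite /ysection /= inE. Qed.

Lemma measurable_xsection_incidence x : measurable (xsection Q x).
Proof. apply: measurable_xsection; exact: measurable_incidence. Qed.

Lemma measurable_ysection_incidence y : measurable (ysection Q y).
Proof. apply: measurable_ysection; exact: measurable_incidence. Qed.

Lemma mu_incidence : mu Q = (\int[m]_x m (xsection Q x))%E.
Proof. by []. Qed.

(** Tonelli. The product measure is defined through sections at fixed x1, whereas the enlargement of
    cubes in x1 is estimated at fixed x2. *)
Lemma mu_incidence_swap : mu Q = (\int[m]_y m (ysection Q y))%E.
Proof.
have mQ := measurable_incidence.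
have FE := @indic_fubini_tonelli_FE _ _ _ _ R m Q mQ.
have GE := @indic_fubini_tonelli_GE _ _ _ _ R m Q mQ.
transitivity (\int[m]_x fubini_F m (EFin \o \1_Q) x)%E; first by rewrite FE.
rewrite (@indic_fubini_tonelli _ _ _ _ R m m Q mQ).
by apply: eq_integral => y _; exact: (congr1 (@^~ y) GE).
Qed.

Lemma mu_incidence_lty : (mu Q < +oo)%E.
Proof.
have m1 : measurable [set` `]-oo, X]] by exact: measurable_itv.
apply: (@le_lt_trans _ _ (mu ([set` `]-oo, X]] `*` [set` `]-oo, X]]))).
  apply: le_measure; rewrite ?inE; [exact: measurable_incidence|exact: measurableX|].
  by move=> z [p pS [h1 h2]]; split; rewrite /= in_itv /=; [exact: EX h1|exact: GX h2].
have fin : (m [set` `]-oo, X]] < +oo)%E.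
  by apply: (bessel_measure_lty lambda_gt0 (b := X)) => // x; rewrite /= in_itv.
by rewrite /bessel_measure2 product_measure1E// lte_mul_pinfty// ge0_fin_numE.
Qed.

Lemma Int_xsection_incidence g : 0 < g -> 0 < X ->
  dominated g (fun x => vol (xsection Q x)) /\ Int (fun x => vol (xsection Q x)) = fine (mu Q).
Proof.
move=> g0 X0; have mxs := measurable_xsection_incidence.
have xsX x y : xsection Q x y -> y <= X.
  by rewrite xsection_incidence => -[p pS [_ h]]; exact: GX h.
have mm : measurable_fun setT (m \o xsection Q) by exact: measurable_fun_xsection measurable_incidence.
split; last first.
  rewrite /Int /Rintegral mu_incidence integral_Rplus//; congr fine.
  by apply: eq_integral => x _; rewrite (volE lambda_gt0 (mxs x) (@xsX x)).
apply: (dominated_bounded lambda_gt0 g0 X0 (M := vol `]0%R, X]%classic)).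
- apply: measurable_funTS.
  by apply: (@measurableT_comp _ _ _ _ _ _ fine _ (m \o xsection Q)); first exact: fine_measurable.
- move=> x _; rewrite ger0_norm; last exact: vol_ge0.
  apply: (@le_vol _ _ lambda_gt0 _ _ X) => //.
    by move=> y [/xsX h1 h2]; rewrite /= in_itv/= h1 andbT.
  by move=> y; rewrite /= in_itv/= => /andP[].
- move=> x Xx; rewrite (_ : xsection Q x = set0); first by rewrite /vol measure0.
  apply/seteqP; split => // y; rewrite xsection_incidence => -[p pS [h _]].
  by have := EX pS h; rewrite leNgt Xx.
Qed.

End incidence.

(** The balls of radius [L] scales lie in the triples of selected balls, whose cubes are disjoint
    subsets of [Q]. It is applied to slices, in order to enlarge cubes to supports of atoms in one
    variable. *)
Lemma vitali_union (D : dyadic_system R) : exists C : R, 0 < C /\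
  forall L (T : seq (int * R)) (B Q : set R) X, 1 <= L ->
  (forall i, i \in T -> wavelet_index D i) ->
  measurable B -> measurable Q -> (forall x, B x -> x <= X) -> (forall x, Q x -> x <= X) ->
  (forall x, B x -> exists2 i, i \in T & ball i.2 (L * scale D i) x) ->
  (forall i, i \in T -> wavelet_cube D i `<=` Q) ->
  vol B <= C * L ^+ hdim lambda * vol Q.
Proof.
have [C2 [C21 cb]] := wavelet_cube_ball D.
have [C3 [C30 vc]] := vol_wavelet_cube lambda_gt0 D.
exists (C3 * (3 * C2) ^+ hdim lambda); split; first by pos.
move=> L T B Q X L1 wT mB mQ BX QX BT TQ.
have L0 : 0 < L by lra.
have sc0 i : 0 < scale D i := scale_gt0 D i.1.
pose r i := L * C2 * scale D i.
have r0 i : 0 < r i by rewrite /r; apply: mulr_gt0 => //; pos.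
have rC i : C2 * scale D i <= r i.
  by rewrite /r; apply: ler_wpM2r; [exact: ltW|apply: ler_peMl => //; lra].
have rL i : L * scale D i <= r i.
  by rewrite /r -mulrA; apply: ler_wpM2l; [exact: ltW|apply: ler_peMl => //; exact: ltW].
have [|G [uG GT Gd Gc]] := @vitali_select R _ (fun i : int * R => i.2) r T; first by [].
apply: (@le_trans _ _ (\sum_(j <- G) vol (ball j.2 (3 * C2 * L * scale D j)))).
  pose Y := \sum_(j <- G) `|j.2 + 3 * C2 * L * scale D j|.
  apply: (vol_bigcup_le lambda_gt0 (A := fun j => ball j.2 (3 * C2 * L * scale D j)) (X := Num.max X Y)) => //.
  - by move=> x /BX h; rewrite le_max h.
  - move=> j x jG /ball_le h; rewrite le_max; apply/orP; right; apply: (le_trans h).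
    apply: (le_trans (ler_norm _)); rewrite /Y (big_rem j)//= lerDl.
    by apply: sumr_ge0 => i _.
  - move=> x x0 /BT [i iT ix]; have [j jG [h1 h2]] := Gc _ iT.
    exists j => //; move: ix; rewrite /ball /= => ix.
    rewrite (_ : j.2 - x = (i.2 - x) - (i.2 - j.2)); last by ring.
    apply: (le_lt_trans (ler_normB _ _)).
    have -> : 3 * C2 * L * scale D j = 3 * r j by rewrite /r; ring.
    by have := rL i; lra.
apply: (@le_trans _ _ (\sum_(j <- G) C3 * (3 * C2 * L) ^+ hdim lambda * vol (wavelet_cube D j))).
  rewrite big_seq [leRHS]big_seq; apply: ler_sum => j jG.
  by apply: vc; [exact: wT (GT _ jG)|nra].
rewrite -mulr_sumr exprMn mulrA; apply: ler_wpM2l; first by pos.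
apply: (sum_vol_le lambda_gt0 uG _ mQ QX).
- by move=> j /GT /wT [wj _]; exact: (cube_measurable wj).
- by move=> j x /GT jT _; exact: TQ.
- move=> i j x iG jG ij x0.
  move=> /(cb _ (wT _ (GT _ iG))); rewrite /ball /= => h1.
  move=> /(cb _ (wT _ (GT _ jG))); rewrite /ball /= => h2.
  have := Gd _ _ iG jG ij; apply/negP; rewrite -ltNge.
  rewrite (_ : i.2 - j.2 = (i.2 - x) - (j.2 - x)); last by ring.
  apply: (le_lt_trans (ler_normB _ _)).
  by have := rC i; have := rC j; lra.
Qed.

(* A form with the properties of (f, h) |-> \iint b(x1, x2) f(x1) h(x2) for a
   function b of little bmo norm at most N. *)
Definition bmo_form (g1 g2 : R) (B : (R -> R) -> (R -> R) -> R) (N : R) : Prop :=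
  [/\ forall h, dominated g2 h -> exists K, dominated_functional g1 (B^~ h) K,
    forall f, dominated g1 f -> exists K, dominated_functional g2 (B f) K &
    forall a b c d (f h : R -> R) (M M' : R), 0 <= a -> a < b -> 0 <= c -> c < d ->
      measurable_fun (Rplus R) f -> measurable_fun (Rplus R) h ->
      (forall x, 0 < x -> `|f x| <= M) -> (forall x, 0 < x -> `|h x| <= M') ->
      (forall x, 0 < x -> x <= a \/ b < x -> f x = 0) ->
      (forall x, 0 < x -> x <= c \/ d < x -> h x = 0) ->
      `|B f h - B (\1_(`]a, b]%classic)) (\1_(`]c, d]%classic)) /
         (vol `]a, b]%classic * vol `]c, d]%classic) * (Int f * Int h)| <=
      N * M * M' * (vol `]a, b]%classic * vol `]c, d]%classic)].

(** * Wavelet coefficients of a bilinear form *)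

Section form.
Variables (D1 D2 : dyadic_system R).
Variables (W1 : wavelet_basis lambda D1) (W2 : wavelet_basis lambda D2).
Variables (g1 g2 : R) (g1_gt0 : 0 < g1) (g2_gt0 : 0 < g2).
Local Notation cube1 := (wavelet_cube D1).
Local Notation cube2 := (wavelet_cube D2).

(** Take the indicator as first argument in the form bound and divide by its volume. The constant
    [N] does not depend on the interval, which makes the Carleson estimate in x2 uniform in x1. *)
Lemma bmo_form_slice B N a b : bmo_form g1 g2 B N -> 0 <= a -> a < b ->
  let L h := B (\1_(`]a, b]%classic)) h / vol `]a, b]%classic in
  (exists K, dominated_functional g2 L K) /\ bmo_functional L N.
Proof.
move=> [_ B2 B3] a0 ab L.
have v0 := vol_itv_gt0 lambda_gt0 a0 ab.
have [K BK] := B2 _ (dominated_itv lambda_gt0 g1_gt0 a b).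
split.
  exists (K / vol `]a, b]%classic); split.
    by move=> k f h df dh; rewrite /L (functional_lin BK)// mulrDl mulrA.
  move=> C f df fC; rewrite /L normrM normfV (gtr0_norm v0) mulrA.
  by apply: ler_wpM2r; [rewrite invr_ge0 ltW|exact: (functional_le BK)].
move=> c d f M c0 cd mf fM f0.
have w0 := vol_itv_gt0 lambda_gt0 c0 cd.
have h := B3 a b c d (\1_(`]a, b]%classic)) f 1 M a0 ab c0 cd _ mf _ fM _ f0.
have -> : L f - itv_mean L c d * Int f = (B (\1_(`]a, b]%classic)) f -
    B (\1_(`]a, b]%classic)) (\1_(`]c, d]%classic)) / (vol `]a, b]%classic * vol `]c, d]%classic) *
    (Int (\1_(`]a, b]%classic)) * Int f)) / vol `]a, b]%classic.
  by rewrite !itv_meanE /L (Int_itv lambda); field; rewrite !gt_eqF.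
rewrite normrM normfV (gtr0_norm v0) ler_pdivrMr//.
apply: le_trans (h _ _ _) _.
- exact: measurable_indic.
- by move=> x _; rewrite indicE; case: (_ \in _); rewrite ?normr1 ?normr0.
- move=> x _ xab; rewrite indicE memNset//= in_itv/= => /andP[h1 h2].
  by case: xab; lra.
- by rewrite le_eqVlt; apply/orP; left; apply/eqP; ring.
Qed.

Lemma sum_pairs_snd (I J : eqType) (S : seq (I * J)) (F : I -> J -> R) :
  \sum_(p <- S) F p.1 p.2 =
  \sum_(j <- undup [seq p.2 | p <- S]) \sum_(i <- [seq p.1 | p <- S & p.2 == j]) F i j.
Proof.
rewrite (sum_fibers (fun p : I * J => p.2)); apply: eq_bigr => j _.
by rewrite big_map big_filter; apply: eq_bigr => p /eqP ->.
Qed.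

(* Almost orthogonality in the first variable reduces the sum to an integral
   over x1 of square sums of B(1_A, psi_J) / vol A, with A the interval of the
   step function that contains x1; to these carleson_wavelets applies. *)
Lemma form_atoms : exists C : R, 0 < C /\
  forall B N r (S : seq ((int * R) * (int * R))) f, bmo_form g1 g2 B N -> 0 < N ->
  1 <= r -> uniq S ->
  (forall p, p \in S -> wavelet_index D1 p.1 /\ wavelet_index D2 p.2) ->
  (forall i, wavelet_index D1 i -> atom lambda D1 (eta W1) r i (f i)) ->
  \sum_(p <- S) (B (f p.1) (psi W2 p.2)) ^+ 2 <=
  C * (N ^+ 2 * fine (mu (incidence cube1 cube2 S))) * r ^+ (3 * hdim lambda).+1.
Proof.
have [C1 [C10 ao]] := almost_orthogonality lambda_gt0 D1 (eta_gt0 W1) (eta_le1 W1).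
have [C2 [C20 cw]] := carleson_wavelets W2.
have [C3 [C30 vu]] := vitali_union D1.
exists (C1 * C2 * C3); split; first by pos.
move=> B N r S f BB N0 r1 uS wS af.
have r0 : 0 < r by lra.
have sc1 i : 0 < scale D1 i := scale_gt0 D1 i.1.
have [c1 [c11 cb1]] := wavelet_cube_ball D1.
have [c2 [c21 cb2]] := wavelet_cube_ball D2.
pose bl (i : int * R) : set R := ball i.2 (r * scale D1 i).
pose X := 1 + \sum_(p <- S) (`|p.1.2| + r * scale D1 p.1 + c1 * scale D1 p.1 + `|p.2.2| + c2 * scale D2 p.2).
have nn p : 0 <= `|p.1.2| + r * scale D1 p.1 + c1 * scale D1 p.1 + `|p.2.2| + c2 * scale D2 p.2.
  by have := sc1 p.1; have := scale_gt0 D2 p.2.1 => ? ?; rewrite !addr_ge0//; pos.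
have X1 : 1 <= X by rewrite /X lerDl; apply: sumr_ge0.
have XS p : p \in S -> [/\ p.1.2 + r * scale D1 p.1 <= X, p.1.2 + c1 * scale D1 p.1 <= X &
    p.2.2 + c2 * scale D2 p.2 <= X].
  move=> pS; have : `|p.1.2| + r * scale D1 p.1 + c1 * scale D1 p.1 + `|p.2.2| + c2 * scale D2 p.2 <= X.
    rewrite /X (big_rem p)//= addrCA lerDl addr_ge0//; apply: sumr_ge0 => *; exact: nn.
  have t1 : 0 < r * scale D1 p.1 by apply: mulr_gt0.
  have t2 : 0 < c1 * scale D1 p.1 by apply: mulr_gt0 => //; lra.
  have t3 : 0 < c2 * scale D2 p.2 by apply: mulr_gt0; [lra|exact: scale_gt0].
  move: t1 t2 t3 (ler_norm p.1.2) (ler_norm p.2.2) (normr_ge0 p.1.2) (normr_ge0 p.2.2).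
  by clear; move: `|_| `|_| (r * _) (c1 * _) (c2 * _) => *; split; lra.
have X0 : 0 < X by lra.
pose Q1 := incidence bl cube2 S; pose Q0 := incidence cube1 cube2 S.
have mbl p : p \in S -> measurable (bl p.1) by move=> _; exact: mball.
have mc1 p : p \in S -> measurable (cube1 p.1).
  by move=> /wS[[w _] _]; exact: (cube_measurable w).
have mc2 p : p \in S -> measurable (cube2 p.2).
  by move=> /wS[_ [w _]]; exact: (cube_measurable w).
have blX p x : p \in S -> bl p.1 x -> x <= X.
  by move=> pS /ball_le h; have [h1 _ _] := XS _ pS; apply: le_trans h1.
have c1X p x : p \in S -> cube1 p.1 x -> x <= X.
  move=> pS hc; have [_ h1 _] := XS _ pS; apply: le_trans h1.
  by have [w _] := wS _ pS; exact: ball_le (cb1 _ w _ hc).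
have c2X p x : p \in S -> cube2 p.2 x -> x <= X.
  move=> pS hc; have [_ _ h1] := XS _ pS; apply: le_trans h1.
  by have [_ w] := wS _ pS; exact: ball_le (cb2 _ w _ hc).
have mxs x : measurable (xsection Q1 x) by apply: measurable_xsection_incidence.
have xsX x y : xsection Q1 x y -> y <= X.
  by rewrite xsection_incidence => -[p pS [_ h]]; exact: c2X h.
have xs0 x : X < x -> xsection Q1 x = set0.
  move=> Xx; apply/seteqP; split => // y; rewrite xsection_incidence => -[p pS [h _]].
  by have := blX _ _ pS h; rewrite leNgt Xx.
have mys0 y : measurable (ysection Q0 y) by apply: measurable_ysection_incidence.
have mys1 y : measurable (ysection Q1 y) by apply: measurable_ysection_incidence.
have fin0 : (mu Q0 < +oo)%E by exact: (@mu_incidence_lty _ _ _ _ _ X).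
(* The x1 sides grow from cubes to supports of atoms; at fixed x2 this compares two unions in one
   variable. *)
have swap : fine (mu Q1) <= C3 * r ^+ hdim lambda * fine (mu Q0).
  have fin0' := fin0; rewrite (mu_incidence_swap mc1 mc2) in fin0'.
  rewrite (mu_incidence_swap mbl mc2) (mu_incidence_swap mc1 mc2).
  apply: fine_integral_le => //; first by pos.
  - exact: measurable_fun_ysection (measurable_incidence mbl mc2).
  - exact: measurable_fun_ysection (measurable_incidence mc1 mc2).
  move=> y.
  have ysX0 x : ysection Q0 y x -> x <= X.
    by rewrite ysection_incidence => -[p pS [h _]]; exact: c1X h.
  have ysX1 x : ysection Q1 y x -> x <= X.
    by rewrite ysection_incidence => -[p pS [h _]]; exact: blX h.
  rewrite -(volE lambda_gt0 (mys0 y) ysX0) -(volE lambda_gt0 (mys1 y) ysX1) -EFinM lee_fin.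
  apply: (vu r [seq p.1 | p <- S & `[< cube2 p.2 y >]] _ _ X) => //.
  - by move=> i /mapP[p]; rewrite mem_filter => /andP[_ /wS[w _]] ->.
  - move=> x; rewrite ysection_incidence => -[p pS [h1 h2]].
    exists p.1 => //; apply/mapP; exists p => //.
    by rewrite mem_filter pS andbT; apply/asboolP.
  - move=> i /mapP[p]; rewrite mem_filter => /andP[/asboolP h pS] -> x hx.
    by rewrite ysection_incidence; exists p.
pose v x := vol (xsection Q1 x).
have [dv IvE] : dominated 1 v /\ Int v = fine (mu Q1).
  exact: (Int_xsection_incidence mbl mc2 blX c2X ltr01 X0).
pose js := undup [seq p.2 | p <- S].
pose SJ j := [seq p.1 | p <- S & p.2 == j].
have SJP i j : i \in SJ j -> (i, j) \in S.
  by move=> /mapP[[i' j']]; rewrite mem_filter /= => /andP[/eqP -> pS] ->.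
have uSJ j : uniq (SJ j).
  rewrite map_inj_in_uniq ?filter_uniq// => -[i1 j1] [i2 j2].
  by rewrite !mem_filter /= => /andP[/eqP -> _] /andP[/eqP -> _] ->.
pose E j := [set x | exists2 i, i \in SJ j & bl i x].
have mE j : measurable (E j).
  rewrite (_ : E j = \big[setU/set0]_(i <- SJ j) bl i).
    by apply: bigsetU_measurable => i _; exact: mball.
  by rewrite -bigcup_seq; apply/seteqP; split => x [i si hx]; exists i.
pose Lf j := B^~ (psi W2 j).
have [B1 B2 B3] := BB.
have LK j : j \in js -> exists K, dominated_functional g1 (Lf j) K.
  rewrite mem_undup => /mapP[p pS ->]; apply: B1.
  by have [_ w] := wS _ pS; exact: dominated_psi.
pose st n j := step n 0 X (itv_mean (Lf j)).
have sum_st n : \sum_(p <- S) (Int (fun x => st n p.2 x * f p.1 x)) ^+ 2 <=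
    C1 * C2 * C3 * (N ^+ 2 * fine (mu Q0)) * r ^+ (3 * hdim lambda).+1.
  rewrite (sum_pairs_snd S (fun i j => (Int (fun x => st n j x * f i x)) ^+ 2)).
  rewrite -/js.
  (* Restricting to the union of the supports that belong to [j] does not change the pairings with
     these atoms, and it keeps [j] at a point x only if the cube of [j] lies in the section of [Q1]
     at x. *)
  pose h j x := \1_(E j) x * st n j x.
  have mh j : measurable_fun (Rplus R) (h j).
    by apply: measurable_funM; [exact: measurable_indic|exact: (measurable_step lambda_gt0 ltr01)].
  have stM j : exists M, forall x, 0 < x -> `|st n j x| <= M.
    exact: step_bounded.
  have hM j : exists M, forall x, 0 < x -> `|h j x| <= M.
    have [M sM] := stM j; exists M => x x0; rewrite normrM -[leRHS]mul1r.
    apply: ler_pM => //; last exact: sM.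
    by rewrite indicE; case: (_ \in _); rewrite ?normr1 ?normr0.
  have hX j x : X < x -> h j x = 0.
    by move=> Xx; rewrite /h /st step_out ?mulr0//; [exact: ltW|right].
  have dh j : dominated 1 (h j).
    by have [M sM] := hM j; exact: (dominated_bounded lambda_gt0 ltr01 X0 (mh j) sM (@hX j)).
  have dh2 j : dominated 1 (fun x => h j x ^+ 2).
    have [M sM] := hM j.
    rewrite (_ : (fun x => h j x ^+ 2) = (fun x => h j x * h j x)).
      exact: (dominatedM (dh j) (mh j) sM).
    by apply/funext => x; rewrite expr2.
  have IF := Int_functional lambda_gt0 (@ltr01 R).
  apply: (@le_trans _ _ (\sum_(j <- js) C1 * r ^+ (2 * hdim lambda).+1 * Int (fun x => h j x ^+ 2))).
    rewrite big_seq [leRHS]big_seq; apply: ler_sum => j jS.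
    have [M sM] := hM j.
    apply: le_trans (ao r (SJ j) f (h j) M X r1 X0 (uSJ j) _ (mh j) sM (@hX j)); last first.
      by move=> i /SJP/wS[w _]; split => //; exact: af.
    rewrite le_eqVlt; apply/orP; left; apply/eqP; rewrite big_seq [RHS]big_seq.
    apply: eq_bigr => i iS; congr (_ ^+ 2).
    have [wi _] := wS _ (SJP _ _ iS); have [mf _ fb fs _] := af _ wi.
    apply: (functional_ext IF).
    - by apply: (dominatedM _ mf fb); exact: (dominated_step lambda_gt0 ltr01).
    - exact: (dominatedM (dh j) mf fb).
    - move=> x x0; rewrite /h indicE; case: (boolP (x \in E j)) => xE; first by rewrite mul1r.
      rewrite fs ?mulr0// leNgt; apply: contra xE => hx; rewrite inE; exists i => //.
      by rewrite /bl /ball /= distrC.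
  rewrite -mulr_sumr -(functional_sum IF)//.
  apply: (@le_trans _ _ (C1 * r ^+ (2 * hdim lambda).+1 * (C2 * N ^+ 2 * Int v))); last first.
    rewrite IvE.
    have -> : C1 * C2 * C3 * (N ^+ 2 * fine (mu Q0)) * r ^+ (3 * hdim lambda).+1 =
       C1 * r ^+ (2 * hdim lambda).+1 * (C2 * N ^+ 2 * (C3 * r ^+ hdim lambda * fine (mu Q0))).
      have -> : r ^+ (3 * hdim lambda).+1 = r ^+ (2 * hdim lambda).+1 * r ^+ hdim lambda.
        by rewrite -exprD addSn -mulSnr.
      ring.
    by apply: ler_wpM2l; [pos|apply: ler_wpM2l; [pos|exact: swap]].
  apply: ler_wpM2l; first by pos.
  rewrite -(functionalZ IF)//; apply: (le_Int lambda_gt0 ltr01); [exact: dominated_sum|exact: dominatedZ|].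
  move=> x x0; have [xX|Xx] := leP x X; last first.
    rewrite big1; first by have := vol_ge0 lambda (xsection Q1 x); rewrite -/(v x) => ?; pos.
    by move=> j _; rewrite hX// expr0n.
  (* The leaf at x is the same for all [j], so the values at x are the wavelet coefficients of one
     functional [Lu] with constant [N]. *)
  have [u [w [[u0 _ ux xw _] [_ leafE]]]] := step_leaf n (lexx 0) x0 xX.
  have uw : u < w by exact: lt_le_trans ux xw.
  have [[Ku LKu] LN] := bmo_form_slice BB u0 uw.
  set Lu := (fun _ => _) in LKu LN.
  rewrite (eq_bigr (fun j => \1_(E j) x * (Lu (psi W2 j)) ^+ 2)); last first.
    move=> j _; rewrite /h /st leafE exprMn; congr (_ * _).
    by rewrite indicE; case: (_ \in _); rewrite ?expr1n ?expr0n.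
  have -> : \sum_(j <- js) \1_(E j) x * (Lu (psi W2 j)) ^+ 2 =
      \sum_(j <- [seq j <- js | x \in E j]) (Lu (psi W2 j)) ^+ 2.
    rewrite big_filter [RHS]big_mkcond; apply: eq_bigr => j _; rewrite indicE.
    by case: (_ \in _); rewrite ?mul1r ?mul0r.
  rewrite /v -mulrA; apply: (cw g2 Lu Ku N _ _ X g2_gt0 LKu LN N0) => //.
  - by rewrite filter_uniq// undup_uniq.
  - by move=> j; rewrite mem_filter mem_undup => /andP[_ /mapP[p pS ->]]; case: (wS _ pS).
  - exact: xsX.
  - move=> j; rewrite mem_filter => /andP[/set_mem[i /SJP ijS bx] _] y hy.
    by rewrite xsection_incidence; exists (i, j).
pose f' p := if p \in S then B (f p.1) (psi W2 p.2) else 0.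
pose u' p n := if p \in S then Int (fun x => st n p.2 x * f p.1 x) else 0.
rewrite big_seq (eq_bigr (fun p => f' p ^+ 2)) -?big_seq; last by move=> p pS; rewrite /f' pS.
apply: (@cvg_sum_sqr _ _ S u'); last first.
  move=> n; apply: le_trans (sum_st n); rewrite big_seq [leRHS]big_seq le_eqVlt; apply/orP; left.
  by apply/eqP; apply: eq_bigr => p pS; rewrite /u' pS.
move=> p; rewrite /u' /f'; case: ifP => pS; last exact: cvg_cst.
have [wi wj] := wS _ pS; have [mf _ fb fs _] := af _ wi.
have [|K LK'] := LK p.2; first by rewrite mem_undup map_f.
apply: (step_cvg lambda_gt0 g1_gt0 LK' mf fb (lexx 0) X0).
- move=> x x0 [h|Xx]; first by move: (lt_le_trans x0 h); rewrite ltxx.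
  apply: (fs x x0); have [h1 _ _] := XS _ pS; apply: le_trans (ler_norm _).
  by rewrite lerBrDl; exact: le_trans h1 (ltW Xx).
- exact: (atom_uniformly_continuous lambda_gt0 (eta_gt0 W1) wi (af _ wi)).
Qed.

(** Only the x1 wavelet still has to be split into atoms, because [form_atoms] already has the full
    wavelet in x2. *)
Theorem form_wavelets : exists C : R, 0 < C /\
  forall B N (S : seq ((int * R) * (int * R))), bmo_form g1 g2 B N -> 0 < N -> uniq S ->
  (forall p, p \in S -> wavelet_index D1 p.1 /\ wavelet_index D2 p.2) ->
  \sum_(p <- S) (B (psi W1 p.1) (psi W2 p.2)) ^+ 2 <=
  C * (N ^+ 2 * fine (mu (incidence cube1 cube2 S))).
Proof.
have [C1 [C10 fa]] := form_atoms.
have [C2 [C20 ws]] := wavelet_square_sum lambda_gt0 W1 (3 * hdim lambda).+1.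
exists (C2 * C1); split; first by pos.
move=> B N S BB N0 uS wS; rewrite -mulrA.
have [B1 _ _] := BB.
have F0 : 0 <= fine (mu (incidence cube1 cube2 S)) by apply: fine_ge0.
apply: (ws _ S (fun p => p.1) (fun p f => B f (psi W2 p.2)) g1 _ g1_gt0).
- by pos.
- move=> p pS; have [w1 w2] := wS _ pS; split => //.
  by apply: B1; exact: dominated_psi.
- by move=> r f r1 af; exact: (fa B N r S f BB N0 r1 uS wS af).
Qed.

End form.
End product_carleson.

(** * Pairing with a function of little bmo *)

Section little_bmo_form.
Context {R : realType}.
Variables (lambda : R) (lambda_gt0 : 0 < lambda).
Local Notation m := (bessel_measure lambda).
Local Notation mu := (bessel_measure2 lambda).
Local Notation vol := (vol lambda).
Local Notation Int := (Int lambda).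
Local Notation wt := (wt lambda).
Local Notation dominated := (dominated lambda).
Local Notation dominated_functional := (dominated_functional lambda).
Local Notation itvoc a b := (`]a, b]%classic : set R).

Lemma measurable_quadrant : measurable (quadrant R).
Proof. by apply: measurableX; exact: measurable_Rplus. Qed.

Lemma measurable_tensor (f h : R -> R) :
  measurable_fun (Rplus R) f -> measurable_fun (Rplus R) h ->
  measurable_fun (quadrant R) (fun z => f z.1 * h z.2).
Proof.
move=> mf mh; apply: measurable_funM.
- apply: (measurable_comp measurable_Rplus _ mf); last exact: measurable_funTS measurable_fst.
  by move=> _ [z [z1 z2] <-].
- apply: (measurable_comp measurable_Rplus _ mh); last exact: measurable_funTS measurable_snd.
  by move=> _ [z [z1 z2] <-].
Qed.

Lemma notin_itvoc (u v x : R) : x \notin itvoc u v -> x <= u \/ v < x.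
Proof.
move=> /negP xI; case: (leP x u) => [|ux]; first by left.
by right; rewrite ltNge; apply/negP => xv; apply: xI; rewrite inE /= in_itv/= ux.
Qed.

Lemma mu_setX (A B : set R) (X : R) : measurable A -> measurable B ->
  (forall x, A x -> x <= X) -> (forall x, B x -> x <= X) ->
  mu (A `*` B) = (vol A * vol B)%:E.
Proof.
move=> mA mB AX BX; rewrite EFinM (volE lambda_gt0 mA AX) (volE lambda_gt0 mB BX).
exact: (product_measure1E m m mA mB).
Qed.

Section tensor.
Variables (g1 g2 : R) (g1_gt0 : 0 < g1) (g2_gt0 : 0 < g2).

Let dominated_restrict (g : R) (u : R -> R) : 0 < g -> dominated g u ->
  m.-integrable setT (EFin \o (u \_ (Rplus R))) /\
  (\int[m]_x ((u \_ (Rplus R)) x)%:E = (Int u)%:E)%E.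
Proof.
move=> g0 du; have pE : EFin \o (u \_ (Rplus R)) = (EFin \o u) \_ (Rplus R).
  by apply/funext => x; rewrite /= /patch; case: ifP.
split.
  rewrite pE; apply/(integrable_mkcond _ measurable_Rplus); exact: (dominated_integrable lambda_gt0 g0).
rewrite (Int_EFin lambda_gt0 g0 du) [RHS]integral_mkcond; apply: eq_integral => x _.
by rewrite -[LHS]/((EFin \o (u \_ (Rplus R))) x) pE.
Qed.

Lemma dominated_norm (g : R) (u : R -> R) : dominated g u -> dominated g (fun x => `|u x|).
Proof.
move=> [mu' [C Cu]]; split; first exact: measurableT_comp.
by exists C => x x0; rewrite normr_id; exact: Cu.
Qed.

Lemma Int_tensor (f h : R -> R) : dominated g1 f -> dominated g2 h ->
  mu.-integrable (quadrant R) (fun z => (f z.1 * h z.2)%:E) /\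
  \int[mu]_(z in quadrant R) (f z.1 * h z.2) = Int f * Int h.
Proof.
move=> df dh.
have [if_ If] := dominated_restrict g1_gt0 df.
have [ih Ih] := dominated_restrict g2_gt0 dh.
have [iaf Iaf] := dominated_restrict g1_gt0 (dominated_norm df).
have [iah Iah] := dominated_restrict g2_gt0 (dominated_norm dh).
pose F (z : R * R) := ((f \_ (Rplus R)) z.1 * (h \_ (Rplus R)) z.2)%:E.
have FE : (fun z => (f z.1 * h z.2)%:E) \_ (quadrant R) = F.
  apply/funext => -[x y]; rewrite /F /patch /quadrant /= in_setX /=.
  by case: (x \in _); case: (y \in _); rewrite ?mul0r ?mulr0.
have nE (u : R -> R) x : `|(u \_ (Rplus R)) x| = ((fun x => `|u x|) \_ (Rplus R)) x.
  by rewrite /patch; case: ifP => // _; rewrite normr0.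
have mF : measurable_fun setT F.
  apply/measurable_EFinP/measurable_funM.
    by apply: measurableT_comp measurable_fst; apply/measurable_EFinP; case/integrableP: if_.
  by apply: measurableT_comp measurable_snd; apply/measurable_EFinP; case/integrableP: ih.
have iF : (m \x m)%E.-integrable setT F.
  apply/integrable12ltyP => //.
  rewrite (eq_integral (fun x => (Int (fun y => `|h y|))%:E * (((fun x => `|f x|) \_ (Rplus R)) x)%:E)%E).
    by rewrite integralZl// Iaf -EFinM ltry.
  move=> x _; rewrite (eq_integral (fun y => (`|(f \_ (Rplus R)) x|)%:E * (((fun x => `|h x|) \_ (Rplus R)) y)%:E)%E).
    by rewrite integralZl// Iah -nE muleC.
  by move=> y _; rewrite /F /= normrM !nE.
split.
  by apply/(integrable_mkcond _ measurable_quadrant); rewrite FE.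
rewrite /Rintegral integral_mkcond FE.
have <- := integral12_prod_meas1 iF.
rewrite (eq_integral (fun x => (Int h)%:E * ((f \_ (Rplus R)) x)%:E)%E).
  by rewrite integralZl// If -EFinM /= mulrC.
move=> x _; rewrite -Ih muleC -integralZl//.
Qed.

End tensor.

Definition rect (a b c d : R) : set (R * R) := `]a, b]%classic `*` `]c, d]%classic.

Lemma measurable_rect a b c d : measurable (rect a b c d).
Proof. by apply: measurableX. Qed.

Lemma mu_rect a b c d : mu (rect a b c d) = (vol (itvoc a b) * vol (itvoc c d))%:E.
Proof.
apply: (@mu_setX _ _ (Num.max b d)) => // x /=; rewrite in_itv/= => /andP[_];
  rewrite le_max => ->//; exact: orbT.
Qed.

Lemma integral_rect_cst a b c d (k : R) : (\int[mu]_(z in rect a b c d) k%:E =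
  (k * (vol (itvoc a b) * vol (itvoc c d)))%:E)%E.
Proof. rewrite EFinM -mu_rect; exact: (@integral_cst _ _ _ mu _ (measurable_rect a b c d)). Qed.

Lemma integrable_rect_cst a b c d (k : R) :
  mu.-integrable (rect a b c d) (EFin \o cst k).
Proof.
apply/integrableP; split; first exact/measurable_EFinP/measurable_cst.
by have := integral_rect_cst a b c d `|k|; rewrite /= => ->; exact: ltry.
Qed.

Lemma rect_quadrant a b c d : 0 <= a -> 0 <= c -> rect a b c d `<=` quadrant R.
Proof.
move=> a0 c0 [x y] [/=]; rewrite !in_itv/= => /andP[ax _] /andP[cy _].
by split => /=; [exact: le_lt_trans ax|exact: le_lt_trans cy].
Qed.

Lemma bounded_itvoc (a b : R) : bounded_set (itvoc a b).
Proof.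
exists (`|a| + `|b|); split; first exact: num_real.
move=> M hM x /=; rewrite in_itv/= => /andP[ax xb]; apply: le_trans (ltW hM).
have := ler_norm a; have := ler_norm b; have := ler_norm (- a); have := ler_norm (- b).
by rewrite !normrN => *; rewrite ler_norml; lra.
Qed.

Lemma rectangles_rect a b c d : 0 <= a -> a < b -> 0 <= c -> c < d ->
  rectangles lambda (rect a b c d).
Proof.
move=> a0 ab c0 cd; exists (`]a, b]%classic), (`]c, d]%classic); split => //.
- by split; exact: interval_is_interval.
- by split; exact: bounded_itvoc.
- split => x /=; rewrite in_itv/= => /andP[h _]; [exact: le_lt_trans h|exact: le_lt_trans h].
- by rewrite mu_rect lte_fin mulr_gt0// vol_itv_gt0.
Qed.

Section bmo.
Variables (b : R * R -> R) (bmo_b : bmo lambda b).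

Lemma measurable_bmo (A : set (R * R)) : measurable A -> A `<=` quadrant R -> measurable_fun A b.
Proof.
move=> mA AQ; apply: measurable_funS (measurable_quadrant) AQ _.
by case: bmo_b => -[].
Qed.

(** A rectangle that touches the axes lies in no compact subset of the quadrant, so integrability of
    [b] on it has to come from finite oscillation: [b] differs from the number [mean] by an
    integrable function, whatever that number is. *)
Lemma bmo_rect : exists N : R, 0 < N /\ forall a1 b1 a2 b2 : R,
  0 <= a1 -> a1 < b1 -> 0 <= a2 -> a2 < b2 ->
  mu.-integrable (rect a1 b1 a2 b2) (EFin \o b) /\
  \int[mu]_(z in rect a1 b1 a2 b2) `|b z - mean lambda b (rect a1 b1 a2 b2)| <=
    N * (vol (itvoc a1 b1) * vol (itvoc a2 b2)).
Proof.
have [N [N0 bN]] : exists N : R, 0 < N /\ (bmo_norm lambda b <= N%:E)%E.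
  case: bmo_b => _; case: (bmo_norm lambda b) => [r _| |_] //.
    by exists (Num.max 1 r); rewrite lt_max ltr01 lee_fin le_max lexx orbT.
  by exists 1; rewrite leNye.
exists N; split => // a1 b1 a2 b2 a10 ab1 a20 ab2.
set Q := rect _ _ _ _.
have mQ : measurable Q by exact: measurable_rect.
have QQ : Q `<=` quadrant R by exact: rect_quadrant.
have mb := measurable_bmo mQ QQ.
set V := vol _ * vol _.
have V0 : 0 < V by rewrite mulr_gt0// vol_itv_gt0.
have muQ : mu Q = V%:E by exact: mu_rect.
have iN : (\int[mu]_(z in Q) `|b z - mean lambda b Q|%:E <= (N * V)%:E)%E.
  have : ((fine (mu Q))^-1%:E * \int[mu]_(z in Q) `|b z - mean lambda b Q|%:E <= N%:E)%E.
    apply: le_trans bN; apply: ereal_sup_ubound; exists Q => //.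
    exact: rectangles_rect.
  by rewrite muQ /= lee_pdivrMl// -EFinM mulrC.
have mbc : measurable_fun Q (fun z => b z - mean lambda b Q) by apply: measurable_funB.
have ibc : mu.-integrable Q (fun z => (b z - mean lambda b Q)%:E).
  apply/integrableP; split; first exact/measurable_EFinP.
  by apply: le_lt_trans (ltry (N * V)); apply: le_trans iN.
split.
  have ic : mu.-integrable Q (EFin \o cst (mean lambda b Q)) by exact: integrable_rect_cst.
  have := integrableD mQ ibc ic.
  by apply: eq_integrable => // z _ /=; rewrite -EFinD subrK.
rewrite -lee_fin; apply: le_trans iN; rewrite /Rintegral fineK//.
apply: integrable_fin_num => //.
exact: (integrable_norm ibc).
Qed.

Lemma mean_rect a1 b1 a2 b2 : mean lambda b (rect a1 b1 a2 b2) =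
  (vol (itvoc a1 b1) * vol (itvoc a2 b2))^-1 * \int[mu]_(z in rect a1 b1 a2 b2) b z.
Proof. by rewrite /mean mu_rect. Qed.

Lemma Rintegral_rect_cst a1 b1 a2 b2 (c : R) :
  \int[mu]_(z in rect a1 b1 a2 b2) c = c * (vol (itvoc a1 b1) * vol (itvoc a2 b2)).
Proof.
by rewrite /Rintegral integral_rect_cst.
Qed.

(** * Growth of the means over rectangles at the origin *)

Section growth.
Variables (N : R).
Hypothesis N_gt0 : 0 < N.
Hypothesis bN : forall a1 b1 a2 b2 : R,
  0 <= a1 -> a1 < b1 -> 0 <= a2 -> a2 < b2 ->
  mu.-integrable (rect a1 b1 a2 b2) (EFin \o b) /\
  \int[mu]_(z in rect a1 b1 a2 b2) `|b z - mean lambda b (rect a1 b1 a2 b2)| <=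
    N * (vol (itvoc a1 b1) * vol (itvoc a2 b2)).

Lemma integrable_oscillation (a1 b1 a2 b2 c : R) : 0 <= a1 -> a1 < b1 -> 0 <= a2 -> a2 < b2 ->
  mu.-integrable (rect a1 b1 a2 b2) (EFin \o (fun z => b z - c)).
Proof.
move=> a10 ab1 a20 ab2; have [ib _] := bN a10 ab1 a20 ab2.
have := integrableB (measurable_rect a1 b1 a2 b2) ib (integrable_rect_cst a1 b1 a2 b2 c).
by apply: eq_integrable => //; exact: measurable_rect.
Qed.

(** The oscillation integral over the larger rectangle dominates the one over the smaller; only the
    normalization changes, hence the ratio of volumes. *)
Lemma mean_diff (b1 b2 b1' b2' : R) : 0 < b1 -> 0 < b2 -> b1 <= b1' -> b2 <= b2' ->
  `|mean lambda b (rect 0 b1 0 b2) - mean lambda b (rect 0 b1' 0 b2')| <=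
  N * ((vol (itvoc 0 b1') * vol (itvoc 0 b2')) / (vol (itvoc 0 b1) * vol (itvoc 0 b2))).
Proof.
move=> b10 b20 bb1 bb2; have b10' := lt_le_trans b10 bb1; have b20' := lt_le_trans b20 bb2.
have [ib _] := bN (lexx 0) b10 (lexx 0) b20.
have [_ bN'] := bN (lexx 0) b10' (lexx 0) b20'.
set V := vol (itvoc 0 b1) * _; set V' := vol (itvoc 0 b1') * _ in bN' *.
have V0 : 0 < V by rewrite mulr_gt0// vol_itv_gt0.
set c := mean lambda b (rect 0 b1' 0 b2') in bN' *.
have mQ := measurable_rect 0 b1 0 b2.
have -> : mean lambda b (rect 0 b1 0 b2) - c = V^-1 * \int[mu]_(z in rect 0 b1 0 b2) (b z - c).
  rewrite RintegralB//; last exact: integrable_rect_cst.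
  by rewrite Rintegral_rect_cst mean_rect -/V; field; exact: lt0r_neq0.
rewrite normrM gtr0_norm ?invr_gt0// [leRHS]mulrA [leRHS]mulrC ler_pM2l ?invr_gt0//.
apply: le_trans bN'.
apply: le_trans (le_normr_Rintegral mQ (integrable_oscillation _ _ _ _ _)) _ => //.
rewrite /Rintegral fine_le//.
- apply: integrable_fin_num => //; exact: (integrable_norm (integrable_oscillation _ _ _ _ _)).
- apply: integrable_fin_num; first exact: measurable_rect.
  exact: (integrable_norm (integrable_oscillation _ _ _ _ _)).
apply: ge0_subset_integral => //.
- exact: measurable_rect.
- by apply/measurable_EFinP/(measurableT_comp (@normr_measurable _ _))/measurable_funB => //;
    apply: measurable_bmo; [exact: measurable_rect|exact: rect_quadrant].
- move=> [x y] [/=]; rewrite !in_itv/= => /andP[x0 xb] /andP[y0 yb].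
  by rewrite /rect /= !in_itv/= x0 y0 (le_trans xb)// (le_trans yb).
Qed.

(** One side is doubled at a time, so that each step has volume ratio at most [kap] and moves the
    mean by at most [N * kap]. *)
Lemma dyadic_mean_growth : exists A : R, 0 < A /\ forall j k : nat,
  (\int[mu]_(z in rect 0 (2 ^+ j) 0 (2 ^+ k)) `|b z|%:E <=
   (A * (j + k).+1%:R * (vol (itvoc 0 (2 ^+ j)) * vol (itvoc 0 (2 ^+ k))))%:E)%E.
Proof.
have [kap [kap1 vb]] := vol_bisect lambda_gt0.
have p2 n : 0 < (2 : R) ^+ n by exact: exprn_gt0.
pose c0 := `|mean lambda b (rect 0 (2 ^+ 0) 0 (2 ^+ 0))|.
have dbl n : vol (itvoc 0 (2 ^+ n.+1)) <= kap * vol (itvoc 0 (2 ^+ n)).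
  have [+ _] := vb 0 (2 ^+ n.+1) (lexx 0) (p2 _).
  by rewrite add0r exprS mulrAC divff// mul1r.
have V0 n : 0 < vol (itvoc 0 (2 ^+ n)) by rewrite vol_itv_gt0.
have le2 n : (2 : R) ^+ n <= 2 ^+ n.+1 by rewrite ler_eXn2l// ltr1n.
have stepA (x y p q : R) : `|x| <= p -> `|x - y| <= q -> `|y| <= p + q.
  by move=> h1 h2; rewrite -[y](subKr x); apply: le_trans (ler_normB _ _) _; exact: lerD.
have grow j k : `|mean lambda b (rect 0 (2 ^+ j) 0 (2 ^+ k))| <= c0 + kap * N * (j + k)%:R.
  elim: j => [|j IH].
    elim: k => [|k IH]; first by rewrite mulr0 addr0.
    have h : `|mean lambda b (rect 0 (2 ^+ 0) 0 (2 ^+ k)) -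
               mean lambda b (rect 0 (2 ^+ 0) 0 (2 ^+ k.+1))| <= N * kap.
      apply: le_trans (mean_diff _ _ _ _) _ => //; rewrite ler_pM2l//.
      by rewrite ler_pdivrMr ?mulr_gt0// mulrCA ler_pM2l.
    by apply: le_trans (stepA _ _ _ _ IH h) _; rewrite !add0n -natr1; lra.
  have h : `|mean lambda b (rect 0 (2 ^+ j) 0 (2 ^+ k)) -
               mean lambda b (rect 0 (2 ^+ j.+1) 0 (2 ^+ k))| <= N * kap.
    apply: le_trans (mean_diff _ _ _ _) _ => //; rewrite ler_pM2l//.
    by rewrite ler_pdivrMr ?mulr_gt0// mulrA ler_pM2r.
  by apply: le_trans (stepA _ _ _ _ IH h) _; rewrite addSn -natr1; lra.
have N0 := N_gt0.
have c00 : 0 <= c0 by exact: normr_ge0.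
have kN : 0 < kap * N by rewrite mulr_gt0//; exact: lt_le_trans kap1.
exists (c0 + kap * N + N); split; first by lra.
move=> j k; have [ib bN'] := bN (lexx 0) (p2 j) (lexx 0) (p2 k).
set V := vol _ * vol _ in bN' *; set Q := rect _ _ _ _ in ib bN' *.
have mQ : measurable Q by exact: measurable_rect.
have V0' : 0 < V by rewrite mulr_gt0.
have iN : mu.-integrable Q (EFin \o (fun z => `|b z|)) by exact: (integrable_norm ib).
have iO : mu.-integrable Q (EFin \o (fun z => `|b z - mean lambda b Q|)).
  exact: (integrable_norm (integrable_oscillation _ _ _ _ _)).
rewrite -[leLHS]fineK; last exact: (integrable_fin_num mQ iN).
rewrite lee_fin -/(Rintegral mu Q (fun z => `|b z|)).
apply: (@le_trans _ _ (\int[mu]_(z in Q) (`|b z - mean lambda b Q| + `|mean lambda b Q|))).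
  apply: le_Rintegral => //.
    have := integrableD mQ iO (integrable_rect_cst 0 (2 ^+ j) 0 (2 ^+ k) `|mean lambda b Q|).
    by apply: eq_integrable.
  by move=> z _; rewrite -[X in `|X| <= _](subrK (mean lambda b Q)) ler_normD.
rewrite RintegralD//; last exact: integrable_rect_cst.
rewrite Rintegral_rect_cst -/V.
have := grow j k; rewrite -/Q => g.
apply: (@le_trans _ _ ((N + (c0 + kap * N * (j + k)%:R)) * V)).
  by rewrite mulrDl lerD// ler_pM2r.
rewrite ler_pM2r// -natr1.
have n0 : 0 <= (j + k)%:R :> R by [].
have : 0 <= c0 * (j + k)%:R by rewrite mulr_ge0.
have : 0 <= N * (j + k)%:R by rewrite mulr_ge0// ltW.
lra.
Qed.

End growth.

(** Boxes with sides 2^j and 2^(n - j) are grouped by [n], which leaves one series. On each box of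
    group [n] volume times weight is at most a multiple of 2^(-g n), against n + 1 boxes and means
    of |b| of order n + 1. *)
Lemma weighted_bmo (g : R) : 0 < g ->
  (\int[mu]_(z in quadrant R) (`|b z| * (wt g z.1 * wt g z.2))%:E < +oo)%E.
Proof.
move=> g0; have [N [N0 bN]] := bmo_rect; have [A [A0 bA]] := dyadic_mean_growth N0 bN.
have [k [k0 wk]] := wt_dyadic lambda_gt0 g0.
set rho := 2 `^ _ in wk.
have rho0 : 0 < rho by rewrite /rho; pos.
(* A third of the decay for each of three tasks: the growth of the means, the number of boxes in a
   group, and the summation over the groups. *)
pose t : R := 2 `^ (- (g / 3)).
have t01 : 0 < t < 1.
  rewrite powR_gt0//= /t powRN invf_lt1 ?powR_gt0//.
  have p1 : (1 : R) `^ (g / 3) = 1 by rewrite powR1.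
  by rewrite -[X in X < _]p1; apply: gt0_ltr_powR; rewrite ?nnegrE; lra.
have [t0 t1] := andP t01.
set T := (1 - t)^-1; have T0 : 0 < T by rewrite invr_gt0; lra.
have rhoV j : rho ^+ j * vol (itvoc 0 (2 ^+ j)) <= (t ^+ 3) ^+ j.
  have h2 : 0 <= (2 : R) by [].
  apply: (@le_trans _ _ (rho ^+ j * (2 ^+ j) `^ (2 * lambda + 1))).
    rewrite ler_pM2l ?exprn_gt0// -lee_fin (@volE _ _ lambda_gt0 _ (2 ^+ j))//.
      by apply: bessel_measure_itv0_le => //; exact: exprn_gt0.
    by move=> x /=; rewrite in_itv/= => /andP[].
  rewrite /rho /t -(powR_mulrn j (powR_ge0 2 _)) -(powR_mulrn j h2) -exprM -(powR_mulrn _ (powR_ge0 2 _)).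
  rewrite -!powRrM -powRDp// natrM; apply: ler_powR; first by lra.
  by rewrite le_eqVlt; apply/orP; left; apply/eqP; field.
have nt n : n.+1%:R * t ^+ n <= T.
  have h : 0 <= t < 1 by rewrite ltW.
  apply: le_trans (geometric_sum_le n.+1 h).
  have -> : n.+1%:R * t ^+ n = \sum_(i < n.+1) t ^+ n by rewrite sumr_const card_ord mulr_natl.
  rewrite big_mkord; apply: ler_sum => i _.
  apply: ler_wiXn2l; [exact: ltW|exact: ltW|].
  by rewrite -ltnS.
pose h n (z : R * R) := (\sum_(j <- iota 0 n.+1) ((k * rho ^+ j) * (k * rho ^+ (n - j)))%:E *
  (`|b z| * \1_(rect 0 (2 ^+ j) 0 (2 ^+ (n - j))) z)%:E)%E.
have mb : measurable_fun (quadrant R) b by exact: measurable_bmo measurable_quadrant _.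
have mh j i : measurable_fun (quadrant R) (fun z => (`|b z| * \1_(rect 0 (2 ^+ j) 0 (2 ^+ i)) z)%:E).
  apply/measurable_EFinP/measurable_funM; first exact: measurableT_comp.
  by apply: measurable_indic; exact: measurable_rect.
have h0 j i z : (0 <= (`|b z| * \1_(rect 0 (2 ^+ j) 0 (2 ^+ i)) z)%:E)%E.
  by rewrite lee_fin mulr_ge0.
have k0' j : 0 <= k * rho ^+ j by pos.
apply: (@le_lt_trans _ _ (A * k ^+ 2 * T ^+ 3)%:E); last exact: ltry.
apply: (@integral_le_nneseries _ _ _ mu (quadrant R) _ h (fun n => A * k ^+ 2 * T ^+ 2 * t ^+ n)).
- exact: measurable_quadrant.
- apply/measurable_EFinP/measurable_funM; first exact: measurableT_comp.
  by apply: measurable_tensor; exact: measurable_wt.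
- move=> [x y] [/= x0 y0]; rewrite lee_fin mulr_ge0// mulr_ge0// ltW//; exact: wt_gt0.
- by move=> n; apply: emeasurable_sum => j; exact: measurable_funeM.
- by move=> n z _; apply: sume_ge0 => j _; rewrite mule_ge0// lee_fin mulr_ge0.
- move=> [x y] [/= x0 y0]; have [i [xi wi]] := wk x x0; have [j [yj wj]] := wk y y0.
  exists (i + j)%N; rewrite /h.
  have iS : i \in iota 0 (i + j).+1 by rewrite mem_iota add0n ltnS leq_addr.
  rewrite (big_rem i iS) /=; apply: lee_paddr.
    by apply: sume_ge0 => l _; rewrite mule_ge0// lee_fin mulr_ge0.
  rewrite addKn -EFinM lee_fin indicE mem_set; last first.
    by split; rewrite /= in_itv/= ?xi ?yj andbT; [exact: x0|exact: y0].
  rewrite mulr1 mulrC; apply: ler_wpM2r => //; apply: ler_pM => //; exact/ltW/wt_gt0.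
- move=> n; rewrite ge0_integral_sum//; last 3 first.
  + exact: measurable_quadrant.
  + by move=> j; exact: measurable_funeM.
  + by move=> j z _; rewrite mule_ge0// lee_fin mulr_ge0.
  apply: (@le_trans _ _ (\sum_(j <- iota 0 n.+1) (A * k ^+ 2 * n.+1%:R * (t ^+ 3) ^+ n)%:E)%E).
    rewrite big_seq [leRHS]big_seq; apply: lee_sum => j; rewrite mem_iota add0n ltnS => /= jn.
    rewrite ge0_integralZl_EFin//; last 2 first.
    + exact: measurable_quadrant.
    + by rewrite mulr_ge0.
    have -> : (\int[mu]_(z in quadrant R) (`|b z| * \1_(rect 0 (2 ^+ j) 0 (2 ^+ (n - j))) z)%:E =
       \int[mu]_(z in rect 0 (2 ^+ j) 0 (2 ^+ (n - j))) `|b z|%:E)%E.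
      rewrite -[in RHS](setIidr (@rect_quadrant 0 (2 ^+ j) 0 (2 ^+ (n - j)) (lexx _) (lexx _))).
      rewrite [RHS]integral_mkcondr; apply: eq_integral => z _; rewrite indicE /patch.
      by case: ifP; rewrite ?mulr1 ?mulr0.
    apply: le_trans (lee_wpmul2l _ (bA _ _)) _; first by rewrite lee_fin mulr_ge0.
    rewrite -EFinM lee_fin subnKC//.
    have hh := ler_pM _ _ (rhoV j) (rhoV (n - j)%N).
    rewrite -exprD subnKC// in hh.
    have -> : k * rho ^+ j * (k * rho ^+ (n - j)) *
      (A * n.+1%:R * (vol (itvoc 0 (2 ^+ j)) * vol (itvoc 0 (2 ^+ (n - j))))) =
      A * k ^+ 2 * n.+1%:R * (rho ^+ j * vol (itvoc 0 (2 ^+ j)) * (rho ^+ (n - j) * vol (itvoc 0 (2 ^+ (n - j))))).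
      by ring.
    apply: ler_wpM2l; first by pos.
    by apply: hh; apply: mulr_ge0; rewrite ?vol_ge0//; pos.
  rewrite sumEFin lee_fin big_const_seq count_predT size_iota iter_addr_0 -[leLHS]mulr_natr.
  have -> : A * k ^+ 2 * n.+1%:R * (t ^+ 3) ^+ n * n.+1%:R =
     A * k ^+ 2 * ((n.+1%:R * t ^+ n) ^+ 2 * t ^+ n).
    by rewrite -exprM mulnC exprM; ring.
  rewrite -[leRHS]mulrA; apply: ler_wpM2l; first by pos.
  apply: ler_wpM2r; first by pos.
  by rewrite lerXn2r// nnegrE; pos.
- move=> n; rewrite -mulr_sumr (_ : _ * T ^+ 3 = A * k ^+ 2 * T ^+ 2 * T); last by ring.
  apply: ler_wpM2l.
    by pos.
  by apply: geometric_sum_le; rewrite ltW.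
Qed.
Lemma wt_antimono (g g' x : R) : g <= g' -> 0 < x -> wt g' x <= wt g x.
Proof. by move=> gg x0; apply: ler_powR; lra. Qed.

Lemma bmo_pairing (g1 g2 : R) : 0 < g1 -> 0 < g2 -> exists K : R, 0 <= K /\
  forall (phi : R * R -> R) (C : R), measurable_fun (quadrant R) phi ->
  (forall x y, 0 < x -> 0 < y -> `|phi (x, y)| <= C * (wt g1 x * wt g2 y)) ->
  mu.-integrable (quadrant R) (fun z => (b z * phi z)%:E) /\
  `|\int[mu]_(z in quadrant R) (b z * phi z)| <= C * K.
Proof.
move=> g10 g20; pose g := Num.min g1 g2.
have g0 : 0 < g by rewrite /g lt_min g10.
have wb := weighted_bmo g0.
pose w (z : R * R) := `|b z| * (wt g z.1 * wt g z.2).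
have mb : measurable_fun (quadrant R) b by exact: measurable_bmo measurable_quadrant _.
have w0 z : quadrant R z -> 0 <= w z.
  by case: z => x y [/= x0 y0]; rewrite mulr_ge0// mulr_ge0// ltW//; exact: wt_gt0.
have iw : mu.-integrable (quadrant R) (EFin \o w).
  apply/integrableP; split.
    apply/measurable_EFinP/measurable_funM; first exact: measurableT_comp.
    by apply: measurable_tensor; exact: measurable_wt.
  rewrite (eq_integral (fun z => (w z)%:E))// => z; rewrite inE => Qz.
  by rewrite /= ger0_norm// w0.
exists (\int[mu]_(z in quadrant R) w z); split.
  by apply: Rintegral_ge0 => z Qz; exact: w0.
move=> phi C mphi phiC.
have C0 : 0 <= C.
  have := phiC 1 1 ltr01 ltr01; have w11 : 0 < wt g1 1 * wt g2 1 by rewrite mulr_gt0//; exact: wt_gt0.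
  by move=> h; rewrite -(pmulr_lge0 _ w11); apply: le_trans h.
have le z : quadrant R z -> `|b z * phi z| <= C * w z.
  case: z => x y [/= x0 y0]; rewrite normrM /w mulrCA ler_wpM2l//.
  apply: le_trans (phiC _ _ x0 y0) _; rewrite ler_wpM2l//.
  apply: ler_pM; [exact/ltW/wt_gt0|exact/ltW/wt_gt0| |].
    by apply: wt_antimono => //; rewrite /g ge_min lexx.
  by apply: wt_antimono => //; rewrite /g ge_min lexx orbT.
have iC : mu.-integrable (quadrant R) (EFin \o (fun z => C * w z)).
  exact: (integrableZl measurable_quadrant C iw).
have ib : mu.-integrable (quadrant R) (EFin \o (fun z => b z * phi z)).
  apply: le_integrable iC; first exact: measurable_quadrant.
    by apply/measurable_EFinP; exact: measurable_funM.
  move=> z Qz; rewrite lee_fin; apply: le_trans (le z Qz) _.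
  exact: ler_norm.
split => //.
apply: le_trans (le_normr_Rintegral measurable_quadrant ib) _.
rewrite -RintegralZl//; last exact: measurable_quadrant.
apply: le_Rintegral => //; first exact: measurable_quadrant.
exact: (integrable_norm ib).
Qed.

Definition pairing_form (f h : R -> R) : R :=
  \int[mu]_(z in quadrant R) (b z * (f z.1 * h z.2)).

Section pairing_form.
Variables (g1 g2 : R) (g1_gt0 : 0 < g1) (g2_gt0 : 0 < g2).

Lemma tensor_le (f h : R -> R) (C C' x y : R) : 0 < x -> 0 < y ->
  `|f x| <= C * wt g1 x -> `|h y| <= C' * wt g2 y ->
  `|f x * h y| <= (C * C') * (wt g1 x * wt g2 y).
Proof. by move=> x0 y0 hf hh; rewrite normrM mulrACA; exact: ler_pM. Qed.

Lemma integrable_pairing (f h : R -> R) : dominated g1 f -> dominated g2 h ->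
  mu.-integrable (quadrant R) (EFin \o (fun z => b z * (f z.1 * h z.2))).
Proof.
move=> [mf [C Cf]] [mh [C' Ch]]; have [K [_ bK]] := bmo_pairing g1_gt0 g2_gt0.
have [|//] := bK (fun z => f z.1 * h z.2) (C * C') (measurable_tensor mf mh).
by move=> x y x0 y0 /=; apply: tensor_le => //; [exact: Cf|exact: Ch].
Qed.

Lemma pairing_formDl (a : R) (f f' h : R -> R) : dominated g1 f -> dominated g1 f' -> dominated g2 h ->
  pairing_form (fun x => a * f x + f' x) h = a * pairing_form f h + pairing_form f' h.
Proof.
move=> df df' dh; have mQ := measurable_quadrant.
rewrite /pairing_form -RintegralZl//; last exact: integrable_pairing.
rewrite -RintegralD//; [|exact: (integrableZl mQ a (integrable_pairing df dh))|exact: integrable_pairing].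
by apply: eq_Rintegral => z _; ring.
Qed.

Lemma pairing_formDr (a : R) (f h h' : R -> R) : dominated g1 f -> dominated g2 h -> dominated g2 h' ->
  pairing_form f (fun x => a * h x + h' x) = a * pairing_form f h + pairing_form f h'.
Proof.
move=> df dh dh'; have mQ := measurable_quadrant.
rewrite /pairing_form -RintegralZl//; last exact: integrable_pairing.
rewrite -RintegralD//; [|exact: (integrableZl mQ a (integrable_pairing df dh))|exact: integrable_pairing].
by apply: eq_Rintegral => z _; ring.
Qed.

(** With c the mean of [b], the product term is the integral of c f h, so the difference is the
    integral of (b - c) f h over the rectangle. *)
Lemma pairing_form_bmo : exists N : R, 0 < N /\ bmo_form lambda g1 g2 pairing_form N.
Proof.
have [N [N0 bN]] := bmo_rect; exists N; split => //.
have [K [K0 bK]] := bmo_pairing g1_gt0 g2_gt0.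
have mQ := measurable_quadrant.
split.
- move=> h dh; have [mh [C' Ch]] := dh; exists (C' * K); split.
    by move=> a f f' df df'; exact: pairing_formDl.
  move=> C f [mf _] Cf; rewrite mulrA.
  have [|_ //] := bK (fun z => f z.1 * h z.2) (C * C') (measurable_tensor mf mh).
  by move=> x y x0 y0 /=; apply: tensor_le => //; [exact: Cf|exact: Ch].
- move=> f df; have [mf [C Cf]] := df; exists (C * K); split.
    by move=> a h h' dh dh'; exact: pairing_formDr.
  move=> C' h [mh _] Ch; rewrite mulrA [C' * C]mulrC.
  have [|_ //] := bK (fun z => f z.1 * h z.2) (C * C') (measurable_tensor mf mh).
  by move=> x y x0 y0 /=; apply: tensor_le => //; [exact: Cf|exact: Ch].
move=> a1 b1 a2 b2 f h M M' a10 ab1 a20 ab2 mf mh fM hM fS hS.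
have b10 : 0 < b1 by exact: le_lt_trans ab1.
have b20 : 0 < b2 by exact: le_lt_trans ab2.
have [ib ibN] := bN _ _ _ _ a10 ab1 a20 ab2.
set V := vol _ * vol _ in ibN *; set Q := rect _ _ _ _ in ib ibN.
have mQ' : measurable Q by exact: measurable_rect.
have QQ : Q `<=` quadrant R by exact: rect_quadrant.
have V0 : 0 < V by rewrite mulr_gt0// vol_itv_gt0.
have df : dominated g1 f.
  by apply: (dominated_bounded lambda_gt0 g1_gt0 b10 mf fM) => x bx; apply: fS; [exact: lt_trans bx|right].
have dh : dominated g2 h.
  by apply: (dominated_bounded lambda_gt0 g2_gt0 b20 mh hM) => x bx; apply: hS; [exact: lt_trans bx|right].
have -> : pairing_form (\1_(itvoc a1 b1)) (\1_(itvoc a2 b2)) / V = mean lambda b Q.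
  rewrite mean_rect -/Q -/V mulrC; congr (_ * _).
  rewrite /pairing_form -[in RHS](setIidr QQ) /Rintegral [in RHS]integral_mkcondr; congr fine.
  apply: eq_integral => z _; rewrite /patch /Q /rect in_setX !indicE.
  by case: (z.1 \in _); case: (z.2 \in _); rewrite ?mulr1 ?mulr0.
set c := mean _ _ _ in ibN *.
have [it <-] := Int_tensor g1_gt0 g2_gt0 df dh.
have ip := integrable_pairing df dh.
have ict : mu.-integrable (quadrant R) (EFin \o (fun z => c * (f z.1 * h z.2))) by exact: (integrableZl mQ c it).
rewrite /pairing_form -RintegralZl// -RintegralB//.
have -> : \int[mu]_(z in quadrant R) (b z * (f z.1 * h z.2) - c * (f z.1 * h z.2)) =
  \int[mu]_(z in Q) ((b z - c) * (f z.1 * h z.2)).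
  rewrite -[in RHS](setIidr QQ) /Rintegral [in RHS]integral_mkcondr; congr fine.
  apply: eq_integral => -[x y]; rewrite inE => -[/= x0 y0]; rewrite /patch; case: ifPn => [_|].
    by rewrite mulrBl.
  rewrite /Q /rect in_setX /= negb_and => nQ.
  suff -> : f x * h y = 0 by rewrite !mulr0 subrr.
  case/orP: nQ => nQ; [rewrite fS ?mul0r//|rewrite hS ?mulr0//].
    exact: notin_itvoc.
  exact: notin_itvoc.
have iQ : mu.-integrable Q (EFin \o (fun z => (b z - c) * (f z.1 * h z.2))).
  have := integrableB mQ ip ict; move=> /(integrableS mQ mQ' QQ).
  by apply: eq_integrable => // z _ /=; rewrite -EFinD mulrBl.
have iO := integrable_oscillation bN c a10 ab1 a20 ab2.
have iN : mu.-integrable Q (EFin \o (fun z => `|b z - c|)) by exact: (integrable_norm iO).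
apply: le_trans (le_normr_Rintegral mQ' iQ) _.
apply: (@le_trans _ _ (\int[mu]_(z in Q) (M * M' * `|b z - c|))).
  apply: le_Rintegral => //.
  - exact: (integrable_norm iQ).
  - exact: (integrableZl mQ' (M * M') iN).
  move=> z /QQ[z1 z2]; rewrite normrM mulrC normrM; apply: ler_wpM2r => //.
  by apply: ler_pM => //; [exact: fM|exact: hM].
have M0 : 0 <= M by apply: le_trans (fM _ ltr01).
have M0' : 0 <= M' by apply: le_trans (hM _ ltr01).
rewrite RintegralZl// (_ : N * M * M' * V = M * M' * (N * V)); last by ring.
by apply: ler_wpM2l => //; rewrite mulr_ge0.
Qed.

End pairing_form.
End bmo.
End little_bmo_form.

(** * Test functions *)

Section plane.
Context {R : realType}.

(** The grid cells of side 1/(n + 1) that lie in [O] are countably many measurable rectangles, and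
    they cover it. *)
Lemma locally_box_measurable (O : set (R * R)) :
  (forall z, O z -> exists2 e : R, 0 < e & forall x y, `|z.1 - x| < e -> `|z.2 - y| < e -> O (x, y)) ->
  measurable O.
Proof.
move=> oO.
pose cell (n : nat) (i : int) : set R := `[i%:~R / n.+1%:R, (i + 1)%:~R / n.+1%:R[%classic.
pose C (p : nat * (int * int)) := cell p.1 p.2.1 `*` cell p.1 p.2.2.
have cellP n (x : R) : cell n (Num.floor (x * n.+1%:R)) x.
  rewrite /cell /= in_itv/= ler_pdivrMr// ltr_pdivlMr//.
  by rewrite Num.Theory.ge_floor Num.Theory.floorD1_gt.
have cell_dist n i (x y : R) : cell n i x -> cell n i y -> `|x - y| < n.+1%:R^-1.
  rewrite /cell /= !in_itv/= intrD mulrDl mul1r.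
  suff h (u v : R) : u <= x < u + v -> u <= y < u + v -> `|x - y| < v by exact: h.
  by move=> /andP[h1 h2] /andP[h3 h4]; rewrite ltr_norml; lra.
have -> : O = \bigcup_(p in [set p | C p `<=` O]) C p.
  apply/seteqP; split => [[x y] Oxy|z [p CO Cz]]; last exact: CO.
  have [e e0 eO] := oO _ Oxy.
  have [n ne] : exists n : nat, n.+1%:R^-1 < e.
    exists (Num.truncn e^-1); rewrite invf_plt ?posrE//; exact: truncnS_gt.
  exists (n, (Num.floor (x * n.+1%:R), Num.floor (y * n.+1%:R))); last by split; exact: cellP.
  move=> [x' y'] [/= cx cy]; apply: eO => /=.
    by apply: lt_trans ne; exact: cell_dist (cellP n x) cx.
  by apply: lt_trans ne; exact: cell_dist (cellP n y) cy.
rewrite bigcup_mkcond; apply: countable_bigcupT_measurable => //.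
by move=> p; case: ifPn => // _; apply: measurableX; exact: measurable_itv.
Qed.

Lemma open_measurable_plane (O : set (R * R)) : open O -> measurable O.
Proof.
move=> oO; apply: locally_box_measurable => z Oz.
have /nbhs_ballP[e e0 eO] : nbhs z O by exact: open_nbhs_nbhs.
by exists e => // x y hx hy; apply: eO; split.
Qed.

Lemma locally_uniform_measurable (phi : R * R -> R) (D : set (R * R)) : measurable D ->
  (forall z, D z -> exists2 e : R, 0 < e & forall x y, `|z.1 - x| < e -> `|z.2 - y| < e -> D (x, y)) ->
  (forall z (t : R), D z -> 0 < t -> exists2 e : R, 0 < e &
    forall x y, D (x, y) -> `|z.1 - x| < e -> `|z.2 - y| < e -> `|phi z - phi (x, y)| < t) ->
  measurable_fun D phi.
Proof.
move=> mD oD cphi; move=> _; apply: (measurability _ (RGenOInfty.measurableE R)) => //.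
move=> _ [_ [a ->] <-]; apply: locally_box_measurable => z [Dz].
rewrite /= in_itv/= andbT => az.
have [e1 e10 h1] := oD _ Dz.
have [|e2 e20 h2] := cphi z (phi z - a) Dz; first by rewrite subr_gt0.
exists (Num.min e1 e2); first by rewrite lt_min e10.
move=> x y; rewrite !lt_min => /andP[x1 x2] /andP[y1 y2]; split; first exact: h1.
rewrite /= in_itv/= andbT; have := h2 _ _ (h1 _ _ x1 y1) x2 y2.
by rewrite ltr_norml => /andP[_]; lra.
Qed.

End plane.

Section test_functions.
Context {R : realType}.
Variables (lambda : R) (lambda_gt0 : 0 < lambda).
Local Notation m := (bessel_measure lambda).
Local Notation w := (test_weight lambda).
Local Notation Int := (Int lambda).
Local Notation wt := (wt lambda).
Local Notation dominated := (dominated lambda).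
Local Notation dominated_functional := (dominated_functional lambda).
Implicit Types p : test_type R.

Definition gauge p (x : R) : R := Defs.radius p + `|x - basepoint p|.

Lemma test_leE p (V : zmodType) (le_norm : V -> R -> Prop) (f : R -> V) (C : R) :
  test_le lambda p le_norm f C <->
  (forall x, 0 < x -> le_norm (f x) (C * w p x)) /\
  (forall x y, 0 < x -> 0 < y -> `|x - y| <= gauge p x / 2 ->
    le_norm (f x - f y) (C * (`|x - y| / gauge p x) `^ regularity p * w p x)).
Proof. by case: p. Qed.

(** [L] stands for the combination a u + v. It is kept abstract because it is used twice: on real
    values, and on values that are functions of x2. *)
Lemma test_le_comb p (V : zmodType) (le_norm : V -> R -> Prop) (L : V -> V -> V) (s : R)
    (f g : R -> V) (C C' : R) :
  (forall u v c d, le_norm u c -> le_norm v d -> le_norm (L u v) (s * c + d)) ->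
  (forall u u' v v', L u v - L u' v' = L (u - u') (v - v')) ->
  test_le lambda p le_norm f C -> test_le lambda p le_norm g C' ->
  test_le lambda p le_norm (fun x => L (f x) (g x)) (s * C + C').
Proof.
move=> Lle LB /test_leE[f1 f2] /test_leE[g1 g2]; apply/test_leE; split.
  by move=> x x0; rewrite mulrDl -mulrA; apply: Lle; [exact: f1|exact: g1].
move=> x y x0 y0 xy; rewrite LB !mulrDl -(mulrA s) -(mulrA s).
by apply: Lle; [exact: f2|exact: g2].
Qed.

Lemma product_test_le_lin p1 p2 (a : R) (f g : R -> R -> R) (C C' : R) :
  product_test_le lambda p1 p2 f C -> product_test_le lambda p1 p2 g C' ->
  product_test_le lambda p1 p2 (fun x1 x2 => a * f x1 x2 + g x1 x2) (`|a| * C + C').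
Proof.
move=> hf hg; apply: (@test_le_comb p1 _ _ (fun (u v : R -> R) x => a * u x + v x) `|a| f g) hf hg.
  move=> u v c d hu hv; apply: (@test_le_comb p2 _ _ (fun (u v : R) => a * u + v) `|a|) hu hv.
    move=> u' v' c' d' hu' hv'; rewrite /abs_le; apply: le_trans (ler_normD _ _) _.
    by rewrite normrM lerD// ler_wpM2l.
  by move=> *; ring.
move=> u u' v v'; apply/funext => x.
by rewrite -[LHS]/(a * u x + v x - (a * u' x + v' x)) -[RHS]/(a * (u x - u' x) + (v x - v' x)); ring.
Qed.

Section one_test_type.
Variables (p : test_type R).
Hypotheses (x0_gt0 : 0 < basepoint p) (r_gt0 : 0 < Defs.radius p).
Hypotheses (reg_gt0 : 0 < regularity p) (dec_gt0 : 0 < decay p).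

Lemma gauge_ge x : Defs.radius p <= gauge p x.
Proof. by rewrite /gauge lerDl. Qed.

Lemma gauge_gt0 x : 0 < gauge p x.
Proof. exact: lt_le_trans r_gt0 (gauge_ge x). Qed.

Lemma test_weight_gt0 x : 0 < x -> 0 < w p x.
Proof.
move=> x0; have [c [C [c0 C0 h]]] := test_weight_bounds lambda_gt0 x0_gt0 r_gt0 dec_gt0.
have /andP[h1 _] := h x x0; apply: lt_le_trans h1; rewrite mulr_gt0//; exact: wt_gt0.
Qed.

Lemma test_le_dominated (h : R -> R) (C : R) : test_le lambda p abs_le h C ->
  dominated (decay p) h.
Proof.
move=> /test_leE[h1 h2]; split.
  apply: (@hoelder_measurable _ h (fun x => `|C * w p x|) (Defs.radius p / 2) (regularity p)) => //.
    by rewrite divr_gt0.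
  move=> x y x0 y0 xy; have g0 := gauge_gt0 x; have gr := gauge_ge x; have r0 := r_gt0.
  have := h2 _ _ x0 y0; rewrite /abs_le => hh; apply: le_trans (hh _) _; first by lra.
  rewrite mulrAC mulrC; apply: ler_pM; rewrite ?powR_ge0//.
    have := h1 _ x0; rewrite /abs_le; exact: le_trans.
  2: exact: ler_norm.
  apply: ge0_ler_powR; rewrite ?nnegrE; [exact: ltW|by pos|by pos|].
  by rewrite ler_wpM2l// lef_pV2 ?posrE ?divr_gt0//; lra.
have [c [C' [c0 C'0 hw]]] := test_weight_bounds lambda_gt0 x0_gt0 r_gt0 dec_gt0.
have C0 : 0 <= C.
  have := h1 1 ltr01; rewrite /abs_le => hh; rewrite -(pmulr_lge0 _ (test_weight_gt0 ltr01)).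
  exact: le_trans hh.
exists (C * C') => x x0; apply: le_trans (h1 _ x0) _; rewrite -mulrA ler_wpM2l//.
by have /andP[] := hw x x0.
Qed.

(** The decay assumed is twice the one required. The spare factor (1 + x)^(-e) turns increments
    measured by [s] into increments measured by the gauge, which is of order 1 + x. For increments
    longer than [s] the size bound is used at both points, whose weights are comparable. *)
Lemma test_le_bump (e s C : R) (h : R -> R) : 0 < e -> 0 < s ->
  (forall x, 0 < x -> `|h x| <= C * wt (2 * e) x) ->
  (forall x y, 0 < x -> 0 < y -> `|x - y| <= s ->
    `|h x - h y| <= C * (`|x - y| / s) `^ e * wt (2 * e) x) ->
  exists C', test_le lambda (with_exponents e p) abs_le h C'.
Proof.
move=> e0 s0 h1 h2; set p' := with_exponents e p.
have [c [C' [c0 C'0 hw]]] := @test_weight_bounds _ _ lambda_gt0 p' x0_gt0 r_gt0 e0.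
have l0 := lambda_gt0; have r0 := r_gt0; have xb0 := x0_gt0.
have C0 : 0 <= C.
  have := h1 1 ltr01; have w0 : 0 < wt (2 * e) 1 by exact: wt_gt0.
  by move=> hh; rewrite -(pmulr_lge0 _ w0); apply: le_trans hh.
have wtE x : 0 < x -> wt (2 * e) x = wt e x * (1 + x) `^ (- e).
  by move=> x0; rewrite /wt -powRDp; [congr powR; ring|by pos].
have wt1 x : 0 < x -> wt (2 * e) x <= wt e x.
  by move=> x0; apply: (wt_antimono lambda) => //; lra.
pose A := Defs.radius p + basepoint p + 1.
have A0 : 0 < A by rewrite /A; lra.
have gA x : 0 < x -> gauge p x <= A * (1 + x).
  move=> x0; rewrite /gauge /A.
  have : `|x - basepoint p| <= x + basepoint p by rewrite ler_norml; lra.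
  by nra.
pose a := Defs.radius p / (1 + basepoint p + Defs.radius p).
have a0 : 0 < a by rewrite /a; pos.
have ga x : 0 < x -> a * (1 + x) <= gauge p x.
  move=> x0; rewrite /gauge /a mulrAC ler_pdivrMr; last by lra.
  have := ler_norm (x - basepoint p); have := normr_ge0 (x - basepoint p).
  by nra.
have far x y : 0 < x -> 0 < y -> `|x - y| <= gauge p x / 2 -> (1 + x) * (a / (2 * A)) <= 1 + y.
  move=> x0 y0 xy; have := gA _ y0; have := ga _ x0.
  have : gauge p x <= gauge p y + `|x - y|.
    rewrite /gauge -addrA lerD2l; have := ler_normD (y - basepoint p) (x - y).
    by rewrite (_ : y - _ + (x - y) = x - basepoint p)//; ring.
  move=> k1 k2 k3; rewrite mulrA ler_pdivrMr; last by rewrite mulr_gt0.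
  by rewrite mulrC; nra.
pose T := 2 * lambda + 1 + 2 * e.
have T0 : 0 < T by rewrite /T; lra.
pose b := (a / (2 * A)) `^ (- T).
have aA0 : 0 < a / (2 * A) by pos.
have b0 : 0 < b by rewrite /b; pos.
have wfar x y : 0 < x -> 0 < y -> `|x - y| <= gauge p x / 2 -> wt (2 * e) y <= b * wt (2 * e) x.
  move=> x0 y0 xy; rewrite /wt -/T /b mulrC -powRM; [|by pos|by pos].
  rewrite !powRN lef_pV2 ?posrE; [|by pos|by pos].
  apply: ge0_ler_powR; rewrite ?nnegrE; [by pos|by pos|by pos|exact: far].
pose K := C * (1 + b) * s `^ (- e) * A `^ e / c.
have K0 : 0 <= K by rewrite /K; pos.
exists (C / c + K); apply/test_leE; split => [x x0|x y x0 y0 xy]; rewrite /abs_le.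
  have wp0 : c * wt e x <= w p' x by have /andP[] := hw x x0.
  have wt0 : 0 < wt e x by exact: wt_gt0.
  apply: le_trans (h1 _ x0) _; rewrite [leRHS]mulrDl; apply: ler_wpDr.
    by apply: mulr_ge0 => //; apply: le_trans wp0; pos.
  apply: (@le_trans _ _ (C * wt e x)); first by rewrite ler_wpM2l// wt1.
  by rewrite -mulrA ler_wpM2l// mulrC ler_pdivlMr// mulrC.
have g0 : 0 < gauge p x := gauge_gt0 x.
rewrite -[gauge p' x]/(gauge p x) -[regularity p']/e in xy *.
have wp0 : c * wt e x <= w p' x by have /andP[] := hw x x0.
have wt0 : 0 < wt e x by exact: wt_gt0.
have main : `|h x - h y| <= C * (1 + b) * (`|x - y| / s) `^ e * wt (2 * e) x.
  have wt2 : 0 < wt (2 * e) x by exact: wt_gt0.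
  case: (leP `|x - y| s) => xys.
    apply: le_trans (h2 _ _ x0 y0 xys) _; rewrite ler_pM2r// ler_wpM2r ?powR_ge0//.
    by rewrite ler_peMr// lerDl ltW.
  apply: le_trans (ler_normB _ _) _.
  have p1 : 1 <= (`|x - y| / s) `^ e.
    have -> : (1 : R) = 1 `^ e by rewrite powR1.
    apply: ge0_ler_powR; rewrite ?nnegrE//; [exact: ltW|by pos|].
    by rewrite ler_pdivlMr// mul1r ltW.
  have k1 := h1 _ x0; have k2 := h1 _ y0; have k3 := wfar _ _ x0 y0 xy.
  have k4 : C * wt (2 * e) y <= C * (b * wt (2 * e) x) by rewrite ler_wpM2l.
  apply: (@le_trans _ _ (C * (1 + b) * 1 * wt (2 * e) x)); first by lra.
  by rewrite ler_pM2r// ler_wpM2l//; pos.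
apply: (le_trans main).
have dE : `|x - y| / s = `|x - y| / gauge p x * (gauge p x / s) by field; rewrite !gt_eqF.
rewrite dE powRM; [|by pos|by pos].
set q := (_ / _) `^ e; have q0 : 0 <= q by exact: powR_ge0.
have k1 : (gauge p x / s) `^ e * (1 + x) `^ (- e) <= s `^ (- e) * A `^ e.
  apply: (@le_trans _ _ ((A * (1 + x) / s) `^ e * (1 + x) `^ (- e))).
    rewrite ler_wpM2r ?powR_ge0//; apply: ge0_ler_powR; rewrite ?nnegrE; [exact: ltW|by pos|by pos|].
    by rewrite ler_pM2r ?invr_gt0 ?gA//.
  rewrite powRM; [|by pos|by pos]; rewrite powRM; [|by pos|by pos].
  rewrite powR_inv_base; last exact: ltW.
  rewrite mulrAC -(mulrA (A `^ e)) -powRDp ?subrr ?powRr0 ?mulr1; last by pos.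
  by rewrite mulrC.
rewrite wtE//.
have -> : C * (1 + b) * (q * (gauge p x / s) `^ e) * (wt e x * (1 + x) `^ (- e)) =
  (C * (1 + b) * q * wt e x) * ((gauge p x / s) `^ e * (1 + x) `^ (- e)) by ring.
apply: (@le_trans _ _ (C * (1 + b) * q * wt e x * (s `^ (- e) * A `^ e))).
  by rewrite ler_wpM2l//; pos.
have -> : C * (1 + b) * q * wt e x * (s `^ (- e) * A `^ e) = K * q * (c * wt e x).
  by rewrite /K; field; rewrite gt_eqF.
apply: ler_pM => //; [by pos|by pos|].
by rewrite ler_wpM2r// lerDr; pos.
Qed.

End one_test_type.
End test_functions.

(** * Test functions of two variables *)

Section product_test_functions.
Context {R : realType}.
Variables (lambda : R) (lambda_gt0 : 0 < lambda).
Local Notation m := (bessel_measure lambda).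
Local Notation w := (test_weight lambda).
Local Notation Int := (Int lambda).
Local Notation wt := (wt lambda).
Local Notation dominated := (dominated lambda).
Local Notation dominated_functional := (dominated_functional lambda).
Implicit Types p : test_type R.

Lemma test_le_with_exponents p (e C : R) (h : R -> R) : 0 < Defs.radius p ->
  0 < regularity p < e -> 0 < decay p < e -> 0 <= C ->
  test_le lambda (with_exponents e p) abs_le h C -> test_le lambda p abs_le h C.
Proof.
move=> r0 /andP[b0 be] /andP[g0 ge] C0 /test_leE[h1 h2]; apply/test_leE.
have gp x : 0 < gauge p x by exact: gauge_gt0.
have wle x : w (with_exponents e p) x <= w p x.
  case: p r0 b0 be g0 ge {h1 h2} gp => x0 r b g /= r0 b0 be g0 ge gp.
  have d0 := normr_ge0 (x - x0).
  apply: ler_wpM2l; first by rewrite invr_ge0 addr_ge0// fine_ge0.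
  have [-> |] := eqVneq (r / (r + `|x - x0|)) 0; first by rewrite !powR0// gt_eqF// (lt_trans g0).
  move=> q0; rewrite -(subrK g e) powRD ?q0 ?implybT// ler_piMl ?powR_ge0//.
  have q1 : 0 <= r / (r + `|x - x0|) <= 1.
    have s0 : 0 < r + `|x - x0| by lra.
    by rewrite ler_pdivrMr// mul1r lerDl d0 andbT divr_ge0// ltW.
  have [k1 k2] := andP q1.
  have -> : (1 : R) = 1 `^ (e - g) by rewrite powR1.
  by apply: ge0_ler_powR; rewrite ?nnegrE//; lra.
have w0 (p' : test_type R) x : 0 <= w p' x.
  by case: p' => x0 r b g /=; rewrite mulr_ge0 ?powR_ge0// invr_ge0 addr_ge0// fine_ge0.
split => [x x0|x y x0 y0 xy]; rewrite /abs_le.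
  by apply: le_trans (h1 _ x0) _; rewrite ler_wpM2l.
apply: le_trans (h2 _ _ x0 y0 xy) _; rewrite -!mulrA ler_wpM2l//.
apply: ler_pM => //; first exact: powR_ge0.
rewrite -[gauge (with_exponents e p) x]/(gauge p x) /=.
set q := _ / _; have q0 : 0 <= q by rewrite divr_ge0// ltW.
have q1 : q <= 1.
  by rewrite ler_pdivrMr ?mul1r//; apply: le_trans xy _; have := gp x; lra.
have [-> |qn] := eqVneq q 0; first by rewrite !powR0// gt_eqF// (lt_trans b0).
rewrite -(subrK (regularity p) e) powRD ?qn ?implybT// ler_piMl ?powR_ge0//.
have -> : (1 : R) = 1 `^ (e - regularity p) by rewrite powR1.
by apply: ge0_ler_powR; rewrite ?nnegrE//; lra.
Qed.

Lemma test_le_functional p (L : (R -> R) -> R) (K : R) :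
  0 < basepoint p -> 0 < Defs.radius p -> 0 < regularity p -> 0 < decay p ->
  dominated_functional (decay p) L K -> exists2 K', 0 <= K' &
  forall (h : R -> R) C, 0 <= C -> test_le lambda p abs_le h C -> `|L h| <= C * K'.
Proof.
move=> b0 r0 s0 d0 LK; have K0 := functional_ge0 LK.
have [c [C2 [c0 C20 h2]]] := test_weight_bounds lambda_gt0 b0 r0 d0.
exists (C2 * K); first by rewrite mulr_ge0// ltW.
move=> h C C0 hh; rewrite mulrA; apply: (functional_le LK); first exact: test_le_dominated hh.
move=> x x0; have /test_leE[/(_ _ x0) + _] := hh; rewrite /abs_le => k.
by apply: (le_trans k); rewrite -mulrA ler_wpM2l//; have /andP[] := h2 _ x0.
Qed.

Section two_test_types.
Variables p1 p2 : test_type R.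
Hypotheses (b1 : 0 < basepoint p1) (r1 : 0 < Defs.radius p1).
Hypotheses (e1 : 0 < regularity p1) (d1 : 0 < decay p1).
Hypotheses (b2 : 0 < basepoint p2) (r2 : 0 < Defs.radius p2).
Hypotheses (e2 : 0 < regularity p2) (d2 : 0 < decay p2).
Local Notation ptest := (product_test_le lambda p1 p2).

Lemma ptest_slice (f : R -> R -> R) (C x : R) : ptest f C -> 0 < x ->
  test_le lambda p2 abs_le (f x) (C * w p1 x).
Proof. by move=> /test_leE[+ _]; apply. Qed.

Lemma ptest_increment (f : R -> R -> R) (C x y : R) : ptest f C -> 0 < x -> 0 < y ->
  `|x - y| <= gauge p1 x / 2 ->
  test_le lambda p2 abs_le (fun z => f x z - f y z)
    (C * (`|x - y| / gauge p1 x) `^ regularity p1 * w p1 x).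
Proof. by move=> /test_leE[_ +]; apply. Qed.

Lemma ptest_slice_swap (f : R -> R -> R) (C y : R) : ptest f C -> 0 < y ->
  test_le lambda p1 abs_le (f^~ y) (C * w p2 y).
Proof.
move=> hf y0; apply/test_leE; split => [x x0|x x' x0 x0' xx']; rewrite /abs_le.
  by have /test_leE[/(_ _ y0) + _] := ptest_slice hf x0; rewrite /abs_le mulrAC.
have /test_leE[/(_ _ y0) + _] := ptest_increment hf x0 x0' xx'.
rewrite /abs_le => h; apply: (le_trans h); rewrite le_eqVlt; apply/orP; left; apply/eqP; ring.
Qed.

Lemma ptest_le (f : R -> R -> R) (C x y : R) : ptest f C -> 0 < x -> 0 < y ->
  `|f x y| <= C * w p1 x * w p2 y.
Proof. by move=> hf x0 y0; have /test_leE[/(_ _ y0) + _] := ptest_slice hf x0. Qed.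

Lemma ptest_ge0 (f : R -> R -> R) (C : R) : ptest f C -> 0 <= C.
Proof.
move=> hf; have := ptest_le hf ltr01 ltr01.
have w1 : 0 < w p1 1 by exact: test_weight_gt0.
have w2 : 0 < w p2 1 by exact: test_weight_gt0.
by move=> h; rewrite -(pmulr_lge0 _ w1) -(pmulr_lge0 _ w2); apply: le_trans h.
Qed.

Lemma ptest_wt : exists C0 : R, 0 < C0 /\ forall (f : R -> R -> R) (C x y : R), ptest f C ->
  0 < x -> 0 < y -> `|f x y| <= (C * C0) * (wt (decay p1) x * wt (decay p2) y).
Proof.
have [c [C1 [c0 C10 h1]]] := test_weight_bounds lambda_gt0 b1 r1 d1.
have [c' [C2 [c'0 C20 h2]]] := test_weight_bounds lambda_gt0 b2 r2 d2.
exists (C1 * C2); split; first by rewrite mulr_gt0.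
move=> f C x y hf x0 y0; have C0 := ptest_ge0 hf.
apply: le_trans (ptest_le hf x0 y0) _.
have /andP[_ k1] := h1 _ x0; have /andP[_ k2] := h2 _ y0.
have -> : C * (C1 * C2) * (wt (decay p1) x * wt (decay p2) y) =
  C * ((C1 * wt (decay p1) x) * (C2 * wt (decay p2) y)) by ring.
rewrite -mulrA ler_wpM2l//; apply: ler_pM => //; exact/ltW/test_weight_gt0.
Qed.

(** By linearity, an increment of x1 |-> L (f x1) is [L] of an increment of [f], and that increment
    is again a test function in x2. *)
Lemma ptest_functional (L : (R -> R) -> R) (K : R) : dominated_functional (decay p2) L K ->
  exists2 K', 0 <= K' & forall (f : R -> R -> R) (C : R), ptest f C ->
    test_le lambda p1 abs_le (fun x => L (f x)) (C * K').
Proof.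
move=> LK.
have [K' K'0 main] := test_le_functional b2 r2 e2 d2 LK; exists K' => //.
move=> f C hf; have C0 := ptest_ge0 hf.
have w0 x : 0 < x -> 0 <= w p1 x by move=> x0; exact/ltW/test_weight_gt0.
apply/test_leE; split => [x x0|x y x0 y0 xy]; rewrite /abs_le.
  rewrite mulrAC; apply: main; first by rewrite mulr_ge0// w0.
  exact: ptest_slice.
rewrite -(functionalB LK); last 2 first.
- exact: test_le_dominated (ptest_slice hf x0).
- exact: test_le_dominated (ptest_slice hf y0).
have -> : forall q u : R, C * K' * q * u = C * q * u * K' by move=> *; ring.
apply: main; last exact: ptest_increment.
by rewrite mulr_ge0 ?w0// mulr_ge0// powR_ge0.
Qed.

(** Joint continuity: x2 moves first, at fixed x1; then x1 moves, with a bound uniform in x2 because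
    the weight in x2 is bounded. *)
Lemma measurable_ptest (f : R -> R -> R) (C : R) : ptest f C ->
  measurable_fun (quadrant R) (fun z => f z.1 z.2).
Proof.
move=> hf; have C0 := ptest_ge0 hf.
apply: locally_uniform_measurable; first exact: measurable_quadrant.
  move=> [x y] [/= x0 y0]; exists (Num.min x y); first by rewrite lt_min x0.
  move=> x' y'; rewrite !lt_min !ltr_norml => /andP[h1 _] /andP[_ h2].
  by split; rewrite /Rplus /=; lra.
move=> [x y] t [/= x0 y0] t0.
have small p (a : R) : 0 < Defs.radius p -> 0 < regularity p -> 0 <= a -> exists2 e, 0 < e &
    forall d, 0 <= d -> d < e -> d <= Defs.radius p / 2 /\ a * (d / Defs.radius p) `^ regularity p < t / 2.
  move=> r0 g0 a0; set g := regularity p in g0 *; set r := Defs.radius p in r0 *.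
  pose s := t / (4 * (a + 1)); have s0 : 0 < s by rewrite /s; pos.
  exists (Num.min (r / 2) (r * s `^ g^-1)); first by rewrite lt_min; apply/andP; split; pos.
  move=> d d0; rewrite lt_min => /andP[k1 k2]; split; first exact: ltW.
  have k3 : (d / r) `^ g <= s.
    apply: (@le_trans _ _ ((s `^ g^-1) `^ g)).
      apply: ge0_ler_powR; rewrite ?nnegrE; [exact: ltW|by pos|exact: powR_ge0|].
      by rewrite ler_pdivrMr// mulrC ltW.
    by rewrite -powRrM mulVf ?gt_eqF// powRr1// ltW.
  apply: (@le_lt_trans _ _ (a * s)); first by rewrite ler_wpM2l.
  rewrite /s mulrA ltr_pdivrMr; last by pos.
  by have : 0 < a * t + t * 2; [apply: ltr_wpDl; [pos|lra]|lra].
have [c [C2 [c0 C20 hw]]] := test_weight_bounds lambda_gt0 b2 r2 d2.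
have w2 z : 0 < z -> w p2 z <= C2.
  move=> z0; have /andP[_ k] := hw _ z0; apply: (le_trans k).
  by rewrite ler_piMr ?(ltW C20)//; exact: wt_le1.
have wx : 0 <= w p1 x by exact/ltW/test_weight_gt0.
have wy : 0 <= w p2 y by exact/ltW/test_weight_gt0.
have [s1 s10 h1] := small p1 (C * w p1 x * C2) r1 e1 ltac:(pos).
have [s2 s20 h2] := small p2 (C * w p1 x * w p2 y) r2 e2 ltac:(pos).
have grow p z z' : 0 < Defs.radius p -> 0 < regularity p ->
    (`|z - z'| / gauge p z) `^ regularity p <= (`|z - z'| / Defs.radius p) `^ regularity p.
  move=> r0 g0; have gz : 0 < gauge p z by exact: gauge_gt0.
  apply: ge0_ler_powR; rewrite ?nnegrE; [exact: ltW|by pos|by pos|].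
  by rewrite ler_wpM2l// lef_pV2 ?posrE// gauge_ge.
have near p z z' : `|z - z'| <= Defs.radius p / 2 -> `|z - z'| <= gauge p z / 2.
  by move=> k; have := gauge_ge p z; lra.
exists (Num.min s1 s2); first by rewrite lt_min s10.
move=> x' y' [/= x0' y0']; rewrite !lt_min => /andP[xs1 _] /andP[_ ys2].
have [n1 k1] := h1 _ (normr_ge0 _) xs1; have [n2 k2] := h2 _ (normr_ge0 _) ys2.
have -> : f x y - f x' y' = (f x y - f x y') + (f x y' - f x' y') by ring.
apply: le_lt_trans (ler_normD _ _) _; rewrite [t]splitr; apply: ltrD.
  apply: le_lt_trans k2.
  have /test_leE[_ /(_ _ _ y0 y0' (near _ _ _ n2))] := ptest_slice hf x0; rewrite /abs_le => k.
  apply: (le_trans k); rewrite mulrAC ler_wpM2l//; first by pos.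
  exact: grow.
apply: le_lt_trans k1.
have /test_leE[/(_ _ y0') + _] := ptest_increment hf x0 x0' (near _ _ _ n1); rewrite /abs_le => k.
apply: (le_trans k).
have -> : forall q, C * q * w p1 x * w p2 y' = C * w p1 x * w p2 y' * q by move=> ?; ring.
apply: ler_pM; [|exact: powR_ge0| |exact: grow].
  by apply: mulr_ge0; [pos|exact/ltW/test_weight_gt0].
by rewrite ler_wpM2l ?w2//; pos.
Qed.

Local Notation pnorm := (product_test_norm lambda p1 p2).

Lemma product_test_norm_le (f : R -> R -> R) (C : R) : ptest f C -> pnorm f <= C.
Proof. by move=> hf; apply: ge_inf => //; exists 0 => D; exact: ptest_ge0. Qed.

Lemma product_test_norm_lt (f : R -> R -> R) (e : R) : product_G lambda p1 p2 f ->
  pnorm f < e -> exists2 C, ptest f C & C < e.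
Proof.
move=> Gf fe; have hi : has_inf [set C | ptest f C].
  by split => //; exists 0 => D; exact: ptest_ge0.
have e0 : 0 < e - pnorm f by rewrite subr_gt0.
have [C hC Ce] := inf_adherent e0 hi; exists C => //.
by move: Ce; rewrite /product_test_norm subrKC.
Qed.

Lemma le_product_test_norm (f : R -> R -> R) (K c : R) : 0 <= K -> product_G lambda p1 p2 f ->
  (forall C, ptest f C -> c <= K * C) -> c <= K * pnorm f.
Proof.
move=> K0 Gf h; move: K0; rewrite le_eqVlt => /predU1P[K0|K0].
  by case: Gf => C hC; have := h C hC; rewrite -K0 !mul0r.
rewrite mulrC -ler_pdivrMr//; apply: lb_le_inf => // C hC.
by rewrite ler_pdivrMr// mulrC; exact: h.
Qed.

Lemma ptest_tensor (f h : R -> R) (C C' : R) : test_le lambda p1 abs_le f C ->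
  test_le lambda p2 abs_le h C' -> ptest (fun x y => f x * h y) (C * C').
Proof.
move=> /test_leE[f1 f2] /test_leE[h1 h2].
have main (u v : R) : `|u| <= v -> test_le lambda p2 abs_le (fun y => u * h y) (C' * v).
  move=> uv; apply/test_leE; split => [x x0|x y x0 y0 xy]; rewrite /abs_le.
    by rewrite normrM mulrC mulrAC; apply: ler_pM => //; exact: h1.
  rewrite -mulrBr normrM mulrC.
  have -> : forall q z : R, C' * v * q * z = (C' * q * z) * v by move=> *; ring.
  by apply: ler_pM => //; exact: h2.
apply/test_leE; split => [x x0|x y x0 y0 xy].
  by rewrite (mulrC C) -mulrA; apply: main; exact: f1.
have -> : (fun z => f x * h z) - (fun z => f y * h z) = (fun z => (f x - f y) * h z).
  by apply/funext => z; rewrite mulrBl.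
have -> : forall q z : R, C * C' * q * z = C' * (C * q * z) by move=> *; ring.
by apply: main; exact: f2.
Qed.

End two_test_types.

Section product_test.
Variables (e1 e2 : R) (p1 p2 : test_type R).
Hypotheses (adm1 : admissible e1 p1) (adm2 : admissible e2 p2).
Local Notation ptest := (product_test_le lambda p1 p2).
Local Notation product_test := (product_test lambda e1 e2 p1 p2).

Let b1 : 0 < basepoint p1. Proof. by case: adm1. Qed.
Let r1 : 0 < Defs.radius p1. Proof. by case: adm1. Qed.
Let s1 : 0 < regularity p1. Proof. by case: adm1 => _ _ /andP[]. Qed.
Let d1 : 0 < decay p1. Proof. by case: adm1 => _ _ _ /andP[]. Qed.
Let e1_gt0 : 0 < e1. Proof. by case: adm1 => _ _ /andP[+ +] _; exact: lt_trans. Qed.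
Let b2 : 0 < basepoint p2. Proof. by case: adm2. Qed.
Let r2 : 0 < Defs.radius p2. Proof. by case: adm2. Qed.
Let s2 : 0 < regularity p2. Proof. by case: adm2 => _ _ /andP[]. Qed.
Let d2 : 0 < decay p2. Proof. by case: adm2 => _ _ _ /andP[]. Qed.
Let e2_gt0 : 0 < e2. Proof. by case: adm2 => _ _ /andP[+ +] _; exact: lt_trans. Qed.

Lemma product_G_lin p p' (a : R) (f g : R -> R -> R) :
  product_G lambda p p' f -> product_G lambda p p' g ->
  product_G lambda p p' (fun x1 x2 => a * f x1 x2 + g x1 x2).
Proof. by move=> [C hf] [C' hg]; exists (`|a| * C + C'); exact: product_test_le_lin. Qed.

Lemma mean_zero_lin (a : R) (f g : R -> R -> R) :
  product_G lambda (with_exponents e1 p1) (with_exponents e2 p2) f ->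
  product_G lambda (with_exponents e1 p1) (with_exponents e2 p2) g ->
  mean_zero lambda f -> mean_zero lambda g ->
  mean_zero lambda (fun x1 x2 => a * f x1 x2 + g x1 x2).
Proof.
move=> [C hf] [C' hg] [f1 f2] [g1 g2]; split => [x x0|y y0].
  have df : dominated e2 (f x).
    by apply: (@test_le_dominated _ _ lambda_gt0 (with_exponents e2 p2)) (ptest_slice hf x0).
  have dg : dominated e2 (g x).
    by apply: (@test_le_dominated _ _ lambda_gt0 (with_exponents e2 p2)) (ptest_slice hg x0).
  have := functional_lin (Int_functional lambda_gt0 e2_gt0) a df dg.
  by rewrite /Int f1// g1// mulr0 addr0.
have df : dominated e1 (f^~ y).
  by apply: (@test_le_dominated _ _ lambda_gt0 (with_exponents e1 p1)) (ptest_slice_swap hf y0).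
have dg : dominated e1 (g^~ y).
  by apply: (@test_le_dominated _ _ lambda_gt0 (with_exponents e1 p1)) (ptest_slice_swap hg y0).
have := functional_lin (Int_functional lambda_gt0 e1_gt0) a df dg.
by rewrite /Int f2// g2// mulr0 addr0.
Qed.

Lemma product_test_lin (a : R) (f g : R -> R -> R) : product_test f -> product_test g ->
  product_test (fun x1 x2 => a * f x1 x2 + g x1 x2).
Proof.
move=> [Gf hf] [Gg hg]; split; first exact: product_G_lin.
move=> e e0.
have [f' [Gf' mf Gff nf]] := hf (e / (2 * (`|a| + 1))) ltac:(pos).
have [g' [Gg' mg Ggg ng]] := hg (e / 2) ltac:(pos).
have [C1 h1 C1e] := product_test_norm_lt b1 r1 d1 b2 r2 d2 Gff nf.
have [C2 h2 C2e] := product_test_norm_lt b1 r1 d1 b2 r2 d2 Ggg ng.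
have E : (fun x1 x2 => a * f x1 x2 + g x1 x2) - (fun x1 x2 => a * f' x1 x2 + g' x1 x2) =
   (fun x1 x2 => a * (f - f') x1 x2 + (g - g') x1 x2).
  apply/funext => x; apply/funext => y.
  rewrite -[LHS]/(a * f x y + g x y - (a * f' x y + g' x y)).
  by rewrite -[RHS]/(a * (f x y - f' x y) + (g x y - g' x y)); ring.
have h := product_test_le_lin a h1 h2.
exists (fun x1 x2 => a * f' x1 x2 + g' x1 x2); split.
- exact: product_G_lin.
- exact: mean_zero_lin.
- by rewrite E; exact: product_G_lin.
rewrite E; apply: le_lt_trans (product_test_norm_le b1 r1 d1 b2 r2 d2 h) _.
have C10 := ptest_ge0 b1 r1 d1 b2 r2 d2 h1.
have a1 : 0 < `|a| + 1 by rewrite ltr_wpDl.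
have : `|a| * C1 <= e / 2.
  apply: (@le_trans _ _ ((`|a| + 1) * C1)); first by rewrite ler_wpM2r// lerDl.
  move: C1e; rewrite ltr_pdivlMr; last by pos.
  by lra.
lra.
Qed.

(** The product is its own approximant in the closure: it has the largest exponents and mean zero in
    each variable. *)
Lemma product_test_tensor (f h : R -> R) (C C' : R) :
  test_le lambda (with_exponents e1 p1) abs_le f C ->
  test_le lambda (with_exponents e2 p2) abs_le h C' ->
  Int f = 0 -> Int h = 0 -> product_test (fun x1 x2 => f x1 * h x2).
Proof.
move=> tf th f0 h0.
have ge0 (e : R) p (u : R -> R) (D : R) : 0 < basepoint p -> 0 < Defs.radius p -> 0 < e ->
    test_le lambda (with_exponents e p) abs_le u D -> 0 <= D.
  move=> b r e0 /test_leE[/(_ _ ltr01) + _]; rewrite /abs_le => k.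
  have w1 : 0 < w (with_exponents e p) 1 by exact: (@test_weight_gt0 _ _ lambda_gt0 (with_exponents e p)).
  by rewrite -(pmulr_lge0 _ w1); apply: le_trans k.
have G : product_G lambda (with_exponents e1 p1) (with_exponents e2 p2) (fun x y => f x * h y).
  by exists (C * C'); exact: ptest_tensor.
have G' : product_G lambda p1 p2 (fun x y => f x * h y).
  exists (C * C'); case: adm1 => _ _ k1 k2; case: adm2 => _ _ k3 k4.
  have C0 := ge0 _ _ _ _ b1 r1 e1_gt0 tf; have C0' := ge0 _ _ _ _ b2 r2 e2_gt0 th.
  by apply: ptest_tensor; [exact: (test_le_with_exponents r1 k1 k2 C0 tf)|exact: (test_le_with_exponents r2 k3 k4 C0' th)].
have d0 : (fun x y => f x * h y) - (fun x y => f x * h y) = (fun x y => 0 * (f x * h y) + 0 * (f x * h y)).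
  by apply/funext => x; apply/funext => y; rewrite mul0r addr0; exact: subrr.
have t0 : ptest ((fun x y => f x * h y) - (fun x y => f x * h y)) 0.
  rewrite subrr; case: G' => D hD.
  have D0 := ptest_ge0 b1 r1 d1 b2 r2 d2 hD.
  have w1 x : 0 < x -> 0 <= w p1 x by move=> x0; exact/ltW/test_weight_gt0.
  by apply/test_leE; split => *; apply/test_leE; split => *; rewrite !mul0r /abs_le ?subrr normr0.
split => // e e0; exists (fun x y => f x * h y); split => //.
- split => [x x0|y y0].
    have dh : dominated e2 h by exact: (@test_le_dominated _ _ lambda_gt0 (with_exponents e2 p2)) th.
    by have := functionalZ (Int_functional lambda_gt0 e2_gt0) (f x) dh; rewrite /Int -/(Int h) h0 mulr0.
  have df : dominated e1 f by exact: (@test_le_dominated _ _ lambda_gt0 (with_exponents e1 p1)) tf.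
  have := functionalZ (Int_functional lambda_gt0 e1_gt0) (h y) df.
  by rewrite f0 mulr0 => <-; congr (Rintegral _ _ _); apply/funext => x; rewrite mulrC.
- by exists 0.
exact: le_lt_trans (product_test_norm_le b1 r1 d1 b2 r2 d2 t0) e0.
Qed.

End product_test.
End product_test_functions.

(** * Little bmo is contained in product BMO *)

Section bmo_subset.
Context {R : realType}.
Variables (lambda : R) (lambda_gt0 : 0 < lambda).
Local Notation m := (bessel_measure lambda).
Local Notation mu := (bessel_measure2 lambda).
Local Notation Int := (Int lambda).
Local Notation wt := (wt lambda).

Lemma psi_test_le (D : dyadic_system R) (W : wavelet_basis lambda D) (p : test_type R) i :
  0 < basepoint p -> 0 < Defs.radius p -> wavelet_index D i ->
  exists C, test_le lambda (with_exponents (eta W) p) abs_le (psi W i) C.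
Proof.
move=> b0 r0 wi; have e0 := eta_gt0 W.
have e20 : 0 < 2 * eta W by rewrite mulr_gt0.
have [E hE] := wt_lower lambda_gt0 e20.
have s0 : 0 < scale D i := scale_gt0 D i.1.
have [K [K0 hK]] := hE i.2 (scale D i) (index_gt0 wi) s0.
have [C [C0 h]] := psi_decay lambda_gt0 W E; have [h1 h2] := h _ wi.
have v0 := sqrt_wvol_gt0 lambda_gt0 wi.
pose A := C * (Num.sqrt (wvol lambda D i))^-1.
have A0 : 0 < A by rewrite /A; pos.
apply: (test_le_bump lambda_gt0 b0 r0 e0 s0 (C := A * K)).
  move=> x x0; apply: le_trans (h1 _ x0) _; rewrite -/A -mulrA ler_pM2l//; exact: hK.
move=> x y x0 y0 xy; apply: le_trans (h2 _ _ x0 y0 xy) _; rewrite -/A.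
have -> : forall q z : R, A * K * q * z = q * (A * (K * z)) by move=> *; ring.
by rewrite ler_wpM2l ?powR_ge0// ler_pM2l//; exact: hK.
Qed.

Lemma fine_le_real (q : \bar R) (v : R) : (q <= v%:E)%E -> (0 <= v) -> fine q <= v.
Proof. by case: q => [r| |] //=; rewrite ?lee_fin ?leye_eq. Qed.

Section product.
Variables (D1 D2 : dyadic_system R).
Variables (W1 : wavelet_basis lambda D1) (W2 : wavelet_basis lambda D2).
Local Notation cube1 := (wavelet_cube D1).
Local Notation cube2 := (wavelet_cube D2).

(** The inner sum is a supremum of finite partial sums, and the rectangles of a partial sum have
    their union inside Omega. Hence a bound by the measure of this union, for finite [S], is
    enough. *)
Lemma product_bmo_norm_lty (F : (R -> R -> R) -> R) (K : R) : 0 <= K ->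
  (forall S : seq ((int * R) * (int * R)), uniq S ->
    (forall p, p \in S -> wavelet_index D1 p.1 /\ wavelet_index D2 p.2) ->
    \sum_(p <- S) (wavelet_coef W1 W2 F p) ^+ 2 <= K * fine (mu (incidence cube1 cube2 S))) ->
  (product_bmo_norm W1 W2 F < +oo)%E.
Proof.
move=> K0 FK; apply: (@le_lt_trans _ _ (sqrte K%:E)); last by rewrite /sqrte ltry.
apply: ge_ereal_sup => _ [Om [oO OQ Ofin] <-].
have mO : measurable Om by exact: open_measurable_plane.
have muO : mu Om = (fine (mu Om))%:E by rewrite fineK// ge0_fin_numE.
set v := fine (mu Om) in muO *.
have v0 : 0 <= v by exact: fine_ge0.
rewrite lee_sqrt ?lee_fin//.
set I := [set i | _].
suff h : (\esum_(i in I) (`|wavelet_coef W1 W2 F i| ^+ 2)%:E <= (K * v)%:E)%E.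
  apply: le_trans (lee_wpmul2l _ h) _; first by rewrite lee_fin invr_ge0.
  (* The normalization cancels [v] unless Omega is a null set, in which case the left side is 0. *)
  rewrite -EFinM lee_fin mulrCA; have [->|vn] := eqVneq v 0; first by rewrite !mulr0.
  by rewrite mulVf// mulr1.
apply: ge_ereal_sup => _ [A [finA AI] <-].
rewrite fsbig_finite//= sumEFin lee_fin.
set S := finmap.enum_fset _.
have SA p : p \in S -> I p.
  by move=> pS; apply: AI; apply: set_mem; rewrite -in_fset_set.
have wS p : p \in S -> wavelet_index D1 p.1 /\ wavelet_index D2 p.2 by move=> /SA[].
rewrite (eq_bigr (fun p => (wavelet_coef W1 W2 F p) ^+ 2)); last by move=> p _; rewrite real_normK// num_real.
apply: le_trans (FK S (finmap.fset_uniq _) wS) _; apply: ler_wpM2l; first exact: K0.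
have mS : measurable (incidence cube1 cube2 S).
  apply: measurable_incidence => p /wS[[w1 _] [w2 _]]; exact: cube_measurable.
have SO : incidence cube1 cube2 S `<=` Om by move=> z [p /SA[_ _ sO] h]; exact: sO.
apply: fine_le_real v0; rewrite -muO; apply: le_measure; rewrite ?inE.
- exact: mS.
- exact: mO.
- exact: SO.
Qed.

Section distributions.
Variables (p1 p2 : test_type R).
Hypotheses (adm1 : admissible (eta W1) p1) (adm2 : admissible (eta W2) p2).
Local Notation product_test := (product_test lambda (eta W1) (eta W2) p1 p2).

Let b1 : 0 < basepoint p1. Proof. by case: adm1. Qed.
Let r1 : 0 < Defs.radius p1. Proof. by case: adm1. Qed.
Let s1 : 0 < regularity p1. Proof. by case: adm1 => _ _ /andP[]. Qed.
Let d1 : 0 < decay p1. Proof. by case: adm1 => _ _ _ /andP[]. Qed.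
Let b2 : 0 < basepoint p2. Proof. by case: adm2. Qed.
Let r2 : 0 < Defs.radius p2. Proof. by case: adm2. Qed.
Let s2 : 0 < regularity p2. Proof. by case: adm2 => _ _ /andP[]. Qed.
Let d2 : 0 < decay p2. Proof. by case: adm2 => _ _ _ /andP[]. Qed.

Lemma product_test_psi i : wavelet_index D1 i.1 -> wavelet_index D2 i.2 ->
  product_test (fun x1 x2 => psi W1 i.1 x1 * psi W2 i.2 x2).
Proof.
move=> w1 w2; have [C hC] := psi_test_le W1 b1 r1 w1; have [C' hC'] := psi_test_le W2 b2 r2 w2.
by apply: (product_test_tensor lambda_gt0 adm1 adm2 hC hC'); exact: psi_mean0.
Qed.

Lemma bmo_product_test_pairing b : bmo lambda b -> exists2 K, 0 <= K &
  forall f C, product_test_le lambda p1 p2 f C ->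
  mu.-integrable (quadrant R) (fun z => (b z * f z.1 z.2)%:E) /\
  `|\int[mu]_(z in quadrant R) (b z * f z.1 z.2)| <= K * C.
Proof.
move=> bb; have [K [K0 hK]] := bmo_pairing lambda_gt0 bb d1 d2.
have [C0 [C00 hC]] := ptest_wt lambda_gt0 b1 r1 d1 b2 r2 d2.
exists (C0 * K); first by rewrite mulr_ge0// ltW.
move=> f C hf.
have mf := measurable_ptest lambda_gt0 b1 r1 s1 d1 b2 r2 s2 d2 hf.
have [|i1 i2] := hK _ (C * C0) mf; first by move=> x y x0 y0; exact: hC.
by split => //; apply: (le_trans i2); rewrite le_eqVlt; apply/orP; left; apply/eqP; ring.
Qed.

Lemma bmo_distribution b F : bmo lambda b ->
  (forall f, product_test f -> F f = \int[mu]_(z in quadrant R) (b z * f z.1 z.2)) ->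
  Defs.distribution lambda (eta W1) (eta W2) p1 p2 F.
Proof.
move=> bb FE; have [K K0 hK] := bmo_product_test_pairing bb.
have mQ := @measurable_quadrant R.
split.
  move=> a f g tf tg; rewrite !FE//; last exact: product_test_lin.
  have [[[C hf] _] [[C' hg] _]] := (tf, tg).
  have [if_ _] := hK _ _ hf; have [ig _] := hK _ _ hg.
  rewrite -RintegralZl// -RintegralD//; last exact: (integrableZl mQ a if_).
  by apply: eq_Rintegral => z _; ring.
exists K => f tf; rewrite FE//; case: tf => Gf _.
by apply: (le_product_test_norm K0 Gf) => C hC; case: (hK _ _ hC).
Qed.

Theorem bmo_distributions_subset : bmo_distributions W1 W2 p1 p2 `<=` product_BMO W1 W2 p1 p2.
Proof.
move=> F [b bb FE]; split; first exact: bmo_distribution bb FE.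
have [N [N0 BN]] := pairing_form_bmo lambda_gt0 bb d1 d2.
have [C [C0 fw]] := form_wavelets lambda_gt0 W1 W2 d1 d2.
apply: (@product_bmo_norm_lty F (C * N ^+ 2)); first by pos.
move=> S uS wS; rewrite -mulrA; apply: le_trans (fw _ _ S BN N0 uS wS).
rewrite big_seq [leRHS]big_seq le_eqVlt; apply/orP; left; apply/eqP.
by apply: eq_bigr => p /wS[w1 w2]; rewrite /wavelet_coef FE//; exact: product_test_psi.
Qed.

End distributions.
End product.
End bmo_subset.

(** * The logarithm *)

Section logarithm.
Context {R : realType}.
Variables (lambda : R) (lambda_gt0 : 0 < lambda).
Local Notation m := (bessel_measure lambda).
Local Notation vol := (vol lambda).
Local Notation Int := (Int lambda).
Local Notation wt := (wt lambda).
Local Notation dominated := (dominated lambda).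
Local Notation dominated_functional := (dominated_functional lambda).
Local Notation bmo_functional := (bmo_functional lambda).
Local Notation itv_mean := (itv_mean lambda).
Local Notation itvoc a b := (`]a, b]%classic : set R).

Lemma integral_indic_Rplus (A : set R) : measurable A ->
  (\int[m]_(x in Rplus R) (\1_A x)%:E = m A)%E.
Proof.
move=> mA; rewrite integral_indic//; last exact: measurable_Rplus.
exact: bessel_measure_setIRplus.
Qed.

(** The amount by which ln stays below its supremum over (0, b], extended by zero. *)
Definition log_defect (b x : R) : R := (ln b - ln x) * \1_(itvoc 0 b) x.

Lemma measurable_log_defect b (A : set R) : measurable_fun A (log_defect b).
Proof.
apply: measurable_funM; last exact: measurable_indic.
by apply: measurable_funB => //; apply: measurable_funTS; exact: measurable_ln.
Qed.

Lemma log_defect_ge0 b x : 0 <= log_defect b x.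
Proof.
rewrite /log_defect indicE; case: (boolP (x \in _)) => [|_]; last by rewrite mulr0.
rewrite inE /= in_itv/= => /andP[x0 xb]; rewrite mulr1 subr_ge0.
by rewrite ler_ln ?posrE//; exact: lt_le_trans xb.
Qed.

(** For x between b / 2^(j+1) and b / 2^j the defect is at most (j + 1) ln 2 <= j + 1, while (0, b /
    2^j] has at most a multiple of 2^-j times the volume of (0, b]. The sum of (j + 1) 2^-j is at
    most 4, and [c1] is the constant in the lower bound for the volume of (0, b]. *)
Lemma log_defect_integral : exists C : R, 0 < C /\ forall b, 0 < b ->
  (\int[m]_(x in Rplus R) (log_defect b x)%:E <= (C * vol (itvoc 0 b))%:E)%E.
Proof.
pose c1 : R := 2^-1 / 2 * 2^-1 `^ (2 * lambda).
have c10 : 0 < c1 by rewrite /c1; pos.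
exists (4 / c1); split; first by pos.
move=> b b0; have l0 := lambda_gt0.
have p2 j : 0 < (2 : R) ^+ j by exact: exprn_gt0.
have B0 : 0 < b `^ (2 * lambda + 1) by exact: powR_gt0.
have lower : c1 * b `^ (2 * lambda + 1) <= vol (itvoc 0 b).
  apply: le_trans (vol_itv_ge lambda_gt0 (lexx 0) b0).
  rewrite add0r subr0; apply: le_trans (vol_ball_ge lambda_gt0 _ _); [|by lra|by lra].
  rewrite -splitr powRM; [|lra|lra].
  rewrite powRDp// powRr1; last exact: ltW.
  by rewrite /c1 le_eqVlt; apply/orP; left; apply/eqP; ring.
have upper j : vol (itvoc 0 (b / 2 ^+ j)) <= b `^ (2 * lambda + 1) * 2^-1 ^+ j.
  have bj : 0 < b / 2 ^+ j by rewrite divr_gt0.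
  rewrite -lee_fin (@volE _ _ lambda_gt0 _ (b / 2 ^+ j))//; last first.
    by move=> x /=; rewrite in_itv/= => /andP[].
  apply: le_trans (bessel_measure_itv0_le lambda_gt0 bj) _; rewrite lee_fin.
  rewrite powRM; [|exact: ltW|by rewrite invr_ge0 ltW].
  rewrite ler_pM2l// -exprVn.
  have q0 : 0 <= 2^-1 ^+ j :> R by pos.
  have q1 : 2^-1 ^+ j <= 1 :> R by apply: exprn_ile1; lra.
  rewrite powRD; last by apply/implyP => _; rewrite gt_eqF// exprn_gt0//; lra.
  rewrite powRr1// ler_piMl//.
  have p1 : (1 : R) `^ (2 * lambda) = 1 by rewrite powR1.
  rewrite -[leRHS]p1.
  by apply: ge0_ler_powR; rewrite ?nnegrE//; lra.
have sumle n : \sum_(0 <= j < n) (j.+1%:R * 2^-1 ^+ j) <= 4 :> R.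
  suff -> : \sum_(0 <= j < n) (j.+1%:R * 2^-1 ^+ j) = 4 - (2 * n + 4)%:R * 2^-1 ^+ n :> R.
    by rewrite lerBlDr lerDl; apply: mulr_ge0 => //; pos.
  elim: n => [|n IH]; first by rewrite big_geq// muln0 add0n expr0; ring.
  by rewrite big_nat_recr//= IH exprS !natrD !natrM -natr1; field.
apply: (@integral_le_nneseries _ _ _ m (Rplus R) _
  (fun j x => (j.+1%:R)%:E * (\1_(itvoc 0 (b / 2 ^+ j)) x)%:E)%E
  (fun j => b `^ (2 * lambda + 1) * (j.+1%:R * 2^-1 ^+ j))).
- exact: measurable_Rplus.
- by apply/measurable_EFinP; exact: measurable_log_defect.
- by move=> x _; rewrite lee_fin; exact: log_defect_ge0.
- by move=> j; apply: measurable_funeM; apply/measurable_EFinP; exact: measurable_indic.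
- by move=> j x _; rewrite mule_ge0// lee_fin.
- move=> x x0; have x0' : 0 < x by exact: x0.
  case: (leP x b) => xb; last first.
    exists 0; rewrite /log_defect indicE memNset ?mulr0 ?mule_ge0 ?lee_fin//.
    by rewrite /= in_itv/= x0' leNgt xb.
  have ex : exists j : nat, b < x * 2 ^+ j.+1.
    exists (Num.truncn (b / x)); rewrite mulrC -ltr_pdivrMr//.
    apply: lt_le_trans (truncnS_gt _) _.
    by rewrite -natrX ler_nat; exact/ltnW/ltn_expl.
  case: (ex_minnP ex) => j bj jmin; exists j.
  have xj : x <= b / 2 ^+ j.
    rewrite ler_pdivlMr//; case: j jmin {bj} => [|j] jmin; first by rewrite expr0 mulr1.
    by rewrite leNgt; apply/negP => /jmin; rewrite ltnn.
  rewrite /log_defect !indicE !mem_set /=; [|by rewrite in_itv/= x0' xj|by rewrite in_itv/= x0' xb].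
  rewrite mulr1 mule1 lee_fin.
  have : ln b <= ln (x * 2 ^+ j.+1) by rewrite ler_ln ?posrE// ?mulr_gt0// ltW.
  rewrite lnM ?posrE// lnXn// -[_ *+ j.+1]mulr_natr => h.
  have l2 : ln 2 <= 1 :> R by have := @le_ln1Dx R 1 ltac:(lra); rewrite (_ : 1 + 1 = 2 :> R)//.
  have : ln 2 * j.+1%:R <= 1 * j.+1%:R :> R by apply: ler_wpM2r.
  by lra.
- move=> j; rewrite ge0_integralZl_EFin//; last 2 first.
  + exact: measurable_Rplus.
  + by apply/measurable_EFinP; exact: measurable_indic.
  rewrite integral_indic_Rplus// -(@volE _ _ lambda_gt0 _ (b / 2 ^+ j))//; last first.
    by move=> x /=; rewrite in_itv/= => /andP[].
  rewrite -EFinM lee_fin mulrCA ler_wpM2l//; exact: upper.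
- move=> n; rewrite -mulr_sumr.
  apply: (@le_trans _ _ (b `^ (2 * lambda + 1) * 4)); first by rewrite ler_pM2l.
  rewrite mulrAC ler_pdivlMr// (_ : _ * 4 * c1 = 4 * (c1 * b `^ (2 * lambda + 1))); last by ring.
  by rewrite ler_pM2l.
Qed.

(* The defect to the supremum has integral at most a multiple of the volume,
   whether the interval is short or comparable to its distance to the origin. *)
Lemma log_oscillation : exists C : R, 0 < C /\ forall a b, 0 <= a -> a < b ->
  m.-integrable (Rplus R) (fun x => ((ln b - ln x) * \1_(itvoc a b) x)%:E) /\
  \int[m]_(x in Rplus R) `|(ln b - ln x) * \1_(itvoc a b) x| <= C * vol (itvoc a b).
Proof.
have [C [C0 hC]] := log_defect_integral; have [kap [kap1 vb]] := vol_bisect lambda_gt0.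
have kap0 : 0 < kap by lra.
exists (C * kap + 1); split; first by pos.
move=> a b a0 ab; have b0 : 0 < b by exact: le_lt_trans ab.
pose f x := (ln b - ln x) * \1_(itvoc a b) x.
have mf : measurable_fun (Rplus R) f.
  apply: measurable_funM; last exact: measurable_indic.
  by apply: measurable_funB => //; apply: measurable_funTS; exact: measurable_ln.
have vE : (vol (itvoc a b))%:E = m (itvoc a b).
  by apply: (@volE _ _ lambda_gt0 _ b) => // x /=; rewrite in_itv/= => /andP[].
have v0 : 0 <= vol (itvoc a b) by exact: vol_ge0.
have le : (\int[m]_(x in Rplus R) `|f x|%:E <= ((C * kap + 1) * vol (itvoc a b))%:E)%E.
  have maf : measurable_fun (Rplus R) (fun x => `|f x|%:E) by apply/measurable_EFinP; exact: measurableT_comp.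
  have fE x : 0 < x -> `|f x| = f x.
    move=> x0; rewrite ger0_norm// /f indicE; case: (boolP (x \in _)) => [|_]; last by rewrite mulr0.
    rewrite inE /= in_itv/= => /andP[_ xb]; rewrite mulr1 subr_ge0 ler_ln ?posrE//.
  (* If b/2 <= a, then ln b - ln x <= ln 2 <= 1 on the interval. Otherwise (a, b] contains (b/2, b],
     so its volume is comparable to that of (0, b]. *)
  case: (leP (b / 2) a) => ba.
    apply: (@le_trans _ _ (\int[m]_(x in Rplus R) (\1_(itvoc a b) x)%:E)%E).
      apply: ge0_le_integral => //; first exact: measurable_Rplus.
        by apply/measurable_EFinP; exact: measurable_indic.
      move=> x x0; rewrite lee_fin fE// /f !indicE; case: (boolP (x \in _)) => [|_]; last by rewrite mulr0.
      rewrite inE /= in_itv/= => /andP[ax xb]; rewrite mulr1.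
      have xp : 0 < x by exact: x0.
      have : ln b <= ln (x * 2) by rewrite ler_ln ?posrE//; lra.
      rewrite lnM ?posrE//.
      have l2 : ln 2 <= 1 :> R by have := @le_ln1Dx R 1 ltac:(lra); rewrite (_ : 1 + 1 = 2 :> R)//.
      by lra.
    rewrite integral_indic_Rplus// -vE lee_fin mulrDl mul1r lerDr; pos.
  apply: (@le_trans _ _ (\int[m]_(x in Rplus R) (log_defect b x)%:E)%E).
    apply: ge0_le_integral => //; first exact: measurable_Rplus.
      by apply/measurable_EFinP; exact: measurable_log_defect.
    move=> x x0; rewrite lee_fin fE//; apply: (le_trans _ (_ : f x <= _)) => //.
    rewrite /f /log_defect !indicE; case: (boolP (x \in itvoc a b)) => [xab|_].
      rewrite mem_set//; move: xab; rewrite inE /= !in_itv/= => /andP[_ ->].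
      by rewrite andbT; exact: x0.
    by rewrite mulr0 -indicE; exact: log_defect_ge0.
  apply: (le_trans (hC _ b0)); rewrite lee_fin.
  have [_ h1] := vb 0 b (lexx 0) b0; rewrite add0r in h1.
  have h2 : vol (itvoc (b / 2) b) <= vol (itvoc a b).
    apply: (@le_vol _ _ lambda_gt0 _ _ b) => //.
      by move=> x [/=]; rewrite !in_itv/= => /andP[h3 ->] _; rewrite andbT; exact: lt_trans h3.
    by move=> x /=; rewrite in_itv/= => /andP[].
  apply: (@le_trans _ _ (C * (kap * vol (itvoc a b)))).
    rewrite ler_wpM2l ?(ltW C0)//; apply: (le_trans h1); rewrite ler_wpM2l// ltW//.
  by rewrite mulrDl mulrA mul1r lerDl.
have If : m.-integrable (Rplus R) (EFin \o f).
  apply/integrableP; split; first exact/measurable_EFinP.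
  by apply: le_lt_trans (ltry ((C * kap + 1) * vol (itvoc a b))); exact: le.
split => //; rewrite -lee_fin; apply: le_trans le; rewrite /Rintegral fineK//.
apply: integrable_fin_num; first exact: measurable_Rplus.
exact: (integrable_norm If).
Qed.

(** On (0, 1] this is [log_oscillation]; for x > 1, ln x is at most (2/g) (1 + x)^(g/2), at the cost
    of half the decay. *)
Lemma integrable_ln_wt (g : R) : 0 < g ->
  m.-integrable (Rplus R) (fun x => (`|ln x| * wt g x)%:E).
Proof.
move=> g0; have [C [_ hC]] := log_oscillation.
have [i1 _] := hC 0 1 (lexx 0) ltr01.
have g20 : 0 < g / 2 by rewrite divr_gt0.
have i2 := integrable_wt lambda_gt0 g20.
have mR := @measurable_Rplus R.
have i3 := integrableD mR (integrable_norm i1) (integrableZl mR (2 / g) i2).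
apply: (le_integrable mR _ _ i3).
  apply/measurable_EFinP/measurable_funM; last exact: measurable_wt.
  by apply: measurableT_comp => //; apply: measurable_funTS; exact: measurable_ln.
move=> x x0; have xp : 0 < x by exact: x0.
rewrite /= lee_fin ln1 sub0r normrM normr_id (ger0_norm (ltW (wt_gt0 lambda g xp))).
apply: le_trans (ler_norm _); rewrite normrM normrN.
have w0 := wt_gt0 lambda g xp; have w20 := wt_gt0 lambda (g / 2) xp.
case: (leP x 1) => x1.
  rewrite indicE mem_set /=; last by rewrite in_itv/= xp.
  rewrite normr1 mulr1; apply: ler_wpDr; first by pos.
  by rewrite ler_piMr//; exact: wt_le1.
apply: ler_wpDl; first by pos.
have lx : 0 <= ln x by rewrite ln_ge0// ltW.
rewrite ger0_norm//.
have -> : wt (g / 2) x = (1 + x) `^ (g / 2) * wt g x.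
  by rewrite /wt -powRDp; [congr powR; field|lra].
rewrite mulrA ler_pM2r// mulrC mulrA ler_pdivlMr// mulrC.
have h : ln x <= ln (1 + x) by rewrite ler_ln ?posrE//; lra.
have h2 : ln ((1 + x) `^ (g / 2)) < (1 + x) `^ (g / 2) by apply: ln_sublinear; apply: powR_gt0; lra.
rewrite ln_powR in h2.
have : g / 2 * ln x <= g / 2 * ln (1 + x) by rewrite ler_pM2l.
by lra.
Qed.

Definition ln_pairing (h : R -> R) : R := Int (fun x => ln x * h x).

Lemma integrable_ln (g : R) h : 0 < g -> dominated g h ->
  m.-integrable (Rplus R) (EFin \o (fun x => ln x * h x)).
Proof.
move=> g0 [mh [C Ch]]; have mR := @measurable_Rplus R.
have i1 := integrableZl mR C (integrable_ln_wt g0).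
apply: (le_integrable mR _ _ i1).
  by apply/measurable_EFinP/measurable_funM => //; apply: measurable_funTS; exact: measurable_ln.
move=> x x0; rewrite /= lee_fin; apply: le_trans (ler_norm _).
by rewrite normrM mulrCA ler_wpM2l//; exact: Ch.
Qed.

Lemma ln_pairing_functional (g : R) : 0 < g -> exists K, dominated_functional g ln_pairing K.
Proof.
move=> g0; have mR := @measurable_Rplus R.
exists (\int[m]_(x in Rplus R) (`|ln x| * wt g x)); split.
  move=> a f h df dh; have i1 := integrable_ln g0 df; have i2 := integrable_ln g0 dh.
  rewrite /ln_pairing /Int -RintegralZl// -RintegralD//; last exact: (integrableZl mR a i1).
  by apply: eq_Rintegral => x _; ring.
move=> C f df Cf; have i1 := integrable_ln g0 df; have i2 := integrable_ln_wt g0.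
apply: le_trans (le_normr_Rintegral mR i1) _.
rewrite -RintegralZl//; apply: le_Rintegral => //.
- exact: (integrable_norm i1).
- exact: (integrableZl mR C i2).
by move=> x x0; rewrite normrM mulrCA ler_wpM2l//; exact: Cf.
Qed.

(** Subtracting a constant from ln does not change the quantity to be bounded, and ln b is the
    constant for which [log_oscillation] controls the difference. The factor 2 counts the difference
    once against [f] and once through its mean. *)
Lemma ln_pairing_bmo : exists N : R, 0 < N /\ bmo_functional ln_pairing N.
Proof.
have [C [C0 hC]] := log_oscillation; exists (2 * C); split; first by pos.
move=> a b f M a0 ab mf fM fS; have b0 : 0 < b by exact: le_lt_trans ab.
have mR := @measurable_Rplus R.
have [i1 I1] := hC a b a0 ab; pose u x := (ln b - ln x) * \1_(itvoc a b) x; rewrite -/u in i1 I1.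
have v0 := vol_itv_gt0 lambda_gt0 a0 ab.
have pairE (h : R -> R) : dominated 1 h -> (forall x, 0 < x -> x <= a \/ b < x -> h x = 0) ->
    ln_pairing h = ln b * Int h - \int[m]_(x in Rplus R) (u x * h x) /\
    m.-integrable (Rplus R) (EFin \o (fun x => u x * h x)).
  move=> dh hS; have i2 := integrable_ln ltr01 dh; have i3 := dominated_integrable lambda_gt0 ltr01 dh.
  have i4 := integrableZl mR (ln b) i3.
  have i5 := integrableB mR i4 i2.
  have E x : 0 < x -> u x * h x = ln b * h x - ln x * h x.
    move=> x0; rewrite /u indicE; case: (boolP (x \in _)) => [_|/notin_itvoc xI]; first by rewrite mulr1; ring.
    by rewrite hS// !mulr0 subrr.
  have i6 : m.-integrable (Rplus R) (EFin \o (fun x => u x * h x)).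
    by move: i5; apply: eq_integrable => // x /set_mem x0; rewrite /= -EFinD E.
  split => //; have -> : ln b * Int h = \int[m]_(x in Rplus R) (ln b * h x) by rewrite RintegralZl.
  rewrite -RintegralB//.
  by apply: eq_Rintegral => x /set_mem x0; rewrite E//; ring.
have df : dominated 1 f.
  by apply: (dominated_bounded lambda_gt0 ltr01 b0 mf fM) => x bx; apply: fS; [exact: lt_trans bx|right].
have d1 : dominated 1 (\1_(itvoc a b)) by exact: dominated_itv.
have S1 x : 0 < x -> x <= a \/ b < x -> \1_(itvoc a b) x = 0 :> R.
  move=> x0 h; rewrite indicE memNset//= in_itv/= => /andP[h1 h2]; case: h => h.
    by move: (lt_le_trans h1 h); rewrite ltxx.
  by move: (lt_le_trans h h2); rewrite ltxx.
have [-> if_] := pairE f df fS; rewrite /itv_mean; have [-> ih] := pairE _ d1 S1.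
rewrite Int_itv.
set If := \int[m]_(x in _) _; set I1' := \int[m]_(x in _) (_ * \1_(_) x).
set v := vol _ in v0 I1 *.
have -> : ln b * Int f - If - (ln b * v - I1') / v * Int f = I1' / v * Int f - If.
  by field; rewrite gt_eqF.
have M0 : 0 <= M by apply: le_trans (fM _ ltr01).
have b1 : `|If| <= M * (C * v).
  apply: le_trans (le_normr_Rintegral mR if_) _.
  apply: (@le_trans _ _ (\int[m]_(x in Rplus R) (M * `|u x|))).
    apply: le_Rintegral => //; first exact: (integrable_norm if_).
      exact: (integrableZl mR M (integrable_norm i1)).
    by move=> x x0; rewrite normrM mulrC ler_wpM2r//; exact: fM.
  by rewrite RintegralZl ?ler_wpM2l//; exact: (integrable_norm i1).
have b2 : `|I1'| <= C * v.
  apply: le_trans (le_normr_Rintegral mR ih) _; apply: le_trans I1.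
  apply: le_Rintegral => //; first exact: (integrable_norm ih).
    exact: (integrable_norm i1).
  move=> x x0; rewrite normrM ler_piMr//.
  by rewrite indicE; case: (_ \in _); rewrite ?normr1 ?normr0.
have b3 : `|Int f| <= M * v.
  rewrite /v -Int_itv -(functionalZ (Int_functional lambda_gt0 ltr01))//.
  apply: (Int_abs_le lambda_gt0 ltr01) => //; first exact: dominatedZ.
  move=> x x0; rewrite indicE; case: (boolP (x \in _)) => [_|/notin_itvoc xI]; first by rewrite mulr1; exact: fM.
  by rewrite fS// normr0 mulr0.
apply: le_trans (ler_normB _ _) _.
have : `|I1' / v * Int f| <= C * (M * v).
  rewrite normrM normrM (gtr0_norm (_ : 0 < v^-1)) ?invr_gt0//.
  by apply: ler_pM => //; [rewrite mulr_ge0// invr_ge0 ltW|rewrite ler_pdivrMr].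
move=> b4; rewrite (_ : 2 * C * M * v = C * (M * v) + M * (C * v)); last by ring.
exact: lerD.
Qed.

End logarithm.

(** * Strictness of the inclusion *)

Section strictness.
Context {R : realType}.
Variables (lambda : R) (lambda_gt0 : 0 < lambda).
Local Notation m := (bessel_measure lambda).
Local Notation mu := (bessel_measure2 lambda).
Local Notation vol := (vol lambda).
Local Notation Int := (Int lambda).
Local Notation wt := (wt lambda).
Local Notation dominated := (dominated lambda).
Local Notation dominated_functional := (dominated_functional lambda).
Local Notation bmo_functional := (bmo_functional lambda).
Local Notation ln_pairing := (ln_pairing lambda).
Local Notation itvoc a b := (`]a, b]%classic : set R).

Section product.
Variables (D1 D2 : dyadic_system R).
Variables (W1 : wavelet_basis lambda D1) (W2 : wavelet_basis lambda D2).
Local Notation cube1 := (wavelet_cube D1).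
Local Notation cube2 := (wavelet_cube D2).

(* The one-parameter Carleson estimate in x_1 bounds the sum over the first
   cubes by an integral in x_1, to which the estimate in x_2 applies. *)
Lemma carleson_tensor : exists C : R, 0 < C /\
  forall g1 g2 (L1 L2 : (R -> R) -> R) K1 K2 N1 N2 (S : seq ((int * R) * (int * R))),
  0 < g1 -> 0 < g2 -> dominated_functional g1 L1 K1 -> dominated_functional g2 L2 K2 ->
  bmo_functional L1 N1 -> bmo_functional L2 N2 -> 0 < N1 -> 0 < N2 -> uniq S ->
  (forall p, p \in S -> wavelet_index D1 p.1 /\ wavelet_index D2 p.2) ->
  \sum_(p <- S) (L1 (psi W1 p.1) * L2 (psi W2 p.2)) ^+ 2 <=
  C * ((N1 * N2) ^+ 2 * fine (mu (incidence cube1 cube2 S))).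
Proof.
have [C1 [C10 cw1]] := carleson_wavelets lambda_gt0 W1.
have [C2 [C20 cw2]] := carleson_wavelets lambda_gt0 W2.
exists (C1 * C2); split; first by pos.
move=> g1 g2 L1 L2 K1 K2 N1 N2 S g10 g20 LK1 LK2 LN1 LN2 N10 N20 uS wS.
have [c1 [c11 cb1]] := wavelet_cube_ball D1.
have [c2 [c21 cb2]] := wavelet_cube_ball D2.
pose t p := (`|p.1.2| + c1 * scale D1 p.1) + (`|p.2.2| + c2 * scale D2 p.2).
have t1 p : 0 <= `|p.1.2| + c1 * scale D1 p.1.
  by have := scale_gt0 D1 p.1.1 => ?; rewrite addr_ge0// mulr_ge0//; [lra|exact: ltW].
have t2 (p : (int * R) * (int * R)) : 0 <= `|p.2.2| + c2 * scale D2 p.2.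
  by have := scale_gt0 D2 p.2.1 => ?; rewrite addr_ge0// mulr_ge0//; [lra|exact: ltW].
pose X := 1 + \sum_(p <- S) t p.
have X0 : 0 < X by rewrite /X ltr_pwDl// sumr_ge0// => p _; rewrite addr_ge0.
have tX p : p \in S -> t p <= X.
  move=> pS; rewrite /X (big_rem p)//= addrCA lerDl addr_ge0//.
  by apply: sumr_ge0 => q _; rewrite addr_ge0.
have mc1 p : p \in S -> measurable (cube1 p.1).
  by move=> /wS[[w _] _]; exact: (cube_measurable w).
have mc2 p : p \in S -> measurable (cube2 p.2).
  by move=> /wS[_ [w _]]; exact: (cube_measurable w).
have c1X p x : p \in S -> cube1 p.1 x -> x <= X.
  move=> pS hc; have [w _] := wS _ pS; apply: le_trans (ball_le (cb1 _ w _ hc)) _.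
  apply: le_trans (tX _ pS); rewrite /t; apply: ler_wpDr => //.
  by rewrite lerD2r ler_norm.
have c2X p x : p \in S -> cube2 p.2 x -> x <= X.
  move=> pS hc; have [_ w] := wS _ pS; apply: le_trans (ball_le (cb2 _ w _ hc)) _.
  apply: le_trans (tX _ pS); rewrite /t; apply: ler_wpDl => //.
  by rewrite lerD2r ler_norm.
pose Q := incidence cube1 cube2 S.
have [dv IvE] : dominated 1 (fun x => vol (xsection Q x)) /\ Int (fun x => vol (xsection Q x)) = fine (mu Q).
  exact: (Int_xsection_incidence lambda_gt0 mc1 mc2 c1X c2X ltr01 X0).
pose js := undup [seq p.2 | p <- S].
pose SJ j := [seq p.1 | p <- S & p.2 == j].
have SJP i j : i \in SJ j -> (i, j) \in S.
  by move=> /mapP[[i' j']]; rewrite mem_filter /= => /andP[/eqP -> pS] ->.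
have uSJ j : uniq (SJ j).
  rewrite map_inj_in_uniq ?filter_uniq// => -[i1 j1] [i2 j2].
  by rewrite !mem_filter /= => /andP[/eqP -> _] /andP[/eqP -> _] ->.
pose U j : set R := [set x | exists2 i, i \in SJ j & cube1 i x].
have mU j : measurable (U j).
  rewrite (_ : U j = \big[setU/set0]_(i <- SJ j | i \in SJ j) cube1 i).
    by apply: bigsetU_measurable => i /SJP/mc1.
  by rewrite -big_seq -bigcup_seq; apply/seteqP; split => x [i si hx]; exists i.
have UX j x : U j x -> x <= X by move=> [i /SJP ijS]; exact: (c1X _ _ ijS).
pose a i := L1 (psi W1 i); pose d j := L2 (psi W2 j).
have dU j : dominated 1 (fun x => d j ^+ 2 * \1_(U j) x).
  by apply: dominatedZ; exact: (dominated_indic lambda_gt0 ltr01 (mU j) (@UX j)).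
have IF := Int_functional lambda_gt0 (@ltr01 R).
rewrite (sum_pairs_snd S (fun i j => (a i * d j) ^+ 2)) -/js.
apply: (@le_trans _ _ (\sum_(j <- js) C1 * N1 ^+ 2 * Int (fun x => d j ^+ 2 * \1_(U j) x))).
  apply: ler_sum => j _.
  rewrite (eq_bigr (fun i => (a i) ^+ 2 * (d j) ^+ 2)); last by move=> i _; rewrite exprMn.
  rewrite -mulr_suml (functionalZ IF); last exact: (dominated_indic lambda_gt0 ltr01 (mU j) (@UX j)).
  rewrite (Int_indic lambda (mU j) (@UX j)) [leLHS]mulrC.
  have -> : forall q v : R, C1 * N1 ^+ 2 * (q * v) = q * (C1 * (N1 ^+ 2 * v)) by move=> *; ring.
  apply: ler_wpM2l; first exact: sqr_ge0.
  apply: (cw1 g1 L1 K1 N1 _ _ X g10 LK1 LN1 N10 (uSJ j)) => //.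
  - by move=> i /SJP/wS[].
  - exact: UX.
  - by move=> i si x hx; exists i.
rewrite -mulr_sumr -(functional_sum IF)//.
have -> : C1 * C2 * ((N1 * N2) ^+ 2 * fine (mu Q)) = C1 * N1 ^+ 2 * (C2 * N2 ^+ 2 * fine (mu Q)) by ring.
rewrite ler_wpM2l//; first by pos.
rewrite -IvE -(functionalZ IF)//; apply: (le_Int lambda_gt0 ltr01); [exact: dominated_sum|exact: dominatedZ|].
move=> x x0.
have -> : \sum_(j <- js) d j ^+ 2 * \1_(U j) x = \sum_(j <- [seq j <- js | x \in U j]) d j ^+ 2.
  rewrite big_filter [RHS]big_mkcond; apply: eq_bigr => j _; rewrite indicE.
  by case: (_ \in _); rewrite ?mulr1 ?mulr0.
rewrite -mulrA; apply: (cw2 g2 L2 K2 N2 _ _ X g20 LK2 LN2 N20) => //.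
- by rewrite filter_uniq// undup_uniq.
- by move=> j; rewrite mem_filter mem_undup => /andP[_ /mapP[p pS ->]]; case: (wS _ pS).
- exact: measurable_xsection_incidence.
- by move=> y; rewrite xsection_incidence => -[p pS [_ h]]; exact: c2X h.
- move=> j; rewrite mem_filter => /andP[/set_mem[i /SJP ijS bx] _] y hy.
  by rewrite xsection_incidence; exists (i, j).
Qed.

(** An iterated pairing avoids integrability in two variables: the inner pairing of a test function
    is a test function of x1. *)
Definition ln_tensor (f : R -> R -> R) : R := ln_pairing (fun x1 => ln_pairing (f x1)).

Variables (p1 p2 : test_type R).
Hypotheses (adm1 : admissible (eta W1) p1) (adm2 : admissible (eta W2) p2).
Local Notation product_test := (product_test lambda (eta W1) (eta W2) p1 p2).

Let b1 : 0 < basepoint p1. Proof. by case: adm1. Qed.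
Let r1 : 0 < Defs.radius p1. Proof. by case: adm1. Qed.
Let s1 : 0 < regularity p1. Proof. by case: adm1 => _ _ /andP[]. Qed.
Let d1 : 0 < decay p1. Proof. by case: adm1 => _ _ _ /andP[]. Qed.
Let b2 : 0 < basepoint p2. Proof. by case: adm2. Qed.
Let r2 : 0 < Defs.radius p2. Proof. by case: adm2. Qed.
Let s2 : 0 < regularity p2. Proof. by case: adm2 => _ _ /andP[]. Qed.
Let d2 : 0 < decay p2. Proof. by case: adm2 => _ _ _ /andP[]. Qed.

Lemma ln_tensor_distribution : Defs.distribution lambda (eta W1) (eta W2) p1 p2 ln_tensor.
Proof.
have [K1 LK1] := ln_pairing_functional lambda_gt0 d1.
have [K2 LK2] := ln_pairing_functional lambda_gt0 d2.
have [K2' K20 hK2] := ptest_functional lambda_gt0 b1 r1 d1 b2 r2 s2 d2 LK2.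
have [K1' K10 hK1] := test_le_functional lambda_gt0 b1 r1 s1 d1 LK1.
split.
  move=> a f g [[C hf] _] [[C' hg] _].
  have df := test_le_dominated lambda_gt0 b1 r1 s1 d1 (hK2 _ _ hf).
  have dg := test_le_dominated lambda_gt0 b1 r1 s1 d1 (hK2 _ _ hg).
  have dfg := test_le_dominated lambda_gt0 b1 r1 s1 d1 (hK2 _ _ (product_test_le_lin a hf hg)).
  rewrite /ln_tensor -(functional_lin LK1)//; apply: (functional_ext LK1 dfg).
    exact: dominated_lin.
  move=> x x0; rewrite -(functional_lin LK2)//.
    exact: (test_le_dominated lambda_gt0 b2 r2 s2 d2 (ptest_slice hf x0)).
  exact: (test_le_dominated lambda_gt0 b2 r2 s2 d2 (ptest_slice hg x0)).
exists (K2' * K1') => f [Gf _]; apply: (le_product_test_norm _ Gf); first by rewrite mulr_ge0.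
move=> C hf; have C0 := ptest_ge0 lambda_gt0 b1 r1 d1 b2 r2 d2 hf.
have -> : K2' * K1' * C = C * K2' * K1' by ring.
by apply: hK1; [rewrite mulr_ge0|exact: hK2].
Qed.

Lemma ln_tensorM (f h : R -> R) g1 g2 : 0 < g1 -> 0 < g2 -> dominated g1 f -> dominated g2 h ->
  ln_tensor (fun x1 x2 => f x1 * h x2) = ln_pairing f * ln_pairing h.
Proof.
move=> g10 g20 df dh; have [K1 LK1] := ln_pairing_functional lambda_gt0 g10.
have [K2 LK2] := ln_pairing_functional lambda_gt0 g20.
rewrite /ln_tensor mulrC -(functionalZ LK1)//; congr ln_pairing; apply/funext => x.
by rewrite (functionalZ LK2)// mulrC.
Qed.

Lemma ln_tensor_product_BMO : product_BMO W1 W2 p1 p2 ln_tensor.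
Proof.
split; first exact: ln_tensor_distribution.
have [K1 LK1] := ln_pairing_functional lambda_gt0 d1.
have [K2 LK2] := ln_pairing_functional lambda_gt0 d2.
have [N [N0 LN]] := ln_pairing_bmo lambda_gt0.
have [C [C0 ct]] := carleson_tensor.
apply: (@product_bmo_norm_lty _ _ _ _ W1 W2 _ (C * (N * N) ^+ 2)); first by pos.
move=> S uS wS; rewrite -mulrA.
apply: le_trans (ct _ _ _ _ _ _ _ _ _ d1 d2 LK1 LK2 LN LN N0 N0 uS wS).
rewrite big_seq [leRHS]big_seq le_eqVlt; apply/orP; left; apply/eqP.
apply: eq_bigr => p /wS[w1 w2]; rewrite /wavelet_coef.
by rewrite (ln_tensorM d1 d2)//; exact: dominated_psi.
Qed.

End product.
End strictness.

(** * Normalized tents at the origin *)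

Section tents.
Context {R : realType}.
Variables (lambda : R) (lambda_gt0 : 0 < lambda).
Local Notation vol := (vol lambda).
Local Notation Int := (Int lambda).
Local Notation wt := (wt lambda).
Local Notation dominated := (dominated lambda).
Local Notation dominated_functional := (dominated_functional lambda).
Local Notation ln_pairing := (ln_pairing lambda).
Local Notation itvoc a b := (`]a, b]%classic : set R).

Lemma test_le_lipschitz (p : test_type R) (e K M X : R) (f : R -> R) :
  0 < basepoint p -> 0 < Defs.radius p -> 0 < e -> e <= 1 -> 0 <= K -> 0 < X ->
  (forall x y, 0 < x -> 0 < y -> `|f x - f y| <= K * `|x - y|) ->
  (forall x, 0 < x -> `|f x| <= M) -> (forall x, X < x -> f x = 0) ->
  exists C, test_le lambda (with_exponents e p) abs_le f C.
Proof.
move=> b0 r0 e0 e1 K0 X0 fK fM fX.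
have e20 : 0 < 2 * e by rewrite mulr_gt0.
have X10 : 0 < X + 1 by rewrite addr_gt0.
have M0 : 0 <= M by apply: le_trans (fM _ ltr01).
have wX : 0 < wt (2 * e) (X + 1) by exact: wt_gt0.
(* When |x - y| <= 1, either x <= X + 1 and the weight is at least its value at X + 1, or [f]
   vanishes at both points. *)
pose C := (M + K) / wt (2 * e) (X + 1).
apply: (test_le_bump lambda_gt0 b0 r0 e0 ltr01 (C := C)).
  apply: (wt_bounded lambda_gt0 e20 X10) => [x x0|x xX].
    by apply: le_trans (fM _ x0) _; rewrite lerDl.
  by apply: fX; apply: lt_trans xX; rewrite ltrDl.
move=> x y x0 y0 xy; rewrite divr1.
have w0 : 0 < wt (2 * e) x by exact: wt_gt0.
have pe : 0 <= `|x - y| `^ e by exact: powR_ge0.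
case: (leP x (X + 1)) => xX; last first.
  rewrite fX ?fX; [|by have := ler_norm (x - y); lra|by lra].
  by rewrite subrr normr0 /C; pos.
apply: le_trans (fK _ _ x0 y0) _.
apply: (@le_trans _ _ ((M + K) * `|x - y| `^ e)).
  apply: (@le_trans _ _ (K * `|x - y| `^ e)); last by rewrite ler_wpM2r// lerDr.
  by rewrite ler_wpM2l//; exact: le_powR_unit.
have -> : C * `|x - y| `^ e * wt (2 * e) x =
    (M + K) * `|x - y| `^ e * (wt (2 * e) x / wt (2 * e) (X + 1)).
  by rewrite /C; field; rewrite gt_eqF.
apply: ler_peMr; first by rewrite mulr_ge0// addr_ge0.
by rewrite ler_pdivlMr// mul1r; exact: wt_ge.
Qed.

Definition tent (r x : R) : R := Num.max 0 (Num.min x (r - x)).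

Lemma tent_ge0 r x : 0 <= tent r x.
Proof. by rewrite /tent le_max lexx. Qed.

Lemma tent_le r x : 0 < r -> tent r x <= r / 2.
Proof. by move=> r0; rewrite /tent ge_max; apply/andP; split; [lra|rewrite ge_min; case: (leP x (r / 2)) => //= h; lra]. Qed.

Lemma tent_out r x : r < x -> tent r x = 0.
Proof. by move=> rx; apply/eqP; rewrite eq_le tent_ge0 /tent ge_max lexx ge_min; apply/andP; split => //=; apply/orP; right; lra. Qed.

Lemma tent_lip r x y : `|tent r x - tent r y| <= `|x - y|.
Proof.
have h u v : tent r u <= tent r v + `|u - v|.
  rewrite /tent ge_max; apply/andP; split; first by rewrite addr_ge0// le_max lexx.
  have h1 := ler_norm (u - v); have h2 := ler_norm (v - u); rewrite distrC in h2.
  rewrite -lerBlDr le_max; apply/orP; right; rewrite le_min !lerBlDr; apply/andP; split.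
    by rewrite ge_min; apply/orP; left; lra.
  by rewrite ge_min; apply/orP; right; lra.
rewrite ler_norml; have := h x y; have := h y x; rewrite distrC => h1 h2.
by apply/andP; split; lra.
Qed.

Lemma measurable_tent r : measurable_fun (Rplus R) (tent r).
Proof.
apply: (@hoelder_measurable _ _ (fun=> 1) 1 1) => // x y x0 y0 _.
by rewrite mulr1 divr1 powRr1// tent_lip.
Qed.

Lemma dominated_tent (g r : R) : 0 < g -> 0 < r -> dominated g (tent r).
Proof.
move=> g0 r0; apply: (dominated_bounded lambda_gt0 g0 r0 (measurable_tent r) (M := r / 2)).
  by move=> x _; rewrite ger0_norm ?tent_ge0// tent_le.
exact: tent_out.
Qed.

(** The tent is at least r/4 on (r/2, 3r/4], and two bisections compare the volume of this interval
    with that of (0, r]. *)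
Lemma Int_tent : exists c : R, 0 < c /\ forall r, 0 < r -> c * (r * vol (itvoc 0 r)) <= Int (tent r).
Proof.
have [kap [kap1 vb]] := vol_bisect lambda_gt0.
exists ((4 * kap ^+ 2)^-1); split; first by rewrite invr_gt0; pos.
move=> r r0; have r20 : 0 < r / 2 by rewrite divr_gt0.
have [_ h1] := vb 0 r (lexx 0) r0; rewrite add0r in h1.
have [h2 _] := vb (r / 2) r (ltW r20) ltac:(lra).
set q := (r / 2 + r) / 2 in h2.
have qr : q = 3 * r / 4 by rewrite /q; field.
have k0 : 0 < kap by lra.
have le1 : r / 4 * vol (itvoc (r / 2) q) <= Int (tent r).
  rewrite -Int_itv -(functionalZ (Int_functional lambda_gt0 ltr01)); last exact: dominated_itv.
  apply: (le_Int lambda_gt0 ltr01); [exact/dominatedZ/dominated_itv|exact: dominated_tent|].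
  move=> x x0; rewrite indicE; case: (boolP (x \in _)) => [|_]; last by rewrite mulr0 tent_ge0.
  rewrite inE /= in_itv/= qr => /andP[u1 u2]; rewrite mulr1 /tent le_max le_min.
  by apply/orP; right; apply/andP; split; lra.
apply: le_trans le1.
rewrite mulrC ler_pdivrMr; last by pos.
apply: (@le_trans _ _ (r * (kap * (kap * vol (itvoc (r / 2) q))))).
  rewrite ler_wpM2l ?(ltW r0)//; apply: (le_trans h1); rewrite ler_wpM2l// ltW//.
by rewrite le_eqVlt; apply/orP; left; apply/eqP; field.
Qed.

Definition unit_tent (r x : R) : R := (Int (tent r))^-1 * tent r x.

(** What matters is that [A] does not depend on [r]: the sup bound times the volume of (0, r] is the
    quantity that enters the bound of a bmo form. *)
Lemma unit_tent_facts : exists A : R, forall r, 0 < r ->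
  [/\ 0 < Int (tent r),
      Int (unit_tent r) = 1,
      (forall x, 0 <= unit_tent r x),
      (forall x, r < x -> unit_tent r x = 0) &
      exists M, (forall x, unit_tent r x <= M) /\ M * vol (itvoc 0 r) <= A].
Proof.
have [c [c0 hc]] := Int_tent; exists (2 * c)^-1 => r r0.
have v0 : 0 < vol (itvoc 0 r) by rewrite vol_itv_gt0.
have I0 : 0 < Int (tent r) by apply: lt_le_trans (hc _ r0); pos.
split => //.
- rewrite /unit_tent (functionalZ (Int_functional lambda_gt0 ltr01)); last exact: dominated_tent.
  by rewrite mulVf// gt_eqF.
- by move=> x; rewrite mulr_ge0 ?tent_ge0// invr_ge0 ltW.
- by move=> x rx; rewrite /unit_tent tent_out// mulr0.
exists ((Int (tent r))^-1 * (r / 2)); split.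
  by move=> x; rewrite ler_pM2l ?invr_gt0// tent_le.
rewrite -mulrA mulrC ler_pdivrMr//.
have := hc _ r0 => h; rewrite invfM.
have -> : r / 2 * vol (itvoc 0 r) = 2^-1 / c * (c * (r * vol (itvoc 0 r))) by field; rewrite gt_eqF.
by rewrite ler_wpM2l//; pos.
Qed.

Lemma dominated_unit_tent (g r : R) : 0 < g -> 0 < r -> dominated g (unit_tent r).
Proof. by move=> g0 r0; apply: dominatedZ; exact: dominated_tent. Qed.

(** A probability density carried by (0, r] averages ln to at most its value at r. *)
Lemma ln_pairing_unit_tent (r : R) : 0 < r -> ln_pairing (unit_tent r) <= ln r.
Proof.
move=> r0; have [A hA] := unit_tent_facts; have [_ I1 u0 uo _] := hA _ r0.
have du := dominated_unit_tent ltr01 r0.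
rewrite -[leRHS]mulr1 -I1 -(functionalZ (Int_functional lambda_gt0 ltr01))//.
apply: le_Rintegral; first exact: measurable_Rplus.
- exact: (integrable_ln lambda_gt0 ltr01 du).
- exact: (dominated_integrable lambda_gt0 ltr01 (dominatedZ (ln r) du)).
move=> x x0; case: (leP x r) => xr; last by rewrite uo// !mulr0.
by rewrite ler_wpM2r// ler_ln// posrE.
Qed.

End tents.

(** * The product of logarithms is not given by a bmo function *)

Section strict.
Context {R : realType}.
Variables (lambda : R) (lambda_gt0 : 0 < lambda).
Local Notation mu := (bessel_measure2 lambda).
Local Notation vol := (vol lambda).
Local Notation Int := (Int lambda).
Local Notation dominated := (dominated lambda).
Local Notation ln_pairing := (ln_pairing lambda).
Local Notation unit_tent := (unit_tent lambda).
Local Notation itvoc a b := (`]a, b]%classic : set R).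

(** The tent at scale 1 is subtracted to obtain mean zero; it changes the logarithmic pairing only
    by a constant. *)
Definition tent_gap (n : nat) (x : R) : R := unit_tent (2^-1 ^+ n) x - unit_tent 1 x.

Let pow_gt0 n : 0 < 2^-1 ^+ n :> R.
Proof. by rewrite exprn_gt0. Qed.

Lemma tent_gap_dominated (g : R) n : 0 < g -> dominated g (tent_gap n).
Proof. by move=> g0; apply: dominatedB; exact: dominated_unit_tent. Qed.

Lemma tent_gap_mean0 n : Int (tent_gap n) = 0.
Proof.
have [A hA] := unit_tent_facts lambda_gt0.
have [_ I1 _ _ _] := hA _ (pow_gt0 n); have [_ I2 _ _ _] := hA _ (@ltr01 R).
by rewrite (functionalB (Int_functional lambda_gt0 ltr01)) ?I1 ?I2 ?subrr//; exact: dominated_unit_tent.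
Qed.

Lemma tent_gap_test_le (p : test_type R) (e : R) n : 0 < basepoint p -> 0 < Defs.radius p ->
  0 < e -> e <= 1 -> exists C, test_le lambda (with_exponents e p) abs_le (tent_gap n) C.
Proof.
move=> b0 r0 e0 e1; have [A hA] := unit_tent_facts lambda_gt0.
have [i1 _ u1 o1 [M1 [m1 _]]] := hA _ (pow_gt0 n); have [i2 _ u2 o2 [M2 [m2 _]]] := hA _ (@ltr01 R).
pose K := (Int (tent (2^-1 ^+ n)))^-1 + (Int (tent 1))^-1.
have lip r x y : 0 < Int (tent r) -> `|unit_tent r x - unit_tent r y| <= (Int (tent r))^-1 * `|x - y|.
  by move=> i; rewrite -mulrBr normrM gtr0_norm ?invr_gt0// ler_pM2l ?invr_gt0// tent_lip.
apply: (@test_le_lipschitz _ _ lambda_gt0 p e K (M1 + M2) 1) => //.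
- by rewrite addr_ge0// invr_ge0 ltW.
- move=> x y _ _; rewrite /tent_gap mulrDl.
  have -> : unit_tent (2^-1 ^+ n) x - unit_tent 1 x - (unit_tent (2^-1 ^+ n) y - unit_tent 1 y) =
    (unit_tent (2^-1 ^+ n) x - unit_tent (2^-1 ^+ n) y) - (unit_tent 1 x - unit_tent 1 y) by ring.
  by apply: le_trans (ler_normB _ _) _; apply: lerD; exact: lip.
- move=> x _; apply: le_trans (ler_normB _ _) _; rewrite !ger0_norm//.
  by apply: lerD; [exact: m1|exact: m2].
- move=> x x1; rewrite /tent_gap o1 ?o2 ?subrr//; apply: le_lt_trans x1.
  by apply: exprn_ile1; lra.
Qed.

Lemma ln_pairing_tent_gap n : ln_pairing (tent_gap n) <= - (n%:R * ln 2) - ln_pairing (unit_tent 1).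
Proof.
have [K LK] := ln_pairing_functional lambda_gt0 (@ltr01 R).
rewrite (functionalB LK); [|exact: dominated_unit_tent|exact: dominated_unit_tent].
rewrite lerD2r; apply: le_trans (ln_pairing_unit_tent lambda_gt0 (pow_gt0 n)) _.
by rewrite lnXn ?invr_gt0// lnV ?posrE// mulNrn mulr_natl.
Qed.

Lemma ln_pairing_tent_gap_unbounded (B : R) : exists n, ln_pairing (tent_gap n) < - B.
Proof.
pose l := ln_pairing (unit_tent 1).
have l2 : 0 < ln 2 :> R by rewrite ln_gt0// ltr1n.
exists (Num.truncn ((B - l) / ln 2)).+1; apply: le_lt_trans (ln_pairing_tent_gap _) _.
have := truncnS_gt ((B - l) / ln 2); rewrite ltr_pdivrMr// -/l.
by lra.
Qed.

Section not_bmo.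
Variables (b : R * R -> R) (g1 g2 : R) (N : R) (k : nat).
Hypotheses (g1_gt0 : 0 < g1) (g2_gt0 : 0 < g2) (N_gt0 : 0 < N).
Hypothesis bN : bmo_form lambda g1 g2 (pairing_form lambda b) N.

(* In the second variable the mean over an interval is invisible, so that a
   bmo form does not see the logarithmic growth at 0 in the first variable. *)
Lemma bmo_form_tent_gap : exists B, forall n,
  `|pairing_form lambda b (tent_gap n) (tent_gap k)| <= B.
Proof.
have [A hA] := unit_tent_facts lambda_gt0.
have [_ _ u1 o1 [M1 [m1 _]]] := hA _ (pow_gt0 k); have [_ _ u2 o2 [M2 [m2 _]]] := hA _ (@ltr01 R).
have [B1 _ B3] := bN.
have dk : dominated g2 (tent_gap k) by exact: tent_gap_dominated.
have [K LK] := B1 _ dk.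
have main r : 0 < r -> `|pairing_form lambda b (unit_tent r) (tent_gap k)| <=
    N * A * (M1 + M2) * vol (itvoc 0 1).
  move=> r0; have [_ _ u o [M [mM MA]]] := hA _ r0.
  (* Here the term with the mean vanishes because [tent_gap k] has integral 0, and the bound of [M]
     times the volume of (0, r] by [A] removes the dependence on [r]. *)
  have := B3 0 r 0 1 (unit_tent r) (tent_gap k) M (M1 + M2) (lexx 0) r0 (lexx 0) ltr01.
  rewrite tent_gap_mean0 !mulr0 subr0 => h.
  apply: le_trans (h _ _ _ _ _ _) _.
  - by case: (dominated_unit_tent lambda_gt0 ltr01 r0).
  - by case: (tent_gap_dominated k (@ltr01 R)).
  - by move=> x _; rewrite ger0_norm.
  - move=> x _; apply: le_trans (ler_normB _ _) _; rewrite !ger0_norm//.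
    by apply: lerD; [exact: m1|exact: m2].
  - by move=> x x0 [h0|rx]; [move: (lt_le_trans x0 h0); rewrite ltxx|exact: o].
  - move=> x x0 [h0|x1]; first by move: (lt_le_trans x0 h0); rewrite ltxx.
    by rewrite /tent_gap o1 ?o2 ?subrr//; apply: le_lt_trans x1; apply: exprn_ile1; lra.
  have v0 := vol_ge0 lambda (itvoc 0 1).
  have M0 : 0 <= M1 + M2 by apply: addr_ge0; [exact: le_trans (u1 0) (m1 0)|exact: le_trans (u2 0) (m2 0)].
  have -> : N * M * (M1 + M2) * (vol (itvoc 0 r) * vol (itvoc 0 1)) =
     (M * vol (itvoc 0 r)) * (N * (M1 + M2) * vol (itvoc 0 1)) by ring.
  have -> : N * A * (M1 + M2) * vol (itvoc 0 1) = A * (N * (M1 + M2) * vol (itvoc 0 1)) by ring.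
  by apply: ler_wpM2r => //; pos.
exists (2 * (N * A * (M1 + M2) * vol (itvoc 0 1))) => n.
rewrite (functionalB LK); [|exact: dominated_unit_tent|exact: dominated_unit_tent].
apply: le_trans (ler_normB _ _) _; rewrite mulr2n mulrDl mul1r; apply: lerD; exact: main.
Qed.

End not_bmo.

Variables (D1 D2 : dyadic_system R).
Variables (W1 : wavelet_basis lambda D1) (W2 : wavelet_basis lambda D2).
Variables (p1 p2 : test_type R).
Hypotheses (adm1 : admissible (eta W1) p1) (adm2 : admissible (eta W2) p2).

Lemma ln_tensor_not_bmo : ~ bmo_distributions W1 W2 p1 p2 (ln_tensor lambda).
Proof.
move=> [b bb FE].
have [b1 r1 _ /andP[d1 _]] := adm1; have [b2 r2 _ /andP[d2 _]] := adm2.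
have [N [N0 BN]] := pairing_form_bmo lambda_gt0 bb d1 d2.
(* [k] comes first: it makes the second factor less than -1, and the bound [B] depends on it. Then
   [n] is chosen for this [B]. *)
have [k lk] := ln_pairing_tent_gap_unbounded 1.
have [B hB] := bmo_form_tent_gap k d1 d2 N0 BN.
have [n ln] := ln_pairing_tent_gap_unbounded B.
have [C hC] := tent_gap_test_le n b1 r1 (eta_gt0 W1) (eta_le1 W1).
have [C' hC'] := tent_gap_test_le k b2 r2 (eta_gt0 W2) (eta_le1 W2).
have t := product_test_tensor lambda_gt0 adm1 adm2 hC hC' (tent_gap_mean0 n) (tent_gap_mean0 k).
have := hB n; rewrite /pairing_form -(FE _ t).
rewrite (ln_tensorM lambda_gt0 d1 d2); [|exact: tent_gap_dominated|exact: tent_gap_dominated].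
have B0 : 0 <= B by apply: le_trans (hB 0).
rewrite leNgt normrM => /negP; apply.
rewrite (ltr0_norm (_ : ln_pairing (tent_gap n) < 0)); last by lra.
rewrite (ltr0_norm (_ : ln_pairing (tent_gap k) < 0)); last by lra.
apply: lt_le_trans (_ : - ln_pairing (tent_gap n) <= _); first by lra.
by rewrite ler_peMr//; lra.
Qed.

End strict.

(** Absolute convergence is part of the claim, since a divergent integral would take a default value
    and [bmo_distributions] would lose its meaning. *)
Theorem corollary1p5 (R : realType) (lambda : R) (lambda_gt0 : 0 < lambda)
    (D1 D2 : dyadic_system R)
    (W1 : wavelet_basis lambda D1) (W2 : wavelet_basis lambda D2)
    (p1 p2 : test_type R)
    (p1_adm : admissible (eta W1) p1) (p2_adm : admissible (eta W2) p2) :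
  (forall b f, bmo lambda b -> product_test lambda (eta W1) (eta W2) p1 p2 f ->
    (bessel_measure2 lambda).-integrable (quadrant R)
      (fun z => (b z * f z.1 z.2)%:E)) /\
  bmo_distributions W1 W2 p1 p2 `<` product_BMO W1 W2 p1 p2.
Proof.
split.
  move=> b f bb [[C hf] _].
  by have [K _ hK] := bmo_product_test_pairing lambda_gt0 p1_adm p2_adm bb; case: (hK _ _ hf).
split; first exact: bmo_distributions_subset.
by move=> /(_ _ (ln_tensor_product_BMO lambda_gt0 p1_adm p2_adm)); exact: ln_tensor_not_bmo.
Qed.
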